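(* There is a universal constant $c$ such that the following holds for all positive integers $n$ and $k$. Let $M$ be a random $n\times n$ unitary matrix distributed according to Haar measure on the unitary group $\mathcal{U}_n$, and let $A_1,\ldots,A_k$ be fixed $n\times n$ matrices over $\mathbb{C}$ such that $\operatorname{Tr}(A_iA_j^* )=n\delta_{ij}$ for all $1\le i,j\le k$. Let $$W=W(M)=(\operatorname{Tr}(A_1M),\ldots,\operatorname{Tr}(A_kM))\in\mathbb{C}^k$$ and let $Z$ be a standard complex Gaussian random vector in $\mathbb{C}^k$. Then $$d_W(W,Z)\le\frac{ck}{n}.$$
   Context: $A^*$ is the conjugate transpose; $\delta_{ij}$ is the Kronecker delta. $\mathbb{C}^k$ is identified with $\mathbb{R}^{2k}$. A standard complex Gaussian random vector in $\mathbb{C}^k$ is one whose corresponding random vector in $\mathbb{R}^{2k}$ is a centered Gaussian with covariance matrix $\frac12I_{2k}$. The Wasserstein distance is $d_W(X,Y)=\sup\left|\mathbb{E}g(X)-\mathbb{E}g(Y)\right|$, the supremum being over real-valued functions $g$ on $\mathbb{C}^k\cong\mathbb{R}^{2k}$ with Lipschitz constant (with respect to the Euclidean norm) at most $1$. ''Universal'' means that $c$ does not depend on $n$, $k$, or the matrices $A_i$. *)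

(* Defs.v *)
From HB Require Import structures.
From mathcomp Require Import all_boot all_order all_algebra spectral.
From mathcomp Require Import complex.
From mathcomp Require Import all_classical all_reals all_analysis.

Set Implicit Arguments.
Unset Strict Implicit.
Unset Printing Implicit Defensive.

Import Order.TTheory GRing.Theory Num.Theory.
Import numFieldNormedType.Exports.

Local Open Scope classical_set_scope.
Local Open Scope ring_scope.
Local Open Scope complex_scope.
Local Open Scope sesquilinear_scope.

(* The Borel sets of the complex matrices, identified with the space of their
   real coordinates: on R^N the Borel sigma-algebra is the one generated by the
   coordinates. *)
Definition cmx_cylinder (R : realType) (m n : nat) :
    set (set 'M[R[i]]_(m, n)) :=
  [set B | exists (i : 'I_m) (j : 'I_n) (E : set R), measurable E /\
     (B = [set A : 'M[R[i]]_(m, n) | E (complex.Re (A i j))] \/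
      B = [set A : 'M[R[i]]_(m, n) | E (complex.Im (A i j))])].

Definition borel_cmx (R : realType) (m n : nat) : set (set 'M[R[i]]_(m, n)) :=
  <<s @cmx_cylinder R m n >>.

Definition random_cmx (R : realType) (d : measure_display)
    (T : measurableType d) (m n : nat) (X : T -> 'M[R[i]]_(m, n)) : Prop :=
  forall B, borel_cmx B -> measurable (X @^-1` B).

Definition unitary_group (R : realType) (n : nat) : set 'M[R[i]]_n :=
  [set U | U \is unitarymx].

(* Haar measure of U_n, as a Borel measure on all n x n matrices carried by
   U_n: the left translation invariant one of total mass 1. *)
Definition is_haar_unitary (R : realType) (n : nat)
    (mu : set 'M[R[i]]_n -> \bar R) : Prop :=
  mu (@unitary_group R n) = 1%E /\
  forall (U : 'M[R[i]]_n) (B : set 'M[R[i]]_n),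
    unitary_group U -> borel_cmx B -> mu (mulmx U @` B) = mu B.

Definition haar_random_unitary (R : realType) (d : measure_display)
    (T : measurableType d) (P : probability T R) (n : nat)
    (M : T -> 'M[R[i]]_n) : Prop :=
  [/\ random_cmx M,
      forall w, unitary_group (M w) &
      is_haar_unitary (fun B => P (M @^-1` B))].

(* The identification of C^k with R^(2k). *)
Definition realify (R : realType) (k : nat) (z : 'rV[R[i]]_k) :
    'rV[R]_(k + k) :=
  row_mx (map_mx (@complex.Re R) z) (map_mx (@complex.Im R) z).

(* The library norm on matrices is the sup norm, hence not the one below. *)
Definition euclidean_norm (R : realType) (d : nat) (x : 'rV[R]_d) : R :=
  Num.sqrt (\sum_(i < d) x ord0 i ^+ 2).

Definition lipschitz1 (R : realType) (k : nat) (g : 'rV[R[i]]_k -> R) : Prop :=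
  forall x y, `|g x - g y| <= euclidean_norm (realify x - realify y).

(* X and Y may live on different probability spaces, since only their laws
   matter. *)
Definition dW (R : realType) (k : nat)
    (d : measure_display) (T : measurableType d) (P : probability T R)
    (X : T -> 'rV[R[i]]_k)
    (d' : measure_display) (T' : measurableType d') (P' : probability T' R)
    (Y : T' -> 'rV[R[i]]_k) : \bar R :=
  ereal_sup [set `| 'E_P[g \o X] - 'E_P'[g \o Y] |%E | g in @lipschitz1 R k].

(* Subfamilies are covered by taking E i = setT for the other indices. *)
Definition mutually_independent (R : realType) (d : measure_display)
    (T : measurableType d) (P : probability T R) (l : nat)
    (X : 'I_l -> T -> R) : Prop :=
  forall E : 'I_l -> set R, (forall i, measurable (E i)) ->
    P [set w | forall i, E i (X i w)] = (\prod_(i < l) P (X i @^-1` E i))%E.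

Definition iid_standard_normal (R : realType) (d : measure_display)
    (T : measurableType d) (P : probability T R) (l : nat)
    (G : T -> 'rV[R]_l) : Prop :=
  [/\ forall i, measurable_fun setT (fun w => G w ord0 i),
      forall i (E : set R), measurable E ->
        P [set w | E (G w ord0 i)] = normal_prob 0 1 E &
      mutually_independent P (fun i w => G w ord0 i)].

(* X has law N(m, Sigma): X is an affine image m + G A of a vector G of
   independent N(0, 1) variables, which has covariance matrix A^T A.
   Degenerate Sigma are allowed: taking l to be the rank of Sigma, such a G
   always exists on the space where X is defined. *)
Definition gaussian_vector (R : realType) (d : measure_display)
    (T : measurableType d) (P : probability T R) (N : nat)
    (X : T -> 'rV[R]_N) (m : 'rV[R]_N) (Sigma : 'M[R]_N) : Prop :=
  (forall i, measurable_fun setT (fun w => X w ord0 i)) /\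
  exists (l : nat) (A : 'M[R]_(l, N)) (G : T -> 'rV[R]_l),
    [/\ iid_standard_normal P G,
        {ae P, forall w, X w = m + G w *m A} &
        A^T *m A = Sigma].

Definition standard_complex_gaussian (R : realType) (d : measure_display)
    (T : measurableType d) (P : probability T R) (k : nat)
    (Z : T -> 'rV[R[i]]_k) : Prop :=
  gaussian_vector P (fun w => realify (Z w)) 0 (2^-1)%:M.

(* Main.v *)
(* Let W be the vector of traces and X the Gaussian vector, both in R^(2k).
   A Lipschitz g is approximated, up to eta (1 + |x|^2), by trigonometric
   polynomials p with gradient of norm at most 2, so it suffices to compare
   E p(W) and E p(X).  With X independent of W, interpolate along
   phi(al) = E p(sin al W + cos al X); the X-expectation of cos(<xi, .> + th) is
   explicit, so that phi is an explicit combination of characteristic functions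
   of W and no product space is needed.

   Haar invariance along curves s |-> U_s in the unitary group gives integration
   by parts, E DF(M)(H) = 0 for every H, hence the Stein identity
   n E sin(l + th) l = 1/2 E cos(l + th) (Tr K K^* - Re Tr M K M K) with l = Re Tr M K.
   Therefore phi' only involves an error matrix with entries
   Re, Im Tr(M A_l M A_j), paired with the Hessian of p smoothed by X.  Gaussian
   integration by parts turns that Hessian into a gradient, and the error matrix has
   mean squared Hilbert-Schmidt norm at most 16 k^2, again by integration by parts.
   Integrating |phi'| <= 6 k / n over [0, pi/2] gives 12 k / n. *)

From HB Require Import structures.
From mathcomp Require Import all_boot all_order all_algebra spectral complex.
From mathcomp Require Import all_classical all_reals all_analysis.
From mathcomp Require Import measurable_realfun.
From mathcomp Require Import ring lra.
Require Import Defs.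

Set Implicit Arguments.
Unset Strict Implicit.
Unset Printing Implicit Defensive.

Import Order.TTheory GRing.Theory Num.Theory.
Import numFieldNormedType.Exports.

Local Open Scope classical_set_scope.
Local Open Scope ring_scope.

(** Trigonometric polynomials are used because Gaussian smoothing multiplies each of their terms by
    an explicit factor, so that every derivative along the path is that of a finite sum. An
    unbounded [g] is not a uniform limit of them, whence the weight 1 + |x|^2, which is harmless
    because both vectors have finite second moments. The delicate point is to control the gradient
    at the same time: a Fejer kernel averaged over a finite grid keeps the Lipschitz constant
    exactly along grid vectors, and the factor 2 pays for the other directions.

    The path (sin al, cos al) preserves the covariance, so the main term of the Stein identity
    cancels the derivative of the Gaussian factor. The remaining Hessian carries a factor cos al,
    and a Gaussian integration by parts costs exactly 1 / cos al: no singularity appears at either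
    end of the path. It also replaces the Hessian, which is not controlled, by the gradient in the
    direction of the transformed Gaussian vector, whose mean norm is at most the Hilbert-Schmidt
    norm of the error matrix. This is of order k, and the Stein identity supplies 1 / n. *)

Section quadratic_remainder.
Variable R : realType.
Implicit Types (f df : R -> R) (x y d C : R).

(** Derivatives of integrals are obtained from this criterion without dominated convergence: a
    quadratic bound on the remainder of the integrand integrates to one for the integral. *)
Lemma is_derive_quadratic f x d C :
  (forall y, `|y| <= 1 -> `|f (x + y) - f x - y * d| <= C * y ^+ 2) ->
  is_derive x 1 f d.
Proof.
move=> fC.
have C0 : 0 <= C.
  have := fC 1; rewrite normr1 expr1n mulr1 => /(_ (lexx _)).
  exact: le_trans.
have cv : h^-1 *: (f (h *: 1 + x) - f x) @[h --> 0^'] --> d.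
  apply/cvgrPdist_le => /= e e0; near=> h.
  have h0 : h != 0 by near: h; exact: nbhs_dnbhs_neq.
  have h1 : `|h| <= Num.min 1 (e / (C + 1)).
    near: h; apply: dnbhs0_le.
    by rewrite lt_min ltr01/= divr_gt0// ltr_wpDl.
  move: h1; rewrite le_min => /andP[h1 he].
  have -> : d - h^-1 *: (f (h *: 1 + x) - f x) =
      - (h^-1 * (f (x + h) - f x - h * d)).
    have sE (a b : R) : a *: b = a * b by [].
    by rewrite !sE mulr1 (addrC h); field.
  rewrite normrN normrM normfV ler_pdivrMl ?normr_gt0//.
  apply: le_trans (fC _ h1) _.
  rewrite -normr_id -(@real_normK _ h) ?num_real// expr2 mulrCA.
  rewrite normr_id ler_wpM2l// mulrC.
  apply: le_trans (_ : e / (C + 1) * (C + 1) <= _); last first.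
    by rewrite divfK// gt_eqF// ltr_wpDl.
  by rewrite ler_pM// lerDl.
split; first by apply/cvg_ex; exists d.
by apply/cvg_lim.
Unshelve. all: by end_near. Qed.

(** The mean value theorem gives the increment [y * df c] with [c] within [|y|] of [x]. The constant
    1 is worse than the 1/2 of Taylor's formula but suffices throughout. *)
Lemma MVT_quadratic f df x y :
  (forall z : R, is_derive z (1 : R) f (df z)) -> (forall a b, `|df a - df b| <= `|a - b|) ->
  `|f (x + y) - f x - y * df x| <= y ^+ 2.
Proof.
move=> fdf lip.
have cf A : {within A, continuous f}.
  apply: continuous_subspaceT => z; apply: differentiable_continuous.
  by apply/derivable1_diffP; case: (fdf z).
have [c cxy ->] : exists2 c, `|c - x| <= `|y| & f (x + y) - f x = y * df c.
  have [y0|y0] := leP 0 y.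
    have [|c /[!in_itv]/= /andP[xc cx] ->] :=
      @MVT_segment R f df x (x + y) _ (fun z _ => fdf z) (cf _).
      by rewrite lerDl.
    exists c; last by ring.
    by rewrite (ger0_norm y0) ger0_norm ?subr_ge0// lerBlDl.
  have [|c /[!in_itv]/= /andP[xc cx]] :=
    @MVT_segment R f df (x + y) x _ (fun z _ => fdf z) (cf _).
    by rewrite gerDl ltW.
  move=> h; exists c.
    by rewrite (ltr0_norm y0) ler0_norm ?subr_le0// opprB; lra.
  by rewrite -opprB h; ring.
rewrite -mulrBr normrM -real_normK ?num_real// expr2 ler_wpM2l//.
exact: le_trans (lip _ _) _.
Qed.

Lemma MVT_lipschitz f df x y L :
  (forall z : R, is_derive z (1 : R) f (df z)) -> (forall z, `|df z| <= L) ->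
  `|f x - f y| <= L * `|x - y|.
Proof.
move=> fdf lip.
wlog yx : x y / y <= x.
  move=> wl; have [|/ltW yx] := leP y x; first exact: wl.
  by rewrite distrC (distrC x); exact: wl.
have cf A : {within A, continuous f}.
  apply: continuous_subspaceT => z; apply: differentiable_continuous.
  by apply/derivable1_diffP; case: (fdf z).
have [c _ ->] := @MVT_segment R f df y x yx (fun z _ => fdf z) (cf _).
by rewrite normrM ler_wpM2r.
Qed.

Lemma cos_lipschitz x y : `|cos x - cos y| <= `|x - y|.
Proof.
rewrite -[leRHS]mul1r; apply: (@MVT_lipschitz _ (fun z => - sin z)) => z.

by rewrite normrN sin_max.
Qed.

Lemma sin_lipschitz x y : `|sin x - sin y| <= `|x - y|.
Proof.
rewrite -[leRHS]mul1r; apply: (@MVT_lipschitz _ (fun z => cos z)) => z.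
exact: cos_max.
Qed.

Lemma sin_remainder x y : `|sin (x + y) - sin x - y * cos x| <= y ^+ 2.
Proof. by apply: (@MVT_quadratic _ cos) => // a b; exact: cos_lipschitz. Qed.

Lemma cos_remainder x y : `|cos (x + y) - cos x + y * sin x| <= y ^+ 2.
Proof.
rewrite -[X in _ + X]opprK -mulrN.
apply: (@MVT_quadratic _ (fun z => - sin z)) => a b.
by rewrite -opprD normrN sin_lipschitz.
Qed.

Lemma sin_approx x : `|sin x - x| <= x ^+ 2.
Proof. by have := sin_remainder 0 x; rewrite add0r sin0 subr0 cos0 mulr1. Qed.

End quadratic_remainder.

(** * Euclidean structure on row vectors *)

Section dot_product.
Variables (R : realType) (d : nat).
Implicit Types (x y z : 'rV[R]_d) (c : R).

Definition dot x y : R := \sum_(i < d) x ord0 i * y ord0 i.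

Lemma dotDr x y z : dot x (y + z) = dot x y + dot x z.
Proof. by rewrite -big_split/=; apply: eq_bigr => i _; rewrite mxE mulrDr. Qed.

Lemma dotDl x y z : dot (x + y) z = dot x z + dot y z.
Proof. by rewrite -big_split/=; apply: eq_bigr => i _; rewrite mxE mulrDl. Qed.

Lemma dotZr c x y : dot x (c *: y) = c * dot x y.
Proof. by rewrite mulr_sumr; apply: eq_bigr => i _; rewrite mxE mulrCA. Qed.

Lemma dotZl c x y : dot (c *: x) y = c * dot x y.
Proof. by rewrite mulr_sumr; apply: eq_bigr => i _; rewrite mxE mulrA. Qed.

Lemma dotNr x y : dot x (- y) = - dot x y.
Proof. by rewrite -scaleN1r dotZr mulN1r. Qed.

Lemma dotNl x y : dot (- x) y = - dot x y.
Proof. by rewrite -scaleN1r dotZl mulN1r. Qed.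

Lemma dotBr x y z : dot x (y - z) = dot x y - dot x z.
Proof. by rewrite dotDr dotNr. Qed.

Lemma dotBl x y z : dot (x - y) z = dot x z - dot y z.
Proof. by rewrite dotDl dotNl. Qed.

Lemma dot0l x : dot 0 x = 0.
Proof. by rewrite /dot big1// => i _; rewrite mxE mul0r. Qed.

Lemma dot_delta i x : dot (delta_mx ord0 i) x = x ord0 i.
Proof.
rewrite /dot (bigD1 i)//= big1 => [|j ji]; first by rewrite mxE !eqxx mul1r addr0.
by rewrite mxE eqxx (negbTE ji) mul0r.
Qed.

Lemma dot_ge0 x : 0 <= dot x x.
Proof. by apply: sumr_ge0 => i _; rewrite -expr2 sqr_ge0. Qed.

Lemma ler_norm_dot c x y : (forall i, `|x ord0 i| <= c) ->
  `|dot x y| <= c * \sum_(i < d) `|y ord0 i|.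
Proof.
move=> xc; apply: le_trans (ler_norm_sum _ _ _) _.
by rewrite mulr_sumr; apply: ler_sum => i _; rewrite normrM ler_wpM2r.
Qed.

Lemma enormE x : euclidean_norm x = Num.sqrt (dot x x).
Proof. by congr Num.sqrt; apply: eq_bigr => i _; rewrite expr2. Qed.

Lemma enorm_ge0 x : 0 <= euclidean_norm x.
Proof. exact: sqrtr_ge0. Qed.

Lemma sqr_enorm x : euclidean_norm x ^+ 2 = dot x x.
Proof. by rewrite enormE sqr_sqrtr// dot_ge0. Qed.

Lemma enorm_le x y : (forall i, `|x ord0 i| <= `|y ord0 i|) ->
  euclidean_norm x <= euclidean_norm y.
Proof.
move=> xy; apply: ler_wsqrtr; apply: ler_sum => i _.
by rewrite -real_normK ?num_real// -[leRHS]real_normK ?num_real// lerXn2r ?nnegrE.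
Qed.

Lemma enormZ c x : euclidean_norm (c *: x) = `|c| * euclidean_norm x.
Proof. by rewrite !enormE dotZl dotZr mulrA -expr2 sqrtrM ?sqr_ge0// sqrtr_sqr. Qed.

Lemma ler_enorm_coord x i : `|x ord0 i| <= euclidean_norm x.
Proof.
rewrite -sqrtr_sqr; apply: ler_wsqrtr; rewrite (bigD1 i)//= lerDl.
by apply: sumr_ge0 => j _; rewrite sqr_ge0.
Qed.

Lemma enorm_le_sum x : euclidean_norm x <= \sum_(i < d) `|x ord0 i|.
Proof.
have s0 : 0 <= \sum_(i < d) `|x ord0 i| by apply: sumr_ge0.
rewrite -(ger0_norm s0) -sqrtr_sqr; apply: ler_wsqrtr.
rewrite expr2 mulr_suml; apply: ler_sum => i _.
rewrite -real_normK ?num_real// expr2 ler_wpM2l// (bigD1 i)//= lerDl.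
exact: sumr_ge0.
Qed.

End dot_product.

(** * Trigonometric polynomials and their differential *)

Section trig_polynomial.
Variables (R : realType) (d : nat) (I : finType).
Variables (a : I -> R) (xi : I -> 'rV[R]_d) (th : I -> R).
Implicit Types x v : 'rV[R]_d.

Definition trig_poly x := \sum_(i : I) a i * cos (dot (xi i) x + th i).

Definition trig_grad x v :=
  \sum_(i : I) - a i * sin (dot (xi i) x + th i) * dot (xi i) v.

Lemma trig_gradZ c x v : trig_grad x (c *: v) = c * trig_grad x v.
Proof.
by rewrite /trig_grad mulr_sumr; apply: eq_bigr => i _; rewrite dotZr mulrCA.
Qed.

Lemma trig_gradD x v w : trig_grad x (v + w) = trig_grad x v + trig_grad x w.
Proof.
by rewrite -big_split/=; apply: eq_bigr => i _; rewrite dotDr mulrDr.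
Qed.

Lemma trig_grad_le x v c : (forall i, `|dot (xi i) v| <= c) ->
  `|trig_grad x v| <= \sum_(i : I) `|a i| * c.
Proof.
move=> vc; apply: le_trans (ler_norm_sum _ _ _) _; apply: ler_sum => i _.
rewrite normrM normrM normrN -mulrA ler_wpM2l// -[leRHS]mul1r.
by rewrite ler_pM// sin_max.
Qed.

Lemma trig_poly_remainder x v c : (forall i, `|dot (xi i) v| <= c) ->
  `|trig_poly (x + v) - trig_poly x - trig_grad x v| <= \sum_(i : I) `|a i| * c ^+ 2.
Proof.
move=> vc; rewrite /trig_poly /trig_grad -!sumrB.
apply: le_trans (ler_norm_sum _ _ _) _; apply: ler_sum => i _.
have c0 : 0 <= c by apply: le_trans (vc i).
have -> : a i * cos (dot (xi i) (x + v) + th i) - a i * cos (dot (xi i) x + th i) -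
   - a i * sin (dot (xi i) x + th i) * dot (xi i) v =
   a i * (cos (dot (xi i) x + th i + dot (xi i) v) - cos (dot (xi i) x + th i) +
     dot (xi i) v * sin (dot (xi i) x + th i)).
  by rewrite dotDr (addrAC (dot _ x)); ring.
rewrite normrM ler_wpM2l//; apply: le_trans (cos_remainder _ _) _.
by rewrite -real_normK ?num_real// lerXn2r ?nnegrE.
Qed.

End trig_polynomial.

(** * Approximation by trigonometric polynomials *)

Section torus_grid.
Variable R : realType.
Implicit Types (x y : R).

Lemma cos_eq1 x : `|x| < pi *+ 2 -> cos x = 1 -> x = 0.
Proof.
wlog x0 : x / 0 <= x => [wl|].
  have [/wl//|x0] := leP 0 x => x2 cx.
  by apply/eqP; rewrite -oppr_eq0; apply/eqP/wl;
    rewrite ?normrN ?cosN// oppr_ge0 ltW.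
rewrite ger0_norm// => x2 cx; apply/eqP; rewrite eq_le x0 andbT leNgt.
apply/negP => xp.
have s0 : 0 < sin (x / 2) by apply: sin_gt0_pi; lra.
have : cos ((x / 2) *+ 2) = 1 by rewrite -mulr_natr divfK.
rewrite cos_mulr2n cos2sin2 => h.
have /eqP : sin (x / 2) ^+ 2 = 0 by move: h; rewrite -mulr_natr; lra.
by rewrite sqrf_eq0 gt_eqF.
Qed.

Lemma cosD2pin x n : cos (x + pi *+ 2 *+ n) = cos x.
Proof. by rewrite periodicn//; exact: cosD2pi. Qed.

Lemma sinD2pin x n : sin (x + pi *+ 2 *+ n) = sin x.
Proof. by rewrite periodicn//; exact: sinD2pi. Qed.

Variables (d q : nat).
Local Notation Y := 'rV['I_q.+1]_d.

(** Integer frequency vectors are represented as differences of two such rows. *)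
Definition nat_row (b : 'I_d -> nat) : 'rV[R]_d := \row_i (b i)%:R.

Definition angle (k : nat) : R := pi *+ 2 * k%:R / q.+1%:R.

Definition grid (y : Y) : 'rV[R]_d := \row_i angle (y ord0 i).

(** Addition of ordinals is modulo q + 1, so the grid is a finite subgroup of the torus and [angle]
    is additive up to a full period. *)
Lemma angleD (k l : 'I_q.+1) :
  angle k + angle l = angle (k + l)%R + pi *+ 2 *+ ((k + l) %/ q.+1)%N.
Proof.
rewrite /angle /= -mulrDl -mulrDr -natrD {1}(divn_eq (k + l) q.+1).
rewrite natrD natrM -[pi *+ 2 *+ _]mulr_natr.
by field.
Qed.

Lemma sin_gridD (y h : Y) i :
  sin (grid (y + h) ord0 i) = sin (grid y ord0 i + grid h ord0 i).
Proof. by rewrite !mxE angleD sinD2pin. Qed.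

Lemma dot_nat_gridD (b : 'I_d -> nat) (y h : Y) : exists k : nat,
  dot (nat_row b) (grid y + grid h) = dot (nat_row b) (grid (y + h)) + pi *+ 2 *+ k.
Proof.
exists (\sum_(i < d) b i * ((y ord0 i + h ord0 i) %/ q.+1))%N.
rewrite /dot -sumrMnr -big_split/=; apply: eq_bigr => i _.
rewrite !mxE angleD mulrDr mulnC mulrnA; congr (_ + _).
by rewrite mulr_natl.
Qed.

Lemma cos_gridD (b c : 'I_d -> nat) (y h : Y) t :
  cos (dot (nat_row b - nat_row c) (grid (y + h)) + t) =
  cos (dot (nat_row b - nat_row c) (grid y + grid h) + t).
Proof.
have [k bk] := dot_nat_gridD b y h; have [l cl] := dot_nat_gridD c y h.
rewrite !dotBl bk cl -[LHS](cosD2pin _ k) -[RHS](cosD2pin _ l).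
by congr cos; ring.
Qed.

(** Orthogonality of the characters of the grid. If b and c differ at i, translation by the unit
    vector [e] of coordinate i preserves the sum and moves the phase by [be]; averaging the
    translations by [e] and its opposite gives S = S cos be. As b i and c i are below q + 1, [be] is
    nonzero and smaller than 2 pi in absolute value, so S = 0. *)
Lemma sum_cos_grid (b c : 'I_d -> nat) t :
  (forall i, (b i < q.+1)%N) -> (forall i, (c i < q.+1)%N) ->
  \sum_(y : Y) cos (dot (nat_row b - nat_row c) (grid y) + t) =
  if [forall i, b i == c i] then #|{: Y}|%:R * cos t else 0.
Proof.
move=> bq cq; case: ifPn => [/forallP bc|].
  have -> : nat_row b = nat_row c.
    by apply/rowP => i; rewrite !mxE (eqP (bc i)).
  under eq_bigr do rewrite subrr dot0l add0r.
  by rewrite sumr_const mulr_natl.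
rewrite negb_forall => /existsP[i bci].
have q0 : (0 < q)%N.
  by case: q bq cq => // /(_ i) + /(_ i); case: (b i) (c i) bci => [|?] [|?].
pose e : Y := \row_k (if k == i then inord 1 else ord0).
set m := nat_row b - nat_row c.
pose S t := \sum_(y : Y) cos (dot m (grid y) + t).
pose be := dot m (grid e).
have shift t' : S t' = S (t' + be).
  rewrite /S (reindex_inj (addIr e))/=; apply: eq_bigr => y _.
  by rewrite cos_gridD dotDr -/be; congr cos; ring.
have : S t *+ 2 = S t *+ 2 * cos be.
  have h : S (t + be) + S (t - be) = S t *+ 2 * cos be.
    rewrite /S -big_split/= -sumrMnl mulr_suml; apply: eq_bigr => y _.
    by rewrite !addrA (cosD _ be) cosB; ring.
  by rewrite -h -shift -[in X in _ = _ + X](subrK be t) addrK (shift (t - be)) subrK mulr2n.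
have bE : be = pi *+ 2 * ((b i)%:R - (c i)%:R) / q.+1%:R.
  rewrite /be /dot (bigD1 i)//= big1 => [|j ji].
    by rewrite !mxE !eqxx/= /angle addr0 inordK//; ring.
  by rewrite !mxE (negbTE ji) /angle/= mulr0 mul0r mulr0.
move=> /eqP; rewrite -subr_eq0 -{1}(mulr1 (S t *+ 2)) -mulrBr mulf_eq0 => /orP[|].
  by rewrite mulrn_eq0/= => /eqP.
rewrite subr_eq0 eq_sym => /eqP /cos_eq1 => be0.
exfalso; have p2 : 0 < (pi : R) *+ 2 by rewrite pmulrn_lgt0// pi_gt0.
have : be = 0.
  apply: be0; rewrite bE -mulrA normrM gtr0_norm// -[ltRHS]mulr1 ltr_pM2l//.
  rewrite normrM normfV (ger0_norm (ler0n _ q.+1)) ltr_pdivrMr ?ltr0n// mul1r.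
  by rewrite ltr_norml ltrNl opprB !ltrBlDr -!natrD !ltr_nat !ltn_addr.
rewrite bE => /eqP; rewrite !mulf_eq0 invr_eq0 pnatr_eq0 orbF subr_eq0 eqr_nat.
by rewrite (negbTE bci) orbF gt_eqF.
Qed.

(** Two angles are needed since those of the grid are nonnegative. Rounding towards 0 gives the
    first bound, thanks to which the rounded vector is never longer than the original one. *)
Lemma grid_approx (t : R) : `|t| <= 1 -> exists a b : 'I_q.+1,
  `|angle a - angle b| <= `|t| /\ `|angle a - angle b - t| <= pi *+ 2 / q.+1%:R.
Proof.
have p2 : 0 < (pi : R) *+ 2 by rewrite pmulrn_lgt0// pi_gt0.
have q0 : 0 < q.+1%:R :> R by rewrite ltr0n.
have angle0 : angle 0 = 0 by rewrite /angle mulr0 mul0r.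
have step (s : R) : 0 <= s <= 1 -> exists a : 'I_q.+1,
    0 <= angle a <= s /\ s - angle a <= pi *+ 2 / q.+1%:R.
  move: s => {}t /andP[t0 t1]; pose k := Num.truncn (t * q.+1%:R / (pi *+ 2)).
  have /truncn_itv/andP[k1 k2] : 0 <= t * q.+1%:R / (pi *+ 2).
    by rewrite divr_ge0 ?mulr_ge0 ?(ltW p2).
  have kq : (k < q.+1)%N.
    rewrite -(ltr_nat R); apply: le_lt_trans k1 _.
    rewrite ltr_pdivrMr// mulrC ltr_pM2l//; apply: le_lt_trans t1 _.
    by have := @pi_ge2 R; rewrite -mulr_natr; lra.
  exists (Ordinal kq); rewrite /angle/=.
  move: k1 k2; rewrite -/k ler_pdivlMr// ltr_pdivrMr// => k1 k2.
  rewrite divr_ge0 ?mulr_ge0 ?(ltW p2)//= ler_pdivrMr// mulrC k1; split=> //.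
  rewrite lerBlDr -mulrDl ler_pdivlMr//; apply: ltW; apply: lt_le_trans k2 _.
  by rewrite -natr1 mulrDl mul1r addrC mulrC.
move=> t1; have [t0|t0] := leP 0 t.
  have [|a [/andP[a0 a1] a2]] := step t; first by rewrite t0 (le_trans (ler_norm t)).
  exists a, ord0; rewrite angle0 subr0 ger0_norm// (ger0_norm t0); split=> //.
  by rewrite distrC ger0_norm ?subr_ge0.
have [|a [/andP[a0 a1] a2]] := step (- t).
  by rewrite oppr_ge0 ltW//= (le_trans (ler_norm _))// normrN.
exists ord0, a; rewrite angle0 sub0r normrN (ger0_norm a0) (ltr0_norm t0).
split=> //; rewrite ger0_norm; first by rewrite addrC.
by rewrite addrC subr_ge0.
Qed.

End torus_grid.

(** * The Fejer kernel and averages over the grid *)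

Section fejer_kernel.
Variables (R : realType) (d q N : nat).
Hypothesis Nq : (N < q)%N.
Local Notation Y := 'rV['I_q.+1]_d.
Local Notation J := 'rV['I_N.+1]_d.

Definition freq (j : J) : 'rV[R]_d := nat_row R (fun i => j ord0 i).

(** This is the squared modulus of the sum of e^(i <j, u>) over the box {0, ..., N}^d, divided by
    the size of the box. The double sum shows at once that it is a trigonometric polynomial. *)
Definition fejer (u : 'rV[R]_d) : R :=
  #|{: J}|%:R^-1 * \sum_(j : J) \sum_(l : J) cos (dot (freq j - freq l) u).

(* Averages over a finite grid of the torus replace integrals: they agree on
   trigonometric polynomials of degree less than the grid size. *)
Definition grid_mean (f : Y -> R) : R := #|{: Y}|%:R^-1 * \sum_(y : Y) f y.

Lemma card_grid_gt0 n : 0 < #|{: 'rV['I_n.+1]_d}|%:R :> R.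
Proof. by rewrite ltr0n; apply/card_gt0P; exists 0. Qed.

Lemma fejer_ge0 u : 0 <= fejer u.
Proof.
rewrite mulr_ge0 ?invr_ge0 ?ler0n//.
suff -> : \sum_(j : J) \sum_(l : J) cos (dot (freq j - freq l) u) =
    (\sum_(j : J) cos (dot (freq j) u)) ^+ 2 + (\sum_(j : J) sin (dot (freq j) u)) ^+ 2.
  by rewrite addr_ge0 ?sqr_ge0.
rewrite !expr2 !mulr_suml -big_split/=; apply: eq_bigr => j _.
rewrite !mulr_sumr -big_split/=; apply: eq_bigr => l _.
by rewrite dotBl cosB.
Qed.

(** The frequencies are integral, so the kernel does not see the periods lost by adding y and h
    modulo q + 1. *)
Lemma fejer_gridD u (y h : Y) : fejer (u + grid R h - grid R (y + h)) = fejer (u - grid R y).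
Proof.
congr (_ * _); apply: eq_bigr => j _; apply: eq_bigr => l _.
have := cos_gridD (fun i => l ord0 i) (fun i => j ord0 i) y h (dot (freq j - freq l) (u + grid R h)).
rewrite -/(freq j) -/(freq l) => E.
transitivity (cos (dot (freq l - freq j) (grid R (y + h)) + dot (freq j - freq l) (u + grid R h))).
  by rewrite !(dotBl, dotBr, dotDr); congr cos; ring.
by rewrite E !(dotBl, dotBr, dotDr); congr cos; ring.
Qed.

Lemma eq_grid_mean f g : f =1 g -> grid_mean f = grid_mean g.
Proof. by move=> fg; congr (_ * _); apply: eq_bigr. Qed.

Lemma grid_meanD f g : grid_mean (fun y => f y + g y) = grid_mean f + grid_mean g.
Proof. by rewrite /grid_mean big_split mulrDr. Qed.

Lemma grid_meanB f g : grid_mean (fun y => f y - g y) = grid_mean f - grid_mean g.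
Proof. by rewrite /grid_mean sumrB mulrBr. Qed.

Lemma grid_meanZ c f : grid_mean (fun y => c * f y) = c * grid_mean f.
Proof. by rewrite /grid_mean -mulr_sumr mulrCA. Qed.

Lemma grid_mean_sum (I : finType) (f : I -> Y -> R) :
  grid_mean (fun y => \sum_i f i y) = \sum_i grid_mean (f i).
Proof. by rewrite /grid_mean exchange_big/= mulr_sumr. Qed.

Lemma ler_grid_mean f g : (forall y, f y <= g y) -> grid_mean f <= grid_mean g.
Proof.
by move=> fg; rewrite ler_wpM2l ?invr_ge0 ?ler0n// ler_sum.
Qed.

Lemma ler_norm_grid_mean f : `|grid_mean f| <= grid_mean (fun y => `|f y|).
Proof.
rewrite /grid_mean normrM ger0_norm ?invr_ge0 ?ler0n//.
by rewrite ler_wpM2l ?invr_ge0 ?ler0n// ler_norm_sum.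
Qed.

Lemma grid_mean_shift f h : grid_mean (fun y => f (y + h)) = grid_mean f.
Proof. by rewrite /grid_mean [in RHS](reindex_inj (addIr h)). Qed.

Lemma grid_mean_cos (b c : 'I_d -> nat) u :
  (forall i, (b i < q.+1)%N) -> (forall i, (c i < q.+1)%N) ->
  grid_mean (fun y => cos (dot (nat_row R b - nat_row R c) (u - grid R y))) =
  [forall i, b i == c i]%:R.
Proof.
move=> bq cq; rewrite /grid_mean.
under eq_bigr => y _.
  have -> : dot (nat_row R b - nat_row R c) (u - grid R y) =
    dot (nat_row R c - nat_row R b) (grid R y) + dot (nat_row R b - nat_row R c) u.
    by rewrite !(dotBl, dotBr); ring.
  over.
rewrite sum_cos_grid//.
have -> : [forall i, c i == b i] = [forall i, b i == c i].
  by apply: eq_forallb => i; rewrite eq_sym.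
case: ifPn => [/forallP bc|]; last by rewrite mulr0.
have -> : nat_row R b = nat_row R c by apply/rowP => i; rewrite !mxE (eqP (bc i)).
by rewrite subrr dot0l cos0 mulr1 mulVf// gt_eqF// card_grid_gt0.
Qed.

Lemma freq_eq (j l : J) : [forall i, j ord0 i == l ord0 i :> nat] = (j == l).
Proof.
apply/forallP/eqP => [jl|-> //].
by apply/rowP => i; apply/val_inj/eqP/jl.
Qed.

Let ltq (j : J) i : (j ord0 i < q.+1)%N.
Proof. by rewrite (leq_trans (ltn_ord _))// ltnS ltnW. Qed.

Lemma grid_mean_fejer u : grid_mean (fun y => fejer (u - grid R y)) = 1.
Proof.
rewrite /fejer grid_meanZ grid_mean_sum.
under eq_bigr => j _ do rewrite grid_mean_sum.
under eq_bigr => j _.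
  under eq_bigr => l _ do rewrite grid_mean_cos// freq_eq.
  rewrite (bigD1 j)//= eqxx big1 => [|l /negbTE]; last by rewrite eq_sym => ->.
  rewrite addr0; over.
by rewrite sumr_const mulVf// gt_eqF// card_grid_gt0.
Qed.

(** By translation in the group of indices, a coordinate takes each of its N + 1 values equally
    often. *)
Lemma sum_ord_max (i : 'I_d) :
  N.+1%:R * \sum_(j : J) (j ord0 i == ord_max)%:R = #|{: J}|%:R :> R.
Proof.
have cst (c : 'I_N.+1) :
    \sum_(j : J) (j ord0 i == c)%:R = \sum_(j : J) (j ord0 i == ord_max)%:R :> R.
  pose e : J := \row_k (ord_max - c).
  rewrite [in RHS](reindex_inj (addIr e))/=; apply: eq_bigr => j _.
  by rewrite !mxE -(inj_eq (addIr (ord_max - c))) [in LHS](addrC c) subrK.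
transitivity (\sum_(c : 'I_N.+1) \sum_(j : J) (j ord0 i == c)%:R : R).
  by rewrite (eq_bigr _ (fun c _ => cst c)) sumr_const card_ord mulr_natl.
rewrite exchange_big/= -[RHS]sumr_const; apply: eq_bigr => j _.
by rewrite (bigD1 (j ord0 i))//= eqxx big1 ?addr0// => c /negbTE; rewrite eq_sym => ->.
Qed.

(** Multiplication by the cosine moves the frequency j by one unit in coordinate i. By orthogonality
    j then contributes 1 as soon as the moved index stays in the box, which fails only when j i = N,
    a fraction 1 / (N + 1) of the indices. The hypothesis N < q keeps the moved index below the grid
    size. *)
Lemma grid_mean_fejer_cos u i :
  1 - N.+1%:R^-1 <= grid_mean (fun y => fejer (u - grid R y) * cos (u ord0 i - grid R y ord0 i)).
Proof.
pose s (j : J) (k : 'I_d) : nat := (j ord0 k + (k == i))%N.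
have sq j k : (s j k < q.+1)%N.
  rewrite /s ltnS; apply: leq_trans Nq; rewrite -[leqRHS]addn1.
  by apply: leq_add; [rewrite -ltnS ltn_ord|exact: leq_b1].
have sE j : nat_row R (s j) = freq j + delta_mx ord0 i.
  by apply/rowP => k; rewrite !mxE natrD eqxx.
pose M (j l : J) := grid_mean (fun y => cos (dot (nat_row R (s j) - freq l) (u - grid R y))).
have ME j l : M j l = [forall k, s j k == l ord0 k]%:R by rewrite /M grid_mean_cos.
have -> : grid_mean (fun y => fejer (u - grid R y) * cos (u ord0 i - grid R y ord0 i)) =
    #|{: J}|%:R^-1 * \sum_(j : J) \sum_(l : J) M j l.
  pose c (j l : J) (y : Y) := cos (dot (nat_row R (s j) - freq l) (u - grid R y)).
  (* The product formula yields half of cos (a + b) + cos (a - b); the second term is the first one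
     with j and l exchanged, so both have the same sum. *)
  transitivity (grid_mean (fun y =>
      #|{: J}|%:R^-1 * 2^-1 * \sum_(j : J) \sum_(l : J) (c j l y + c l j y))); last first.
    rewrite grid_meanZ -mulrA; congr (_ * _); rewrite grid_mean_sum.
    under eq_bigr do rewrite grid_mean_sum.
    under eq_bigr => j _.
      under eq_bigr do rewrite grid_meanD.
      rewrite big_split/=; over.
    by rewrite big_split/= [X in _ + X]exchange_big/=; lra.
  apply: eq_grid_mean => y; rewrite /c.
  rewrite /fejer -!mulrA; congr (_ * _); rewrite mulr_suml mulr_sumr; apply: eq_bigr => j _.
  rewrite mulr_suml mulr_sumr; apply: eq_bigr => l _.
  have -> : u ord0 i - grid R y ord0 i = dot (delta_mx ord0 i) (u - grid R y).
    by rewrite dot_delta !mxE.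
  set w := u - grid R y; rewrite !sE.
  have -> : dot (freq j + delta_mx ord0 i - freq l) w =
      dot (freq j - freq l) w + dot (delta_mx ord0 i) w.
    by rewrite !(dotBl, dotDl); ring.
  rewrite -[cos (dot (freq l + _ - _) _)]cosN.
  have -> : - dot (freq l + delta_mx ord0 i - freq j) w =
      dot (freq j - freq l) w - dot (delta_mx ord0 i) w.
    by rewrite !(dotBl, dotDl); ring.
  by rewrite cosD cosB; field.
have jl (j : J) : 1 - (j ord0 i == ord_max)%:R <= \sum_(l : J) M j l.
  have M0 l : 0 <= M j l by rewrite ME ler0n.
  case: eqP => [_|/eqP ji]; first by rewrite subrr sumr_ge0.
  have js k : (s j k < N.+1)%N.
    rewrite /s; case: eqP => [->|_]; last by rewrite addn0.
    rewrite addn1 ltnS ltn_neqAle -ltnS ltn_ord andbT.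
    by apply: contra ji => /eqP ji; apply/eqP/val_inj.
  rewrite subr0 (bigD1 (\row_k Ordinal (js k)))//=.
  suff -> : M j (\row_k Ordinal (js k)) = 1 by rewrite lerDl sumr_ge0.
  by rewrite ME; case: forallP => // -[] k; rewrite mxE.
apply: le_trans (_ : #|{: J}|%:R^-1 * \sum_(j : J) (1 - (j ord0 i == ord_max)%:R) <= _); last first.
  by rewrite ler_wpM2l ?invr_ge0 ?ler0n// ler_sum.
have J0 : #|{: J}|%:R != 0 :> R by rewrite gt_eqF// card_grid_gt0.
have N0 : N.+1%:R != 0 :> R by rewrite pnatr_eq0.
rewrite sumrB sumr_const -[X in _ * (_ - X)](mulKf N0) sum_ord_max.
by rewrite mulrBr mulVf// mulrCA mulVf// mulr1.
Qed.

End fejer_kernel.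

(** * Fejer means of a periodized Lipschitz function *)

Section fejer_mean.
Variables (R : realType) (d : nat) (g : 'rV[R]_d -> R).
Hypothesis g_lip : forall x y, `|g x - g y| <= euclidean_norm (x - y).
Variable r : R.
Hypothesis r_gt0 : 0 < r.

(* The substitution x = r sin u makes g periodic; it is inverted near x = 0 by
   u = x / r with r large. *)
Definition periodized (u : 'rV[R]_d) : R := g (\row_i (r * sin (u ord0 i))).

Lemma periodized_le (u v : 'rV[R]_d) : `|periodized u - periodized v| <=
  r * euclidean_norm (\row_i (sin (u ord0 i) - sin (v ord0 i))).
Proof.
apply: le_trans (g_lip _ _) _; rewrite -[X in X * _]gtr0_norm// -enormZ.
by apply: enorm_le => i; rewrite !mxE mulrBr.
Qed.

Lemma periodized_bounded u : `|periodized u| <= `|g 0| + r * d%:R.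
Proof.
rewrite -[periodized u](subrK (g 0)) addrC (le_trans (ler_normD _ _))// lerD2l.
apply: le_trans (g_lip _ _) _; rewrite subr0; apply: le_trans (enorm_le_sum _) _.
rewrite mulr_natr -[in leRHS](card_ord d) -sumr_const; apply: ler_sum => i _.
by rewrite mxE normrM gtr0_norm// ler_piMr ?sin_max// ltW.
Qed.

(** The right-hand side is the squared distance of e^(ia) and e^(ib), of which sin a - sin b is the
    imaginary part. *)
Lemma sqr_sin_diff (a b : R) : (sin a - sin b) ^+ 2 <= 2 * (1 - cos (a - b)).
Proof.
have := sqr_ge0 (cos a - cos b); have := cos2Dsin2 a; have := cos2Dsin2 b.
rewrite cosB; nra.
Qed.

(** The norm e is replaced by de + e^2 / de, because the Fejer kernel averages the terms 1 - cos
    explicitly but not a square root. *)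
Lemma periodized_le_cos (de : R) u v : 0 < de -> `|periodized u - periodized v| <=
  r * (de + 2 / de * \sum_(i < d) (1 - cos (u ord0 i - v ord0 i))).
Proof.
move=> de0; apply: le_trans (periodized_le _ _) _; rewrite ler_pM2l//.
set e := euclidean_norm _; have e0 : 0 <= e by exact: enorm_ge0.
apply: le_trans (_ : de + e ^+ 2 / de <= _).
  rewrite -(ler_pM2l de0) mulrDr mulrCA divff ?gt_eqF// mulr1; nra.
rewrite lerD2l [leRHS]mulrAC ler_pM2r ?invr_gt0// sqr_enorm mulr_sumr; apply: ler_sum => i _.
by rewrite mxE -expr2 sqr_sin_diff.
Qed.

Variables (q N : nat).
Hypothesis Nq : (N < q)%N.
Local Notation Y := 'rV['I_q.+1]_d.
Local Notation J := 'rV['I_N.+1]_d.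

Definition fejer_mean (u : 'rV[R]_d) : R :=
  grid_mean (fun y : Y => periodized (grid R y) * fejer N (u - grid R y)).

Lemma fejer_mean_approx (de : R) u : 0 < de ->
  `|fejer_mean u - periodized u| <= r * (de + 2 / de * (d%:R / N.+1%:R)).
Proof.
move=> de0.
have -> : fejer_mean u - periodized u = grid_mean (fun y : Y =>
    fejer N (u - grid R y) * (periodized (grid R y) - periodized u)).
  rewrite -[X in _ - X]mulr1 -(grid_mean_fejer Nq u) -grid_meanZ -grid_meanB.
  by apply: eq_grid_mean => y; ring.
apply: le_trans (ler_norm_grid_mean _) _.
apply: le_trans (_ : grid_mean (fun y : Y => r * de * fejer N (u - grid R y) +
    r * (2 / de) * \sum_(i < d) (fejer N (u - grid R y) -
     fejer N (u - grid R y) * cos (u ord0 i - grid R y ord0 i))) <= _).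
  apply: ler_grid_mean => y.
  rewrite normrM ger0_norm ?fejer_ge0// distrC.
  apply: le_trans (_ : fejer N (u - grid R y) *
     (r * (de + 2 / de * \sum_(i < d) (1 - cos (u ord0 i - grid R y ord0 i)))) <= _).
    by rewrite ler_wpM2l ?fejer_ge0// periodized_le_cos.
  have -> : \sum_(i < d) (fejer N (u - grid R y) -
     fejer N (u - grid R y) * cos (u ord0 i - grid R y ord0 i)) =
    fejer N (u - grid R y) * \sum_(i < d) (1 - cos (u ord0 i - grid R y ord0 i)).
    by rewrite mulr_sumr; apply: eq_bigr => i _; rewrite mulrBr mulr1.
  by rewrite le_eqVlt; apply/orP; left; apply/eqP; ring.
rewrite grid_meanD (grid_meanZ (r * de)) (grid_meanZ (r * (2 / de))) (grid_mean_fejer Nq) mulr1 mulrDr -mulrA lerD2l ler_pM2l//.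
rewrite ler_pM2l ?divr_gt0// grid_mean_sum.
rewrite -[in leRHS](card_ord d) mulrC mulr_natr -sumr_const; apply: ler_sum => i _.
rewrite grid_meanB (grid_mean_fejer Nq) lerBlDr addrC -lerBlDr.
exact: grid_mean_fejer_cos.
Qed.

(** A translation by a grid vector can be moved from the kernel to the function. Since the kernel is
    nonnegative with mean 1, the Lipschitz constant is then inherited without loss, but only along
    differences of grid points. *)
Lemma fejer_mean_shift u (a b : Y) :
  fejer_mean (u + (grid R a - grid R b)) - fejer_mean u <=
  r * euclidean_norm (grid R a - grid R b).
Proof.
rewrite /fejer_mean -[X in X - _](grid_mean_shift _ a) -[X in _ - X](grid_mean_shift _ b).
rewrite -grid_meanB.
set c := r * _; rewrite -[leRHS]mulr1 -(grid_mean_fejer Nq (u - grid R b)) -grid_meanZ.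
apply: ler_grid_mean => y.
have -> : u + (grid R a - grid R b) - grid R (y + a) =
  (u - grid R b) + grid R a - grid R (y + a) by rewrite addrA addrAC.
rewrite fejer_gridD -{2}(subrK (grid R b) u) fejer_gridD -mulrBl.
rewrite ler_wpM2r ?fejer_ge0//; apply: le_trans (ler_norm _) _.
apply: le_trans (periodized_le _ _) _; rewrite ler_pM2l//.
apply: enorm_le => i; rewrite !mxE.
have := sin_gridD R y a i; have := sin_gridD R y b i; rewrite !mxE => -> ->.
by apply: le_trans (sin_lipschitz _ _) _; rewrite opprD addrACA subrr add0r.
Qed.

Definition fm_coef (t : Y * (J * J)) : R :=
  #|{: Y}|%:R^-1 * #|{: J}|%:R^-1 * periodized (grid R t.1).
Definition fm_freq (t : Y * (J * J)) : 'rV[R]_d := freq R t.2.1 - freq R t.2.2.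
Definition fm_phase (t : Y * (J * J)) : R := - dot (fm_freq t) (grid R t.1).

Lemma fejer_meanE u : fejer_mean u = trig_poly fm_coef fm_freq fm_phase u.
Proof.
rewrite /trig_poly /fejer_mean /grid_mean mulr_sumr.
rewrite (eq_bigr (fun y : Y => \sum_(jl : J * J)
  fm_coef (y, jl) * cos (dot (fm_freq (y, jl)) u + fm_phase (y, jl)))).
  by rewrite pair_bigA/=; apply: eq_bigr => -[y jl].
move=> y _; rewrite /fejer mulrCA mulr_sumr mulr_sumr.
rewrite -(pair_bigA _ (fun j l => fm_coef (y, (j, l)) *
  cos (dot (fm_freq (y, (j, l))) u + fm_phase (y, (j, l)))))/=.
rewrite !mulr_sumr; apply: eq_bigr => j _; rewrite !mulr_sumr; apply: eq_bigr => l _.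
by rewrite /fm_coef /fm_phase/= /fm_freq/= dotBr; ring.
Qed.

(** The bound is crude, but like the one on the frequencies it does not depend on q: the grid can be
    refined once N is fixed. *)
Lemma fm_coef_sum :
  \sum_t `|fm_coef t| <= (`|g 0| + r * d%:R) * #|{: J}|%:R.
Proof.
have Y0 := card_grid_gt0 R d q; have J0 := card_grid_gt0 R d N.
apply: le_trans (_ : \sum_(t : Y * (J * J))
   #|{: Y}|%:R^-1 * #|{: J}|%:R^-1 * (`|g 0| + r * d%:R) <= _).
  apply: ler_sum => t _; rewrite normrM ger0_norm ?mulr_ge0 ?invr_ge0 ?ler0n//.
  by rewrite ler_wpM2l ?mulr_ge0 ?invr_ge0 ?ler0n// periodized_bounded.
rewrite sumr_const !card_prod -[leLHS]mulr_natr !natrM le_eqVlt; apply/orP; left; apply/eqP.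
by field; rewrite !gt_eqF.
Qed.

Lemma fm_freq_le t i : `|fm_freq t ord0 i| <= N.+1%:R.
Proof.
rewrite !mxE; have := ltn_ord (t.2.1 ord0 i); have := ltn_ord (t.2.2 ord0 i).
rewrite -(ltr_nat R) -[in X in _ -> X -> _](ltr_nat R).
have := ler0n R (t.2.1 ord0 i); have := ler0n R (t.2.2 ord0 i).
by move=> *; rewrite ler_norml; lra.
Qed.

End fejer_mean.

(** * Approximation with control of the gradient *)

Section trig_approximation.
Variables (R : realType) (d : nat) (g : 'rV[R]_d -> R).
Hypothesis g_lip : forall x y, `|g x - g y| <= euclidean_norm (x - y).

(** A small multiple tau v of a unit vector is replaced by a difference w of grid points, along
    which the increment is at most r tau. The second-order remainder and the replacement each cost r
    tau / 2, whence the factor 2. *)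
Lemma fejer_mean_grad r N : 0 < r -> exists2 q : nat, (N < q)%N &
  forall u v, trig_grad (@fm_coef R d g r q N) (@fm_freq R d q N) (@fm_phase R d q N) u v
    <= 2 * r * euclidean_norm v.
Proof.
move=> r0; pose G := (`|g 0| + r * d%:R) * #|{: 'rV['I_N.+1]_d}|%:R.
have G0 : 0 <= G by rewrite mulr_ge0 ?ler0n// addr_ge0// mulr_ge0 ?ler0n// ltW.
pose c : R := N.+1%:R * d%:R; have c0 : 0 <= c by rewrite mulr_ge0.
(* [G] bounds the sum of the coefficients and [c] turns a bound on coordinates into one on scalar
   products with the frequencies. This [tau] makes the second-order remainder G (c tau)^2 at most r
   tau / 2. *)
pose tau := Num.min 1 (r / 2 / (G * c ^+ 2 + 1)).
have Gc0 : 0 < G * c ^+ 2 + 1 by rewrite ltr_wpDl// mulr_ge0// sqr_ge0.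
have tau0 : 0 < tau by rewrite lt_min ltr01/= !divr_gt0.
have tau1 : tau <= 1 by rewrite ge_min lexx.
have tauG : G * (c * tau) ^+ 2 <= r / 2 * tau.
  rewrite exprMn expr2 mulrA mulrA ler_pM2r// .
  have : tau <= r / 2 / (G * c ^+ 2 + 1) by rewrite ge_min lexx orbT.
  rewrite ler_pdivlMr// => h; apply: le_trans h.
  by rewrite mulrC ler_pM2l// lerDl.
(* An error [e] on each coordinate of tau v changes the differential by at most G c e, hence by at
   most r tau / 2. *)
pose e := r / 2 * tau / (G * c + 1).
have Gc1 : 0 < G * c + 1 by rewrite ltr_wpDl// mulr_ge0.
have e0 : 0 < e by rewrite !(divr_gt0, mulr_gt0).
(* The first argument gives N < q, the second a mesh 2 pi / (q + 1) of at most [e]. *)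
pose q := maxn N.+1 (Num.truncn (pi *+ 2 / e)).+1.
have Nq : (N < q)%N by rewrite /q leq_maxl.
have qe : pi *+ 2 / q.+1%:R <= e.
  rewrite ler_pdivrMr ?ltr0n// mulrC -ler_pdivrMr//.
  have /truncn_itv/andP[_ /ltW h] : 0 <= pi *+ 2 / e.
    by rewrite divr_ge0 ?(ltW e0)// mulrn_wge0 ?pi_ge0.
  by apply: le_trans h _; rewrite ler_nat ltnW// ltnS leq_maxr.
exists q => // u v.
wlog v1 : v / euclidean_norm v = 1 => [wl|].
  have := enorm_ge0 v; rewrite le_eqVlt => /predU1P[v0|v0].
    have -> : v = 0 *: v.
      rewrite scale0r; apply/rowP => i; rewrite mxE.
      by apply/eqP; rewrite -normr_le0 [leRHS]v0 ler_enorm_coord.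
    by rewrite trig_gradZ mul0r enormZ normr0 mul0r mulr0.
  have := wl ((euclidean_norm v)^-1 *: v).
  rewrite trig_gradZ enormZ gtr0_norm ?invr_gt0// mulVf ?gt_eqF// mulr1.
  by move=> /(_ erefl); rewrite ler_pdivrMl// mulrC.
rewrite v1 mulr1.
have tv i : `|tau * v ord0 i| <= 1.
  rewrite normrM gtr0_norm// mulr_ile1//; first exact: ltW.
  by rewrite -v1 ler_enorm_coord.
have [a ab] := choice (fun i => @grid_approx R q _ (tv i)).
have [b {}ab] := choice ab.
pose w := grid R (\row_i a i : 'rV['I_q.+1]_d) - grid R (\row_i b i).
have wv i : `|w ord0 i| <= `|tau * v ord0 i| by rewrite !mxE; case: (ab i).
have wv' i : `|(tau *: v - w) ord0 i| <= e.
  rewrite !mxE; apply: le_trans qe; case: (ab i) => _; rewrite distrC.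
  by congr (`| _ - _ | <= _).
have wtau i : `|w ord0 i| <= tau.
  apply: le_trans (wv i) _; rewrite normrM gtr0_norm// ler_piMr ?(ltW tau0)//.
  by rewrite -v1 ler_enorm_coord.
have dotc (x : 'rV[R]_d) s t : (forall i, `|x ord0 i| <= s) ->
    `|dot (@fm_freq R d q N t) x| <= c * s.
  move=> xs; apply: le_trans (ler_norm_dot _ (fm_freq_le _ t)) _.
  rewrite -mulrA ler_wpM2l// mulr_natl -[in leRHS](card_ord d) -sumr_const.
  exact: ler_sum.
set P := trig_poly (@fm_coef R d g r q N) (@fm_freq R d q N) (@fm_phase R d q N).
set D := trig_grad _ _ _.
have S0 : \sum_t `|@fm_coef R d g r q N t| <= G by exact: fm_coef_sum.
have h1 : `|P (u + w) - P u - D u w| <= G * (c * tau) ^+ 2.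
  apply: le_trans (trig_poly_remainder _ _ _ (fun t => dotc _ _ t wtau)) _.
  by rewrite -mulr_suml ler_wpM2r// sqr_ge0.
have h2 : `|D u (tau *: v - w)| <= G * (c * e).
  apply: le_trans (trig_grad_le _ _ _ (fun t => dotc _ _ t wv')) _.
  by rewrite -mulr_suml ler_wpM2r// mulr_ge0// ltW.
have h3 : P (u + w) - P u <= r * tau.
  rewrite /P -!fejer_meanE; apply: le_trans (fejer_mean_shift g_lip r0 Nq _ _ _) _.
  rewrite ler_pM2l// -[leRHS]mulr1 -v1 -[X in X * _]gtr0_norm// -enormZ.
  by apply: enorm_le => i; rewrite [in leRHS]mxE; exact: wv.
have h4 : G * (c * e) <= r / 2 * tau.
  rewrite mulrA /e mulrCA ler_piMr ?mulr_ge0 ?divr_ge0 ?ltW//.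
  by rewrite ltr_pdivrMr// mul1r ltrDl.
rewrite -(ler_pM2l tau0) -trig_gradZ -(subrK w (tau *: v)) trig_gradD -/D.
move: h1 h2; rewrite !ler_norml => /andP[h1 _] /andP[_ h2].
lra.
Qed.

Lemma trig_approx (eta : R) : 0 < eta ->
  exists (I : finType) (a : I -> R) (xi : I -> 'rV[R]_d) (th : I -> R),
    (forall x, `|trig_poly a xi th x - g x| <= eta * (1 + dot x x)) /\
    (forall x v, trig_grad a xi th x v <= 2 * euclidean_norm v).
Proof.
(* The error |r sin (x / r) - x| <= x^2 / r of the substitution must be at most eta x^2. *)
move=> eta0; pose r := eta^-1; have r0 : 0 < r by rewrite invr_gt0.
(* [de] and then [N] make each of the two terms of the Fejer error r (de + 2 d / (de (N + 1))) at
   most eta / 2. *)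
pose de := eta / (2 * r); have de0 : 0 < de by rewrite divr_gt0 ?mulr_gt0.
pose N := Num.truncn (2 * r * (2 / de * d%:R) / eta).
have hN : r * (2 / de * (d%:R / N.+1%:R)) <= eta / 2.
  have /truncn_itv/andP[_ /ltW] : 0 <= 2 * r * (2 / de * d%:R) / eta.
    by rewrite !(divr_ge0, mulr_ge0)// ltW.
  rewrite -/N ler_pdivrMr// => h; rewrite mulrA mulrA ler_pdivrMr ?ltr0n//.
  lra.
have [q Nq gr] := fejer_mean_grad N r0.
exists _, (@fm_coef R d g r q N), (fun t => r^-1 *: @fm_freq R d q N t), (@fm_phase R d q N).
split=> [x|x v].
  have -> : trig_poly (@fm_coef R d g r q N) (fun t => r^-1 *: @fm_freq R d q N t)
      (@fm_phase R d q N) x = fejer_mean g r q N (r^-1 *: x).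
    by rewrite fejer_meanE; apply: eq_bigr => t _; rewrite dotZl dotZr.
  rewrite -[_ - _](subrKA (periodized g r (r^-1 *: x))).
  apply: le_trans (ler_normD _ _) _; rewrite mulrDr mulr1 lerD//.
    apply: le_trans (fejer_mean_approx g_lip r0 Nq _ de0) _.
    rewrite mulrDr; have -> : r * de = eta / 2 by rewrite /de; field; rewrite gt_eqF.
    by rewrite [leRHS](splitr eta) lerD2l.
  apply: le_trans (g_lip _ _) _; apply: le_trans (enorm_le_sum _) _.
  rewrite mulr_sumr; apply: ler_sum => i _; rewrite !mxE.
  have -> : r * sin (r^-1 * x ord0 i) - x ord0 i =
      r * (sin (r^-1 * x ord0 i) - r^-1 * x ord0 i).
    by rewrite mulrBr mulVKf ?gt_eqF.
  rewrite normrM gtr0_norm//; apply: le_trans (_ : r * (r^-1 * x ord0 i) ^+ 2 <= _).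
    by rewrite ler_pM2l// sin_approx.
  rewrite /r invrK le_eqVlt; apply/orP; left; apply/eqP.
  by field; rewrite gt_eqF.
have -> : trig_grad (@fm_coef R d g r q N) (fun t => r^-1 *: @fm_freq R d q N t)
      (@fm_phase R d q N) x v = r^-1 *
   trig_grad (@fm_coef R d g r q N) (@fm_freq R d q N) (@fm_phase R d q N) (r^-1 *: x) v.
  rewrite /trig_grad mulr_sumr; apply: eq_bigr => t _; rewrite !dotZl dotZr.
  by rewrite mulrCA.
by rewrite ler_pdivrMl// mulrA [r * 2]mulrC.
Qed.

End trig_approximation.

(** * Gaussian vectors *)

Section real_integral.
Context d (T : measurableType d) (R : realType).
Variable mu : {measure set T -> \bar R}.
Implicit Types (f g : T -> R) (c : R).

Definition intg f := mu.-integrable setT (EFin \o f).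

Lemma intg_measurable f : intg f -> measurable_fun setT f.
Proof. by case/integrableP => /measurable_EFinP. Qed.

Lemma intgD f g : intg f -> intg g -> intg (fun w => f w + g w).
Proof. by move=> fi gi; exact: (integrableD measurableT fi gi). Qed.

Lemma intgZ c f : intg f -> intg (fun w => c * f w).
Proof. by move=> fi; exact: (integrableZl measurableT c fi). Qed.

Lemma intgB f g : intg f -> intg g -> intg (fun w => f w - g w).
Proof. by move=> fi gi; exact: (integrableB measurableT fi gi). Qed.

Lemma intg0 : intg (fun=> 0).
Proof. exact: integrable0. Qed.

Lemma intg_sum (I : Type) (s : seq I) (f : I -> T -> R) :
  (forall i, intg (f i)) -> intg (fun w => \sum_(i <- s) f i w).
Proof.
move=> fi; elim: s => [|i s ih].
  by under [X in intg X]funext do rewrite big_nil; exact: intg0.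
by under [X in intg X]funext do rewrite big_cons; exact: intgD.
Qed.

Lemma intg_le f g : measurable_fun setT f -> (forall w, `|f w| <= g w) -> intg g -> intg f.
Proof.
move=> mf fg gi; apply: le_integrable gi => //; first exact/measurable_EFinP.
by move=> w _; rewrite lee_fin (le_trans (fg w))// ler_norm.
Qed.

Lemma intg_abs f : intg f -> intg (fun w => `|f w|).
Proof. exact: integrable_norm. Qed.

Lemma intgMl f g c : intg f -> measurable_fun setT g -> (forall w, `|g w| <= c) ->
  intg (fun w => f w * g w).
Proof.
move=> fi mg gc; apply: (@intg_le _ (fun w => c * `|f w|)).
- by apply: measurable_funM => //; exact: intg_measurable.
- by move=> w; rewrite normrM mulrC ler_wpM2r.
- by apply/intgZ/intg_abs.
Qed.

Definition rint f : R := \int[mu]_w f w.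

Lemma eq_rint f g : f =1 g -> rint f = rint g.
Proof. by move=> fg; apply: eq_Rintegral => w _; exact: fg. Qed.

Lemma rintD f g : intg f -> intg g -> rint (fun w => f w + g w) = rint f + rint g.
Proof. by move=> fi gi; exact: RintegralD. Qed.

Lemma rintB f g : intg f -> intg g -> rint (fun w => f w - g w) = rint f - rint g.
Proof. by move=> fi gi; exact: RintegralB. Qed.

Lemma rintZ c f : intg f -> rint (fun w => c * f w) = c * rint f.
Proof. by move=> fi; exact: RintegralZl. Qed.

Lemma rintN f : intg f -> rint (fun w => - f w) = - rint f.
Proof.
move=> fi; rewrite -mulN1r -rintZ//; apply: eq_rint => w; by rewrite mulN1r.
Qed.

Lemma rint0 : rint (fun=> 0) = 0.
Proof. by rewrite /rint /Rintegral integral0. Qed.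

Lemma rint_sum (I : Type) (s : seq I) (f : I -> T -> R) :
  (forall i, intg (f i)) ->
  rint (fun w => \sum_(i <- s) f i w) = \sum_(i <- s) rint (f i).
Proof.
move=> fi; elim: s => [|i s ih].
  by under eq_rint do rewrite big_nil; rewrite big_nil rint0.
under eq_rint do rewrite big_cons.
by rewrite rintD ?ih ?big_cons//; exact: intg_sum.
Qed.

Lemma rint_le f g : intg f -> intg g -> (forall w, f w <= g w) -> rint f <= rint g.
Proof. by move=> fi gi fg; apply: le_Rintegral. Qed.

Lemma rint_ge0 f : (forall w, 0 <= f w) -> 0 <= rint f.
Proof. by move=> f0; apply: Rintegral_ge0 => w _. Qed.

Lemma rint_norm_le f g : intg f -> intg g -> (forall w, `|f w| <= g w) -> `|rint f| <= rint g.
Proof.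
move=> fi gi fg; apply: le_trans (le_normr_Rintegral _ fi) _ => //.
by apply: rint_le => //; exact: intg_abs.
Qed.

End real_integral.

(** * From indicators to bounded functions, under signed weights *)

Section weighted_extension.
Context d1 (T1 : measurableType d1) d2 (T2 : measurableType d2) (R : realType).
Variables (mu1 : {measure set T1 -> \bar R}) (mu2 : {measure set T2 -> \bar R}).
Variables (Y1 X1 : T1 -> R) (Y2 X2 : T2 -> R).
Hypotheses (Y1i : intg mu1 Y1) (Y2i : intg mu2 Y2).
Hypotheses (mX1 : measurable_fun setT X1) (mX2 : measurable_fun setT X2).
Hypothesis agree : forall E : set R, measurable E ->
  rint mu1 (fun w => Y1 w * \1_E (X1 w)) = rint mu2 (fun w => Y2 w * \1_E (X2 w)).

(* Slicing the range of f approximates it uniformly by combinations of indicators. *)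
Lemma weighted_extension (f : R -> R) (C : R) : measurable_fun setT f -> (forall x, `|f x| <= C) ->
  rint mu1 (fun w => Y1 w * f (X1 w)) = rint mu2 (fun w => Y2 w * f (X2 w)).
Proof.
move=> mf fC.
have C0 : 0 <= C by apply: le_trans (fC 0).
pose A (n k : nat) := f @^-1` `[k%:R / n.+1%:R - C, k.+1%:R / n.+1%:R - C[.
have mA n k : measurable (A n k).
  by rewrite -[A _ _]setTI; apply: mf => //; exact: measurable_itv.
(* The values of f fill an interval of length 2 C, cut into half-open slices of height 1 / (n + 1);
   the successor accounts for the slice that contains the upper end. *)
pose K n := (Num.truncn (2 * C * n.+1%:R)).+1.
pose s n x := \sum_(k <- iota 0 (K n)) (k%:R / n.+1%:R - C) * \1_(A n k) x.
have sf n x : `|f x - s n x| <= n.+1%:R^-1.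
  have n0 : 0 < n.+1%:R :> R by rewrite ltr0n.
  pose j := Num.truncn ((f x + C) * n.+1%:R).
  have /andP[fC1 fC2] : - C <= f x <= C by rewrite -ler_norml.
  have /truncn_itv/andP[j1 j2] : 0 <= (f x + C) * n.+1%:R.
    by rewrite mulr_ge0// -lerBlDr sub0r.
  have jK : (j < K n)%N.
    rewrite /K ltnS; apply: le_truncn; rewrite ler_pM2r//; lra.
  have fA : A n j x.
    rewrite /A/= in_itv/= lerBlDr ler_pdivrMr// ltrBrDr ltr_pdivlMr//.
    by rewrite -/j in j1 j2; rewrite j1 j2.
  have sE : s n x = j%:R / n.+1%:R - C.
    rewrite /s (bigD1_seq j) ?iota_uniq ?mem_iota//= big1 => [|k kj].
      by rewrite indicE mem_set// mulr1 addr0.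
    rewrite indicE memNset ?mulr0// /A/= in_itv/= lerBlDr ler_pdivrMr// ltrBrDr ltr_pdivlMr//.
    move=> /andP[k1 k2]; move/eqP: kj; apply.
    apply/eqP; rewrite eq_sym; apply/eqP/truncn_def; by rewrite k1 k2.
  move: fA; rewrite sE /A/= in_itv/= => /andP[a1 a2].
  rewrite ger0_norm ?subr_ge0// lerBlDr; apply: le_trans (ltW a2) _.
  rewrite -[j.+1%:R]natr1 mulrDl mul1r; set a := _ / _; set b := _^-1.
  by rewrite [leRHS]addrA (addrC b).
have ms n : measurable_fun setT (s n).
  apply: measurable_sum => k; apply: measurable_funM => //.
have s_agree n : rint mu1 (fun w => Y1 w * s n (X1 w)) = rint mu2 (fun w => Y2 w * s n (X2 w)).
  have intgA d (T : measurableType d) (mu : {measure set T -> \bar R}) (Y X : T -> R) k :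
      intg mu Y -> measurable_fun setT X -> intg mu (fun w => Y w * \1_(A n k) (X w)).
    move=> Yi mX; apply: (@intgMl _ _ _ _ _ _ 1) => //.
      by apply: measurableT_comp => //; exact: measurable_indic.
    by move=> w; rewrite indicE; case: (_ \in _); rewrite ?normr1// normr0.
  have sE d (T : measurableType d) (mu : {measure set T -> \bar R}) (Y X : T -> R) :
      intg mu Y -> measurable_fun setT X -> rint mu (fun w => Y w * s n (X w)) =
      \sum_(k <- iota 0 (K n)) (k%:R / n.+1%:R - C) * rint mu (fun w => Y w * \1_(A n k) (X w)).
    move=> Yi mX.
    transitivity (rint mu (fun w => \sum_(k <- iota 0 (K n)) (k%:R / n.+1%:R - C) *
        (Y w * \1_(A n k) (X w)))).
      by apply: eq_rint => w; rewrite /s mulr_sumr; apply: eq_bigr => k _; rewrite mulrCA.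
    rewrite rint_sum => [|k]; first by apply: eq_bigr => k _; rewrite rintZ//; exact: intgA.
    by apply/intgZ/intgA.
  by rewrite !sE//; apply: eq_bigr => k _; rewrite agree.
have near d (T : measurableType d) (mu : {measure set T -> \bar R}) (Y X : T -> R) n :
    intg mu Y -> measurable_fun setT X ->
    `|rint mu (fun w => Y w * f (X w)) - rint mu (fun w => Y w * s n (X w))| <=
    n.+1%:R^-1 * rint mu (fun w => `|Y w|).
  move=> Yi mX.
  have if_ : intg mu (fun w => Y w * f (X w)).
    by apply: (@intgMl _ _ _ _ _ _ C) => //; exact: measurableT_comp.
  have is_ : intg mu (fun w => Y w * s n (X w)).
    apply: (@intgMl _ _ _ _ _ _ (C + n.+1%:R^-1)) => //; first exact: measurableT_comp.
    move=> w; rewrite -[s n _](subrK (f (X w))) addrC (le_trans (ler_normD _ _))// lerD//.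
    by rewrite distrC.
  rewrite -rintB// -rintZ ?intg_abs//; apply: rint_norm_le.
  - exact: intgB.
  - by apply/intgZ/intg_abs.
  - by move=> w; rewrite -mulrBr normrM mulrC ler_wpM2r.
set a := rint mu1 _; set b := rint mu2 _.
set c := rint mu1 (fun w => `|Y1 w|) + rint mu2 (fun w => `|Y2 w|).
have c0 : 0 <= c by rewrite addr_ge0// rint_ge0.
apply/eqP; rewrite -subr_eq0 -normr_le0; apply/ler_addgt0Pr => e e0; rewrite add0r.
pose n := Num.truncn (c / e).
have /truncn_itv/andP[_ /ltW] : 0 <= c / e by rewrite divr_ge0// ltW.
rewrite -/n ler_pdivrMr// => ce.
apply: le_trans (_ : n.+1%:R^-1 * c <= e); last by rewrite ler_pdivrMl.
have := near _ _ _ _ _ n Y1i mX1; have := near _ _ _ _ _ n Y2i mX2.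
rewrite -/a -/b s_agree mulrDr distrC => h1 h2.
rewrite -[a - b](subrKA (rint mu2 (fun w => Y2 w * s n (X2 w)))).
by rewrite (le_trans (ler_normD _ _))// lerD.
Qed.

End weighted_extension.

(** * Rules of differentiation *)

Section derivative_rules.
Variable R : realType.
Implicit Types (f g : R -> R) (x a b c : R).

Lemma is_derive_compE f g x a b : is_derive (g x) 1 f a -> is_derive x 1 g b ->
  is_derive x 1 (fun y => f (g y)) (a * b).
Proof. by move=> fa gb; exact: is_derive1_comp. Qed.

Lemma is_derive_mulE f g x a b : is_derive x 1 f a -> is_derive x 1 g b ->
  is_derive x 1 (fun y => f y * g y) (f x * b + g x * a).
Proof. by move=> fa gb; exact: is_deriveM. Qed.

Lemma is_derive_affine a b x : is_derive x 1 (fun y => a * y + b) a.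
Proof.
apply: (@is_derive_quadratic _ _ _ _ 0) => y _; rewrite mul0r normr_le0.
by apply/eqP; ring.
Qed.

Lemma is_derive_sqr c x : is_derive x 1 (fun y => c * y ^+ 2) (2 * c * x).
Proof.
apply: (@is_derive_quadratic _ _ _ _ `|c|) => y _.
have -> : c * (x + y) ^+ 2 - c * x ^+ 2 - y * (2 * c * x) = c * y ^+ 2 by ring.
by rewrite normrM [ `|y ^+ 2| ]ger0_norm ?sqr_ge0.
Qed.

Lemma is_derive_cos_affine a b x :
  is_derive x 1 (fun y => cos (a * y + b)) (- sin (a * x + b) * a).
Proof. exact: (is_derive_compE (is_derive_cos _) (is_derive_affine a b x)). Qed.

Lemma is_derive_sin_affine a b x :
  is_derive x 1 (fun y => sin (a * y + b)) (cos (a * x + b) * a).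
Proof. exact: (is_derive_compE (is_derive_sin _) (is_derive_affine a b x)). Qed.

Lemma is_derive_expR_sqr c x :
  is_derive x 1 (fun y => expR (c * y ^+ 2)) (expR (c * x ^+ 2) * (2 * c * x)).
Proof. exact: (is_derive_compE (is_derive_expR _) (is_derive_sqr c x)). Qed.

Lemma is_derive_unique_val f x a b : is_derive x 1 f a -> is_derive x 1 f b -> a = b.
Proof. by move=> [_ <-] [_ <-]. Qed.

Lemma is_derive_eqE f x a b : is_derive x 1 f a -> a = b -> is_derive x 1 f b.
Proof. by move=> + <-. Qed.

Lemma is_derive_continuous_at f x a : is_derive x 1 f a -> {for x, continuous f}.
Proof.
by case=> fx _; apply: differentiable_continuous; apply/derivable1_diffP.
Qed.

Lemma is_derive_subE f g x a b : is_derive x 1 f a -> is_derive x 1 g b ->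
  is_derive x 1 (fun y => f y - g y) (a - b).
Proof. by move=> fa gb; exact: is_deriveB. Qed.

Lemma is_derive_continuous f df : (forall x : R, is_derive x 1 f (df x)) -> continuous f.
Proof.
by move=> fdf x; apply: differentiable_continuous; apply/derivable1_diffP; case: (fdf x).
Qed.

End derivative_rules.

Lemma measurable_sin (R : realType) : measurable_fun setT (@sin R).
Proof. by apply: continuous_measurable_fun; exact: continuous_sin. Qed.

Lemma measurable_cos (R : realType) : measurable_fun setT (@cos R).
Proof. by apply: continuous_measurable_fun; exact: continuous_cos. Qed.

(** * Characteristic function of the standard normal law *)

Section normal_characteristic.
Variable R : realType.
Local Notation mu := (@lebesgue_measure R).
Local Notation phi := (@normal_pdf R 0 1).
Implicit Types eta th x : R.

Let intg_leR (f g : R -> R) : measurable_fun setT f -> (forall x, `|f x| <= g x) ->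
  intg mu g -> intg mu f.
Proof. exact: (@intg_le _ _ _ mu). Qed.

Let intg_DR (f g : R -> R) : intg mu f -> intg mu g -> intg mu (fun x => f x + g x).
Proof. exact: (@intgD _ _ _ mu). Qed.

Let intg_BR (f g : R -> R) : intg mu f -> intg mu g -> intg mu (fun x => f x - g x).
Proof. exact: (@intgB _ _ _ mu). Qed.

Let intg_ZR (c : R) (f : R -> R) : intg mu f -> intg mu (fun x => c * f x).
Proof. exact: (@intgZ _ _ _ mu). Qed.

Let rint_BR (f g : R -> R) : intg mu f -> intg mu g ->
  rint mu (fun x => f x - g x) = rint mu f - rint mu g.
Proof. exact: (@rintB _ _ _ mu). Qed.

Let rint_ZR (c : R) (f : R -> R) : intg mu f -> rint mu (fun x => c * f x) = c * rint mu f.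
Proof. exact: (@rintZ _ _ _ mu). Qed.

Let eq_rintR (f g : R -> R) : f =1 g -> rint mu f = rint mu g.
Proof. exact: (@eq_rint _ _ _ mu). Qed.

Let rint_norm_leR (f g : R -> R) : intg mu f -> intg mu g ->
  (forall x, `|f x| <= g x) -> `|rint mu f| <= rint mu g.
Proof. exact: (@rint_norm_le _ _ _ mu). Qed.

Lemma std_pdfE x : phi x = normal_peak 1 * expR (- 2^-1 * x ^+ 2).
Proof.
by rewrite normal_pdfE ?oner_neq0// /normal_fun; congr (_ * expR _); field.
Qed.

Lemma is_derive_pdf x : is_derive x 1 phi (- x * phi x).
Proof.
have -> : phi = (fun y => cst (normal_peak 1) y * expR (- 2^-1 * y ^+ 2)).
  by apply/funext => y; rewrite std_pdfE.
apply: is_derive_eqE (is_derive_mulE (is_derive_cst _ _ _) (is_derive_expR_sqr _ _)) _.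
by rewrite /= mulr0 addr0; field.
Qed.

Lemma intg_pdf : intg mu phi.
Proof. exact: integrable_normal_pdf. Qed.

Lemma rint_pdf : rint mu phi = 1.
Proof. by rewrite /rint /Rintegral integral_normal_pdf. Qed.

(** With y = x^2 / 4 the integrand is a multiple of y e^(-y) e^(-y), and y e^(-y) <= 1; the
    remaining factor is a multiple of the density of variance 2. *)
Lemma intg_pdf_sqr : intg mu (fun x => x ^+ 2 * phi x).
Proof.
have s2 : Num.sqrt 2 != 0 :> R by rewrite gt_eqF// sqrtr_gt0.
have p2 : 0 < normal_peak (Num.sqrt 2) :> R by exact: normal_peak_gt0.
pose c : R := 4 * normal_peak 1 / normal_peak (Num.sqrt 2).
apply: (@intg_leR _ (fun x => c * normal_pdf 0 (Num.sqrt 2) x)).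
- apply: measurable_funM; last exact: measurable_normal_pdf.
  by apply: measurable_funX; exact: measurable_id.
- move=> x; rewrite ger0_norm; last by rewrite mulr_ge0 ?sqr_ge0 ?normal_pdf_ge0.
  rewrite std_pdfE normal_pdfE// /normal_fun subr0 sqr_sqrtr//.
  set y := x ^+ 2 / 4.
  have y0 : 0 <= y by rewrite divr_ge0 ?sqr_ge0.
  have -> : - 2^-1 * x ^+ 2 = - y + - y by rewrite /y; field.
  have -> : - x ^+ 2 / (2 *+ 2) = - y by rewrite /y; field.
  have xy : x ^+ 2 = 4 * y by rewrite /y mulrC divfK.
  have ye : y * expR (- y) <= 1.
    rewrite expRN ler_pdivrMr ?expR_gt0// mul1r.
    by apply: le_trans (expR_ge1Dx y); rewrite lerDr.
  have -> : c * (normal_peak (Num.sqrt 2) * expR (- y)) = 4 * normal_peak 1 * expR (- y).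
    by rewrite /c; field; rewrite gt_eqF.
  rewrite expRD xy.
  have -> : 4 * y * (normal_peak 1 * (expR (- y) * expR (- y))) =
    4 * normal_peak 1 * expR (- y) * (y * expR (- y)) by ring.
  by rewrite ler_piMr// mulr_ge0 ?expR_ge0// mulr_ge0 ?normal_peak_ge0.
- by apply: intg_ZR; exact: integrable_normal_pdf.
Qed.

(** The difference of the two sides is, up to sign, the integral of the derivative of sin (eta x +
    th) phi x. On a bounded interval it is a boundary term; both this term and the tails are O(1 /
    m) on [-m, m]. *)
Lemma normal_ibp eta th :
  rint mu (fun x => x * sin (eta * x + th) * phi x) =
  eta * rint mu (fun x => cos (eta * x + th) * phi x).
Proof.
pose f x := (cos (eta * x + th) * eta) * phi x - x * sin (eta * x + th) * phi x.
pose F x := sin (eta * x + th) * phi x.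
have dF x : is_derive x 1 F (f x).
  apply: is_derive_eqE (is_derive_mulE (is_derive_sin_affine eta th x) (is_derive_pdf x)) _.
  by rewrite /f; ring.
have m_aff : measurable_fun setT (fun x : R => eta * x + th).
  by apply: measurable_funD => //; apply: measurable_funM.
have mc : measurable_fun setT (fun x => cos (eta * x + th)).
  exact: measurableT_comp (@measurable_cos R) m_aff.
have ms : measurable_fun setT (fun x => sin (eta * x + th)).
  exact: measurableT_comp (@measurable_sin R) m_aff.
have ic : intg mu (fun x => cos (eta * x + th) * phi x).
  apply: (intg_leR _ _ intg_pdf).
    by apply: measurable_funM => //; exact: measurable_normal_pdf.
  by move=> x; rewrite normrM (ger0_norm (normal_pdf_ge0 _ _ _)) ler_piMl ?cos_max// normal_pdf_ge0.
have is_ : intg mu (fun x => x * sin (eta * x + th) * phi x).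
  apply: (intg_leR _ _ (intg_DR intg_pdf intg_pdf_sqr)).
    apply: measurable_funM; last exact: measurable_normal_pdf.
    by apply: measurable_funM.
  move=> x; rewrite normrM (ger0_norm (normal_pdf_ge0 _ _ _)).
  have -> : phi x + x ^+ 2 * phi x = (1 + x ^+ 2) * phi x by ring.
  rewrite ler_wpM2r ?normal_pdf_ge0// normrM; apply: le_trans (_ : `|x| <= _).
    by rewrite ler_piMr// sin_max.
  by rewrite -(real_normK (num_real x)); nra.
have if_ : intg mu f.
  apply: intg_BR => //.
  have -> : (fun x => cos (eta * x + th) * eta * phi x) =
      (fun x => eta * (cos (eta * x + th) * phi x)) by apply/funext => x; ring.
  exact: intg_ZR.
suff f0 : rint mu f = 0.
  apply/esym/eqP; rewrite -subr_eq0 -rint_ZR// -rint_BR//; last exact: intg_ZR.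
  by rewrite -[X in _ == X]f0; apply/eqP/eq_rintR => x; rewrite /f; ring.
have cf : continuous f.
  move=> x; apply: is_derive_continuous_at.
  apply: (is_derive_subE (is_derive_mulE (is_derive_mulE (is_derive_cos_affine eta th x)
    (is_derive_cst eta x 1)) (is_derive_pdf x))).
  exact: (is_derive_mulE (is_derive_mulE (is_derive_id x 1)
    (is_derive_sin_affine eta th x)) (is_derive_pdf x)).
have cF : continuous F by exact: is_derive_continuous dF.
pose S := rint mu (fun x => x ^+ 2 * phi x).
(* Outside [-m, m], where m >= 1, |f x| <= (|eta| + 1) |x| phi x and |x| <= x^2 / m, which gives the
   first summand; the second one bounds the two boundary values, by phi m <= phi 0 / m. *)
pose K := (`|eta| + 1) * S + 2 * normal_peak 1.
have bound n : `|rint mu f| <= K / n.+1%:R.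
  have n0 : 0 < n.+1%:R :> R by rewrite ltr0n.
  have n1 : 1 <= n.+1%:R :> R by rewrite ler1n.
  pose D : set R := `[- n.+1%:R, n.+1%:R]%classic.
  have mD : measurable D by exact: measurable_itv.
  have FTC : \int[mu]_(x in D) f x = F n.+1%:R - F (- n.+1%:R).
    rewrite /Rintegral (@continuous_FTC2 _ f F)//.
    - by rewrite gtrN.
    - exact: continuous_subspaceT.
    - split; first by move=> x _; case: (dF x).
      + exact: cvg_at_right_filter (cF _).
      + exact: cvg_at_left_filter (cF _).
    - by move=> x _; rewrite derive1E; case: (dF x).
  have fD : `|rint mu f - \int[mu]_(x in D) f x| <= (`|eta| + 1) * S / n.+1%:R.
    have iD : intg mu (f \_ D).
      apply: (intg_leR _ _ (intg_abs if_)).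
        by apply/(measurable_restrictT _ mD)/measurable_funTS; exact: intg_measurable if_.
      by move=> x; rewrite /patch; case: ifP => // _; rewrite normr0.
    rewrite Rintegral_mkcond -rint_BR// mulrAC -rint_ZR; last exact: intg_pdf_sqr.
    apply: rint_norm_leR.
    - exact: intg_BR.
    - by apply: intg_ZR; exact: intg_pdf_sqr.
    - move=> x; rewrite /patch; case: ifPn => [_|].
        by rewrite subrr normr0 mulr_ge0// mulr_ge0 ?sqr_ge0 ?normal_pdf_ge0.
      rewrite notin_setE /D/= in_itv/= -ler_norml => /negP; rewrite -ltNge subr0 => nx.
      have -> : f x = (cos (eta * x + th) * eta - x * sin (eta * x + th)) * phi x.
        by rewrite /f mulrBl.
      rewrite normrM (ger0_norm (normal_pdf_ge0 _ _ _)) mulrA ler_wpM2r ?normal_pdf_ge0//.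
      apply: le_trans (ler_normB _ _) _; rewrite !normrM.
      apply: le_trans (_ : `|eta| * `|x| + `|x| <= _).
        have hc := cos_max (eta * x + th); have hs := sin_max (eta * x + th).
        rewrite lerD// ?ler_piMr//.
        apply: le_trans (_ : 1 * `|eta| <= _); first by rewrite ler_wpM2r.
        by rewrite mul1r ler_peMr// (le_trans n1)// ltW.
      rewrite -[X in _ + X]mul1r -mulrDl -mulrA ler_wpM2l ?addr_ge0//.
      by rewrite ler_pdivlMl// -(real_normK (num_real x)) expr2 ler_wpM2r// ltW.
  have phin : phi n.+1%:R <= normal_peak 1 / n.+1%:R.
    rewrite std_pdfE ler_pM2l ?normal_peak_gt0 ?oner_neq0// mulNr expRN.
    rewrite lef_pV2 ?posrE ?expR_gt0//; apply: le_trans (expR_ge1Dx _).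
    by have := sqr_ge0 (n.+1%:R - 1 : R); nra.
  have phiN : phi (- n.+1%:R) = phi n.+1%:R by rewrite !std_pdfE sqrrN.
  have FN : `|F n.+1%:R - F (- n.+1%:R)| <= 2 * normal_peak 1 / n.+1%:R.
    rewrite /F phiN -mulrBl normrM (ger0_norm (normal_pdf_ge0 _ _ _)) -mulrA.
    rewrite ler_pM ?normal_pdf_ge0//; apply: le_trans (ler_normB _ _) _.
    by rewrite (_ : 2 = 1 + 1) ?lerD ?sin_max// -natr1.
  rewrite -[rint mu f](subrK (\int[mu]_(x in D) f x)).
  apply: le_trans (ler_normD _ _) _; rewrite /K mulrDl lerD//.
  by rewrite FTC.
have K0 : 0 <= K by have := le_trans (normr_ge0 _) (bound 0); rewrite divr1.
apply/eqP; rewrite -normr_le0; apply/ler_addgt0Pr => e e0; rewrite add0r.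
apply: le_trans (bound (Num.truncn (K / e))) _.
have /truncn_itv/andP[_ /ltW] : 0 <= K / e by rewrite divr_ge0// ltW.
by rewrite ler_pdivrMr// ler_pdivrMr ?ltr0n// mulrC.
Qed.

(** As a function of eta, the integral psi satisfies psi' = - eta psi by [normal_ibp], so its
    product with the integrating factor e^(eta^2 / 2) is constant. *)
Lemma normal_cos eta th :
  rint mu (fun x => cos (eta * x + th) * phi x) = cos th * expR (- 2^-1 * eta ^+ 2).
Proof.
have m_aff e : measurable_fun setT (fun x : R => e * x + th).
  by apply: measurable_funD => //; apply: measurable_funM.
have ic e : intg mu (fun x => cos (e * x + th) * phi x).
  apply: (intg_leR _ _ intg_pdf).
    apply: measurable_funM; last exact: measurable_normal_pdf.
    exact: measurableT_comp (@measurable_cos R) (m_aff e).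
  by move=> x; rewrite normrM (ger0_norm (normal_pdf_ge0 _ _ _)) ler_piMl ?cos_max// normal_pdf_ge0.
have is_ e : intg mu (fun x => x * sin (e * x + th) * phi x).
  apply: (intg_leR _ _ (intg_DR intg_pdf intg_pdf_sqr)).
    apply: measurable_funM; last exact: measurable_normal_pdf.
    by apply: measurable_funM => //; exact: measurableT_comp (@measurable_sin R) (m_aff e).
  move=> x; rewrite normrM (ger0_norm (normal_pdf_ge0 _ _ _)).
  have -> : phi x + x ^+ 2 * phi x = (1 + x ^+ 2) * phi x by ring.
  rewrite ler_wpM2r ?normal_pdf_ge0// normrM; apply: le_trans (_ : `|x| <= _).
    by rewrite ler_piMr// sin_max.
  by rewrite -(real_normK (num_real x)); nra.
pose psi (e : R) : R := rint mu (fun x => cos (e * x + th) * phi x).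
have dpsi (e : R) : is_derive e (1 : R) psi (- e * psi e).
  apply: (@is_derive_quadratic _ _ _ _ (rint mu (fun x => x ^+ 2 * phi x))) => h _.
  rewrite mulNr /psi -normal_ibp mulrN -mulNr -rint_ZR// -!rint_BR//; [|exact: intg_BR|exact: intg_ZR].
  have i2 := intg_ZR (h ^+ 2) intg_pdf_sqr.
  rewrite mulrC -rint_ZR; last exact: intg_pdf_sqr.
  apply: rint_norm_leR => // [|x].
    by apply: intg_BR; [exact: intg_BR|exact: intg_ZR].
  have -> : cos ((e + h) * x + th) * phi x - cos (e * x + th) * phi x -
     - h * (x * sin (e * x + th) * phi x) =
     (cos (e * x + th + h * x) - cos (e * x + th) + h * x * sin (e * x + th)) * phi x.
    by rewrite mulrDl (addrAC (e * x)); ring.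
  rewrite normrM (ger0_norm (normal_pdf_ge0 _ _ _)) mulrA ler_wpM2r ?normal_pdf_ge0//.
  by rewrite -exprMn cos_remainder.
pose w (t : R) : R := psi t * expR (2^-1 * t ^+ 2).
have w0 (t : R) : w t = w 0.
  apply: is_derive_0_is_cst => z.
  apply: is_derive_eqE (is_derive_mulE (dpsi z) (is_derive_expR_sqr _ z)) _.
  by field.
have psi0 : psi 0 = cos th.
  transitivity (cos th * rint mu phi); last by rewrite rint_pdf mulr1.
  rewrite /psi -rint_ZR; last exact: intg_pdf.
  by apply: eq_rintR => x; rewrite mul0r add0r.
have := w0 eta; rewrite /w psi0 expr0n/= mulr0 expR0 mulr1 => <-.
by rewrite /psi -mulrA -expRD -mulrDl subrr mul0r expR0 mulr1.
Qed.

End normal_characteristic.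

Section probability_integral.
Context d (T : measurableType d) (R : realType).
Variable P : probability T R.
Implicit Types (f g : T -> R) (c : R).

Lemma intg_bounded f c : measurable_fun setT f -> (forall w, `|f w| <= c) -> intg P f.
Proof.
move=> mf fc; apply: (@intg_le _ _ _ _ _ (cst c)) => //.
exact: finite_measure_integrable_cst.
Qed.

Lemma intg_cst c : intg P (fun=> c).
Proof. exact: finite_measure_integrable_cst. Qed.

Lemma rint_cst c : rint P (fun=> c) = c.
Proof. by rewrite /rint Rintegral_cst//= (congr1 fine (@probability_setT _ _ _ P)) mulr1. Qed.

Lemma rint_indic (A : set T) : measurable A -> rint P (\1_A) = fine (P A).
Proof. by move=> mA; rewrite /rint /Rintegral integral_indic// setIT. Qed.

End probability_integral.

(** * Characteristic function of independent normal variables *)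

Section gaussian_characteristic.
Variable R : realType.
Local Notation mu := (@lebesgue_measure R).
Local Notation phi := (@normal_pdf R 0 1).
Context d (T : measurableType d) (P : probability T R) (l : nat) (G : T -> 'rV[R]_l).
Hypothesis G_iid : iid_standard_normal P G.

Let nu (E : set R) : R := rint mu (fun x => phi x * \1_E x).

Let mG i : measurable_fun setT (fun w => G w ord0 i).
Proof. by case: G_iid. Qed.

Let PG i (E : set R) : measurable E -> fine (P [set w | E (G w ord0 i)]) = nu E.
Proof.
case: G_iid => _ + _ mE; move=> ->//; rewrite /nu /normal_prob -/(Rintegral _ _ _).
rewrite Rintegral_mkcond; apply: eq_Rintegral => x _.
by rewrite /patch [\1_E _]indicE; case: (x \in E); rewrite ?mulr1 ?mulr0.
Qed.

Let normal_sin (eta : R) : rint mu (fun x => phi x * sin (eta * x)) = 0.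
Proof.
transitivity (rint mu (fun x : R => cos (eta * x + - (pi / 2)) * phi x)).
  by apply: eq_Rintegral => x _; rewrite cosBpihalf mulrC.
by rewrite normal_cos cosN cos_pihalf mul0r.
Qed.

Let normal_cos0 (eta : R) : rint mu (fun x => phi x * cos (eta * x)) = expR (- 2^-1 * eta ^+ 2).
Proof.
transitivity (rint mu (fun x : R => cos (eta * x + 0) * phi x)).
  by apply: eq_Rintegral => x _; rewrite addr0 mulrC.
by rewrite normal_cos cos0 mul1r.
Qed.

Let prod_indic_bounded (p : pred 'I_l) (E : 'I_l -> set R) w :
  `|\prod_(i < l | p i) (\1_(E i) (G w ord0 i) : R)| <= 1.
Proof.
elim/big_ind : _ => [|x y x1 y1|i _]; first by rewrite normr1.
- by rewrite normrM mulr_ile1.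
- by rewrite indicE; case: (_ \in _); rewrite ?normr1// normr0.
Qed.

Let measurable_prod_indic (p : pred 'I_l) (E : 'I_l -> set R) :
  (forall i, measurable (E i)) ->
  measurable_fun setT (fun w => \prod_(i < l | p i) (\1_(E i) (G w ord0 i) : R)).
Proof.
move=> mE; under [X in measurable_fun _ X]funext do rewrite -big_filter.
apply: measurable_prod => i _.
by apply: measurableT_comp (mG i); exact: measurable_indic.
Qed.

(* Induction on the number j of coordinates integrated out, the remaining ones being
   tested against indicators, since independence is a product rule on sets. *)
Lemma iid_normal_cos_partial (eta : 'I_l -> R) (j : nat) : (j <= l)%N ->
  forall (th : R) (E : 'I_l -> set R), (forall i, measurable (E i)) ->
  rint P (fun w => cos (\sum_(i < l | (i < j)%N) eta i * G w ord0 i + th) *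
    \prod_(i < l | (j <= i)%N) \1_(E i) (G w ord0 i)) =
  cos th * (\prod_(i < l | (i < j)%N) expR (- 2^-1 * eta i ^+ 2)) *
    \prod_(i < l | (j <= i)%N) nu (E i).
Proof.
elim: j => [|j IH] jl th E mE.
  rewrite [X in _ * X * _]big_pred0// mulr1.
  transitivity (rint P (fun w => cos th * \1_[set w | forall i, E i (G w ord0 i)] w)).
    apply: eq_rint => w; rewrite big_pred0// add0r; congr (_ * _).
    rewrite indicE; case: (boolP (w \in _)) => [|/negP wE].
      by rewrite inE => wE; rewrite big1// => i _; rewrite indicE mem_set.
    have [i iE] : exists i, ~ E i (G w ord0 i).
      by apply/existsNP => h; apply: wE; rewrite inE.
    by rewrite (bigD1 i)//= indicE memNset// mul0r.
  have mA : measurable [set w | forall i, E i (G w ord0 i)].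
    have -> : [set w | forall i, E i (G w ord0 i)] =
        \bigcap_(i in [set: 'I_l]) ((fun w => G w ord0 i) @^-1` E i).
      by apply/seteqP; split => w /= wE i; [move=> _; exact: wE|exact: (wE i I)].
    apply: fin_bigcap_measurable => [|i _]; first exact: finite_finset.
    by rewrite -[X in measurable X]setTI; exact: mG.
  rewrite rintZ; last first.
    apply: (@intg_bounded _ _ _ _ _ 1) => [|w]; first exact: measurable_indic.
    by rewrite indicE; case: (_ \in _); rewrite ?normr1// normr0.
  congr (_ * _); rewrite rint_indic//.
  case: (G_iid) => _ _ /(_ E mE) ->.
  transitivity (fine (\prod_(i < l) (fine (P [set w | E i (G w ord0 i)]))%:E)).
    by congr fine; apply: eq_bigr => i _; rewrite fineK// fin_num_measure// -[X in measurable X]setTI; exact: mG.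
  by rewrite prodEFin/=; apply: eq_bigr => i _; rewrite PG.
pose a := Ordinal jl.
have lt_split (F : 'I_l -> R) : \sum_(i < l | (i < j.+1)%N) F i =
    \sum_(i < l | (i < j)%N) F i + F a.
  rewrite (bigD1 a)//= addrC; congr (_ + _); apply: eq_bigl => i.
  by rewrite ltnS ltn_neqAle andbC -(inj_eq val_inj).
have lt_splitM (F : 'I_l -> R) : \prod_(i < l | (i < j.+1)%N) F i =
    (\prod_(i < l | (i < j)%N) F i) * F a.
  rewrite (bigD1 a)//= mulrC; congr (_ * _); apply: eq_bigl => i.
  by rewrite ltnS ltn_neqAle andbC -(inj_eq val_inj).
have le_split (F : 'I_l -> R) : \prod_(i < l | (j <= i)%N) F i =
    (\prod_(i < l | (j < i)%N) F i) * F a.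
  rewrite (bigD1 a)//= mulrC; congr (_ * _); apply: eq_bigl => i.
  by rewrite ltn_neqAle andbC -(inj_eq val_inj) eq_sym.
pose S w := \sum_(i < l | (i < j)%N) eta i * G w ord0 i.
pose V w := \prod_(i < l | (j < i)%N) (\1_(E i) (G w ord0 i) : R).
pose c := (\prod_(i < l | (i < j)%N) expR (- 2^-1 * eta i ^+ 2)) *
    \prod_(i < l | (j < i)%N) nu (E i).
have mS : measurable_fun setT S.
  rewrite /S; under [X in measurable_fun _ X]funext do rewrite -big_filter.
  by apply: measurable_sum => i; apply: measurable_funM.
have mV : measurable_fun setT V by exact: measurable_prod_indic.
pose Y t w := cos (S w + t) * V w.
have mY t : measurable_fun setT (Y t).
  apply: measurable_funM => //; apply: measurableT_comp; first exact: measurable_cos.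
  exact: measurable_funD.
have Y1 t w : `|Y t w| <= 1.
  by rewrite normrM mulr_ile1// ?cos_max// prod_indic_bounded.
have iY t : intg P (Y t) by exact: intg_bounded (mY t) (Y1 t).
have iphi t : intg mu (fun x => cos t * c * phi x).
  exact: (@intgZ _ _ _ mu (cos t * c) phi (integrable_normal_pdf 0 1)).
have YG t (E' : set R) : measurable E' ->
    rint P (fun w => Y t w * \1_E' (G w ord0 a)) =
    rint mu (fun x => (cos t * c * phi x) * \1_E' x).
  (* The induction hypothesis holds for every family of test sets; changing the set at [a]
     determines the law of coordinate a under the signed weight [Y t]. *)
  move=> mE'; pose E2 i := if i == a then E' else E i.
  have mE2 i : measurable (E2 i) by rewrite /E2; case: ifP.
  have E2E (F : 'I_l -> set R -> R) : \prod_(i < l | (j < i)%N) F i (E2 i) =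
      \prod_(i < l | (j < i)%N) F i (E i).
    apply: eq_bigr => i ji; rewrite /E2; case: eqP => // ia.
    by move: ji; rewrite ia ltnn.
  have E2a : E2 a = E' by rewrite /E2 eqxx.
  transitivity (cos t * c * nu E').
    transitivity (cos t * (\prod_(i < l | (i < j)%N) expR (- 2^-1 * eta i ^+ 2)) *
        \prod_(i < l | (j <= i)%N) nu (E2 i)); last first.
      by rewrite le_split (E2E (fun=> nu)) E2a /c; ring.
    rewrite -(IH (ltnW jl) t E2 mE2); apply: eq_rint => w.
    by rewrite le_split (E2E (fun i A => \1_A (G w ord0 i))) E2a mulrA.
  rewrite /nu; symmetry; transitivity (rint mu (fun x => cos t * c * (phi x * \1_E' x))).
    by apply: eq_Rintegral => x _; ring.
  apply: RintegralZl => //; apply: (@intgMl _ _ _ mu _ _ 1) => //.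
    exact: integrable_normal_pdf.
  by move=> x; rewrite indicE; case: (_ \in _); rewrite ?normr1// normr0.
have YGf t (f : R -> R) : measurable_fun setT f -> (forall x, `|f x| <= 1) ->
    rint P (fun w => Y t w * f (G w ord0 a)) = cos t * c * rint mu (fun x => phi x * f x).
  move=> mf f1; rewrite (weighted_extension (iY t) (iphi t) (mG a) _ (YG t) mf f1)//.
  symmetry; transitivity (rint mu (fun x => cos t * c * (phi x * f x))); last first.
    by apply: eq_Rintegral => x _; ring.
  symmetry; apply: RintegralZl => //; apply: (@intgMl _ _ _ mu _ _ 1) => //.
  exact: integrable_normal_pdf.
have m_aff : measurable_fun setT (fun x : R => eta a * x) by exact: measurable_funM.
have mc : measurable_fun setT (fun x : R => cos (eta a * x)).
  exact: measurableT_comp (@measurable_cos R) m_aff.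
have ms : measurable_fun setT (fun x : R => sin (eta a * x)).
  exact: measurableT_comp (@measurable_sin R) m_aff.
(* The addition formula separates coordinate a. The sine of the other coordinates is their cosine
   with phase th - pi / 2, which is why the induction is over all phases. *)
transitivity (rint P (fun w => Y th w * cos (eta a * G w ord0 a) -
   Y (th - pi / 2) w * sin (eta a * G w ord0 a))).
  apply: eq_rint => w; rewrite lt_split -/(S w) -/(V w) addrAC cosD /Y addrA cosBpihalf.
  by ring.
rewrite rintB.
- rewrite (YGf _ (fun x => cos (eta a * x)) mc (fun x => cos_max _)).
  rewrite (YGf _ (fun x => sin (eta a * x)) ms (fun x => sin_max _)).
  rewrite normal_sin normal_cos0 mulr0 subr0 lt_splitM /c.
  by ring.
- apply: (@intgMl _ _ _ _ _ _ 1) => // [|w]; last exact: cos_max.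
  exact: measurableT_comp mc (mG a).
- apply: (@intgMl _ _ _ _ _ _ 1) => // [|w]; last exact: sin_max.
  exact: measurableT_comp ms (mG a).
Qed.

Lemma iid_normal_cos (eta : 'I_l -> R) (th : R) :
  rint P (fun w => cos (\sum_(i < l) eta i * G w ord0 i + th)) =
  cos th * expR (- 2^-1 * \sum_(i < l) eta i ^+ 2).
Proof.
have := @iid_normal_cos_partial eta l (leqnn l) th (fun=> setT) (fun=> measurableT).
rewrite [X in _ = _ * X]big_pred0 => [|i]; last by rewrite leqNgt ltn_ord.
rewrite mulr1 (eq_bigl xpredT) => [|i]; last by rewrite ltn_ord.
rewrite -expR_sum -mulr_sumr => <-; apply: eq_rint => w.
rewrite [X in _ * X]big_pred0 => [|i]; last by rewrite leqNgt ltn_ord.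
by rewrite mulr1; congr (cos (_ + _)); apply: eq_bigl => i; rewrite ltn_ord.
Qed.

End gaussian_characteristic.

(** Integrability of the limit is part of the conclusion; in this way second moments are extracted
    from the characteristic function alone. *)
Lemma rint_fatou d (T : measurableType d) (R : realType) (P : probability T R)
    (f : nat -> T -> R) (h : T -> R) (c : R) :
  (forall n, intg P (f n)) -> (forall n w, 0 <= f n w) -> measurable_fun setT h ->
  (forall w, f n w @[n --> \oo] --> h w) -> (forall n, rint P (f n) <= c) ->
  intg P h /\ rint P h <= c.
Proof.
move=> fi f0 mh fh fc.
have h0 w : 0 <= h w.
  rewrite -(cvg_lim _ (fh w))//; apply: limr_ge; first by apply/cvg_ex; exists (h w).
  by apply: nearW.
have inth : (\int[P]_w (h w)%:E <= c%:E)%E.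
  have fa := @fatou _ _ _ P setT measurableT (fun n w => (f n w)%:E)
    (fun n => (integrableP _ _ _ (fi n)).1) (fun n w _ => f0 n w).
  rewrite (_ : (\int[P]_w (h w)%:E)%E = (\int[P]_w limn_einf (fun n => (f n w)%:E))%E); last first.
    apply: eq_integral => w _; symmetry.
    have cv : (f n w)%:E @[n --> \oo] --> (h w)%:E.
      by apply: cvg_EFin; [exact: nearW|exact: fh].
    by rewrite is_cvg_limn_einfE; [exact/cvg_lim|apply/cvg_ex; exists (h w)%:E].
  apply: le_trans fa _; rewrite limn_einf_lim.
  apply: lime_le; first exact: is_cvg_einfs.
  apply: nearW => n; apply: (@le_trans _ _ (\int[P]_w (f n w)%:E)%E).
    by apply: ereal_inf_lbound; exists n => /=.
  rewrite -[leLHS]fineK; first by rewrite lee_fin; exact: fc.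
  exact: (integrable_fin_num measurableT (fi n)).
have hi : intg P h.
  apply/integrableP; split; first exact/measurable_EFinP.
  under eq_integral do rewrite /= ger0_norm//.
  by apply: le_lt_trans inth _; rewrite ltry.
split=> //; rewrite -lee_fin; apply: le_trans inth.
by rewrite /rint /Rintegral fineK//; exact: (integrable_fin_num measurableT hi).
Qed.

(** * Characteristic function and moments of the Gaussian vector *)

Section gaussian_vector_moments.
Context (R : realType) d (T : measurableType d) (P : probability T R) (N : nat).
Variable X : T -> 'rV[R]_N.
Hypothesis X_gauss : gaussian_vector P X 0 (2^-1)%:M.
Implicit Types xi v : 'rV[R]_N.

Lemma measurable_dot_gauss v : measurable_fun setT (fun w => dot v (X w)).
Proof.
case: X_gauss => mX _; apply: measurable_sum => i.
by apply: measurable_funM => //; exact: mX.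
Qed.

Lemma measurable_cos_gauss xi (th : R) : measurable_fun setT (fun w => cos (dot xi (X w) + th)).
Proof.
apply: measurableT_comp; first exact: measurable_cos.
by apply: measurable_funD => //; exact: measurable_dot_gauss.
Qed.

Lemma measurable_sin_gauss xi (th : R) : measurable_fun setT (fun w => sin (dot xi (X w) + th)).
Proof.
apply: measurableT_comp; first exact: measurable_sin.
by apply: measurable_funD => //; exact: measurable_dot_gauss.
Qed.

(** The scalar product is a combination of independent standard normals whose squared coefficients
    sum to |xi|^2 / 2, because the covariance is half the identity; hence the factor 1/4. *)
Lemma gauss_cos xi (th : R) :
  rint P (fun w => cos (dot xi (X w) + th)) = cos th * expR (- 4^-1 * dot xi xi).
Proof.
have [mX [l [A [G [G_iid XG AA]]]]] := X_gauss.
have [mG _ _] := G_iid.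
pose eta a : R := \sum_(i < N) A a i * xi ord0 i.
have etaE w : dot xi (0 + G w *m A) = \sum_(a < l) eta a * G w ord0 a.
  rewrite add0r /dot; under eq_bigr => i _ do rewrite mxE mulr_sumr.
  rewrite exchange_big/=; apply: eq_bigr => a _; rewrite mulr_suml.
  by apply: eq_bigr => i _; ring.
have eta2 : \sum_(a < l) eta a ^+ 2 = 2^-1 * dot xi xi.
  transitivity ((xi *m (A^T *m A) *m xi^T) ord0 ord0).
    rewrite mulmxA -mulmxA mxE; apply: eq_bigr => a _.
    have -> : (xi *m A^T) ord0 a = eta a.
      by rewrite mxE; apply: eq_bigr => i _; rewrite mxE mulrC.
    have -> : (A *m xi^T) a ord0 = eta a.
      by rewrite mxE; apply: eq_bigr => i _; rewrite mxE.
    by rewrite expr2.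
  rewrite AA mul_mx_scalar -scalemxAl mxE; congr (_ * _); rewrite mxE.
  by apply: eq_bigr => i _; rewrite mxE.
have -> : - 4^-1 * dot xi xi = - 2^-1 * \sum_(a < l) eta a ^+ 2 by rewrite eta2; field.
rewrite -(iid_normal_cos G_iid); congr fine; apply: ae_eq_integral => //.
- by apply/measurable_EFinP; exact: measurable_cos_gauss.
- apply/measurable_EFinP; apply: measurableT_comp; first exact: measurable_cos.
  apply: measurable_funD => //; apply: measurable_sum => a.
  by apply: measurable_funM => //; exact: mG.
- by apply: filterS XG => w -> _; rewrite etaE.
Qed.

Lemma intg_cos_gauss xi (th : R) : intg P (fun w => cos (dot xi (X w) + th)).
Proof. by apply: (@intg_bounded _ _ _ _ _ 1) => [|w]; [exact: measurable_cos_gauss|exact: cos_max]. Qed.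

(** The functions 2 m^2 (1 - cos (y / m)) are nonnegative and tend to y^2; at y = <v, X> their means
    are given by [gauss_cos] and are at most |v|^2 / 2. Fatou's lemma concludes. *)
Lemma gauss_sqr v : intg P (fun w => dot v (X w) ^+ 2) /\
  rint P (fun w => dot v (X w) ^+ 2) <= 2^-1 * dot v v.
Proof.
pose f (n : nat) w : R := 2 * n.+1%:R ^+ 2 * (1 - cos (dot (n.+1%:R^-1 *: v) (X w) + 0)).
have n0 n : n.+1%:R != 0 :> R by rewrite pnatr_eq0.
have fi n : intg P (f n) by apply: intgZ; apply: intgB; [exact: intg_cst|exact: intg_cos_gauss].
apply: (@rint_fatou _ _ _ _ f) => //.
- by move=> n w; rewrite !mulr_ge0// ?sqr_ge0// subr_ge0 cos_le1.
- by apply: measurable_funX; exact: measurable_dot_gauss.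
- move=> w; set y := dot v (X w).
  have fE n : f n w = (2 * n.+1%:R * sin (y / (2 * n.+1%:R))) ^+ 2.
    rewrite /f dotZl addr0 -/y.
    have -> : n.+1%:R^-1 * y = y / (2 * n.+1%:R) *+ 2 by field; rewrite nat1r n0.
    by rewrite cos_mulr2n cos2sin2; ring.
  have -> : f ^~ w = (fun n => (2 * n.+1%:R * sin (y / (2 * n.+1%:R))) ^+ 2) by exact/funext.
  suff cy : 2 * n.+1%:R * sin (y / (2 * n.+1%:R)) @[n --> \oo] --> y.
    by rewrite expr2; exact: (cvgM cy cy).
  apply/cvgrPdist_le => /= e e0.
  have e'0 : 0 < e / (y ^+ 2 + 1) by rewrite divr_gt0// ltr_wpDl ?sqr_ge0.
  near=> n.
  have hn : n.+1%:R^-1 <= e / (y ^+ 2 + 1).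
    by apply/ltW; near: n; exact: (near_infty_natSinv_lt (PosNum e'0)).
  have -> : y - 2 * n.+1%:R * sin (y / (2 * n.+1%:R)) =
      - (2 * n.+1%:R * (sin (y / (2 * n.+1%:R)) - y / (2 * n.+1%:R))).
    by field; rewrite nat1r n0.
  rewrite normrN normrM ger0_norm ?mulr_ge0//.
  apply: le_trans (_ : 2 * n.+1%:R * (y / (2 * n.+1%:R)) ^+ 2 <= _).
    by rewrite ler_wpM2l ?mulr_ge0// sin_approx.
  have -> : 2 * n.+1%:R * (y / (2 * n.+1%:R)) ^+ 2 = 2^-1 * y ^+ 2 * n.+1%:R^-1.
    by field; rewrite nat1r n0.
  apply: le_trans (_ : (y ^+ 2 + 1) * (e / (y ^+ 2 + 1)) <= _); last first.
    by rewrite mulrCA divff ?mulr1// gt_eqF// ltr_wpDl ?sqr_ge0.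
  by have y2 := sqr_ge0 y; apply: ler_pM => //; lra.
- move=> n; rewrite /f rintZ; last by apply: intgB; [exact: intg_cst|exact: intg_cos_gauss].
  rewrite rintB ?rint_cst; [|exact: intg_cst|exact: intg_cos_gauss].
  rewrite gauss_cos cos0 mul1r dotZl dotZr.
  have key (m z : R) : m != 0 ->
      2 * m ^+ 2 * (1 - expR (- 4^-1 * (m^-1 * (m^-1 * z)))) <= 2^-1 * z.
    move=> m0; have h := expR_ge1Dx (- 4^-1 * (m^-1 * (m^-1 * z))).
    have -> : 2^-1 * z = 2 * m ^+ 2 * (4^-1 * (m^-1 * (m^-1 * z))) by field.
    rewrite ler_wpM2l//; first by rewrite pmulr_rge0 ?sqr_ge0.
    by rewrite lerBlDr addrC -lerBlDr -mulNr.
  exact: key.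
Unshelve. all: by end_near. Qed.

Lemma intg_dot_gauss v : intg P (fun w => dot v (X w)).
Proof.
apply: (@intg_le _ _ _ _ _ (fun w => 1 + dot v (X w) ^+ 2)).
- exact: measurable_dot_gauss.
- by move=> w; rewrite -(real_normK (num_real (dot v (X w)))); nra.
- by apply: intgD; [exact: intg_cst|exact: (gauss_sqr v).1].
Qed.

(* Gaussian integration by parts, obtained by differentiating [gauss_cos] in xi
   along v. *)
Lemma gauss_sin v xi (th : R) :
  rint P (fun w => dot v (X w) * sin (dot xi (X w) + th)) =
  cos th * (2^-1 * dot v xi) * expR (- 4^-1 * dot xi xi).
Proof.
set I := rint P _.
have iI : intg P (fun w => dot v (X w) * sin (dot xi (X w) + th)).
  apply: (@intgMl _ _ _ _ _ _ 1); first exact: intg_dot_gauss.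
    exact: measurable_sin_gauss.
  by move=> w; exact: sin_max.
pose psi (h : R) : R := rint P (fun w => cos (dot (xi + h *: v) (X w) + th)).
have d1 : is_derive (0 : R) (1 : R) psi (- I).
  apply: (@is_derive_quadratic _ _ _ _ (rint P (fun w => dot v (X w) ^+ 2))) => h _.
  have [v2 _] := gauss_sqr v.
  rewrite add0r /psi mulrN -mulNr -rintZ// -!rintB//; do ?[exact: intg_cos_gauss|exact: intgZ]; last first.
    by apply: intgB; exact: intg_cos_gauss.
  rewrite mulrC -rintZ//; apply: rint_norm_le.
  - by apply: intgB; [apply: intgB; exact: intg_cos_gauss|exact: intgZ].
  - exact: intgZ.
  - move=> w; rewrite scale0r addr0 dotDl dotZl (addrAC (dot xi _)) -exprMn.
    by rewrite mulNr opprK mulrA cos_remainder.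
have d2 : is_derive (0 : R) (1 : R) psi
    (- (cos th * (2^-1 * dot v xi) * expR (- 4^-1 * dot xi xi))).
  have -> : psi = (fun h : R => cos th * expR (- 4^-1 * dot xi xi) *
     expR (- 2^-1 * dot v xi * h + 0) * expR (- 4^-1 * dot v v * h ^+ 2)).
    apply/funext => h; rewrite /psi gauss_cos -!mulrA -!expRD; congr (_ * expR _).
    rewrite !(dotDl, dotDr, dotZl, dotZr).
    have -> : dot xi v = dot v xi by apply: eq_bigr => i _; rewrite mulrC.
    by field.
  apply: is_derive_eqE (is_derive_mulE (is_derive_mulE
    (is_derive_cst (cos th * expR (- 4^-1 * dot xi xi)) (0 : R) 1)
    (is_derive_compE (is_derive_expR _) (is_derive_affine (- 2^-1 * dot v xi) 0 0)))
    (is_derive_expR_sqr (- 4^-1 * dot v v) 0)) _.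
  by rewrite /= !mulr0 expr0n/= mulr0 add0r !addr0 expR0; field.
by apply: oppr_inj; exact: is_derive_unique_val d1 d2.
Qed.

End gaussian_vector_moments.

(** * Measurability and integrability of Lipschitz functions *)

Section lipschitz_measurable.
Context (R : realType) (N : nat) d (T : measurableType d) (X : T -> 'rV[R]_N).
Hypothesis mX : forall i, measurable_fun setT (fun w => X w ord0 i).

Lemma measurable_dot v : measurable_fun setT (fun w => dot v (X w)).
Proof. by apply: measurable_sum => i; apply: measurable_funM. Qed.

Lemma measurable_trig_poly (I : finType) (a : I -> R) (xi : I -> 'rV[R]_N) (th : I -> R) :
  measurable_fun setT (fun w => trig_poly a xi th (X w)).
Proof.
apply: measurable_sum => i; apply: measurable_funM => //.
apply: measurableT_comp; first exact: measurable_cos.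
by apply: measurable_funD => //; exact: measurable_dot.
Qed.

Variable g : 'rV[R]_N -> R.
Hypothesis g_lip : forall x y, `|g x - g y| <= euclidean_norm (x - y).

(** Only the coordinates of [X] are known to be measurable; [g] is the pointwise limit of
    trigonometric polynomials, whose composites with [X] are measurable. *)
Lemma measurable_lipschitz : measurable_fun setT (fun w => g (X w)).
Proof.
have H (m : nat) : exists p : 'rV[R]_N -> R,
    measurable_fun setT (fun w => p (X w)) /\
    forall x, `|p x - g x| <= m.+1%:R^-1 * (1 + dot x x).
  have m0 : 0 < m.+1%:R^-1 :> R by rewrite invr_gt0 ltr0n.
  have [I [a [xi [th [H _]]]]] := trig_approx g_lip m0.
  by exists (trig_poly a xi th); split=> //; exact: measurable_trig_poly.
have [p Hp] := choice H.
apply: (@measurable_fun_cvg _ _ _ setT (fun m w => p m (X w))) => [m|w _].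
  by have [] := Hp m.
apply/cvgrPdist_le => /= e e0.
have D0 : 0 < 1 + dot (X w) (X w) by rewrite ltr_pwDl// dot_ge0.
have e'0 : 0 < e / (1 + dot (X w) (X w)) by rewrite divr_gt0.
near=> m; have [_ /(_ (X w))] := Hp m; rewrite distrC => h; apply: le_trans h _.
rewrite -ler_pdivlMr//; apply/ltW; near: m.
exact: (near_infty_natSinv_lt (PosNum e'0)).
Unshelve. all: by end_near. Qed.

Lemma lipschitz_le x : `|g x| <= `|g 0| + 1 + dot x x.
Proof.
rewrite -[g x](subrK (g 0)) addrC -addrA; apply: le_trans (ler_normD _ _) _.
rewrite lerD2l; apply: le_trans (g_lip _ _) _.
rewrite subr0 -sqr_enorm; have := enorm_ge0 x; nra.
Qed.

Lemma intg_lipschitz (P : probability T R) : intg P (fun w => dot (X w) (X w)) ->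
  intg P (fun w => g (X w)).
Proof.
move=> i2; apply: (@intg_le _ _ _ _ _ (fun w => `|g 0| + 1 + dot (X w) (X w))).
- exact: measurable_lipschitz.
- by move=> w; exact: lipschitz_le.
- by apply: intgD => //; exact: intg_cst.
Qed.

End lipschitz_measurable.

(** * Smoothing by the Gaussian vector *)

Section gaussian_smoothing_bound.
Context (R : realType) d (T : measurableType d) (P : probability T R) (N : nat).
Variable X : T -> 'rV[R]_N.
Hypothesis X_gauss : gaussian_vector P X 0 (2^-1)%:M.
Variables (I : finType) (a : I -> R) (xi : I -> 'rV[R]_N) (th : I -> R).

Definition frob2 (B : 'M[R]_N) : R := \sum_i \sum_j B i j ^+ 2.

Lemma intg_dot_gauss_self : intg P (fun w => dot (X w) (X w)).
Proof.
have -> : (fun w => dot (X w) (X w)) = (fun w => \sum_i dot (delta_mx ord0 i) (X w) ^+ 2).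
  by apply/funext => w; apply: eq_bigr => i _; rewrite dot_delta expr2.
by apply: intg_sum => i; exact: (gauss_sqr X_gauss _).1.
Qed.

Lemma trig_poly_gauss (s : R) (x : 'rV[R]_N) :
  rint P (fun w => trig_poly a xi th (x + s *: X w)) =
  \sum_i a i * (cos (dot (xi i) x + th i) * expR (- 4^-1 * s ^+ 2 * dot (xi i) (xi i))).
Proof.
have E w : trig_poly a xi th (x + s *: X w) =
    \sum_i a i * cos (dot (s *: xi i) (X w) + (dot (xi i) x + th i)).
  apply: eq_bigr => i _; congr (_ * cos _).
  by rewrite dotDr dotZr dotZl addrA (addrC (s * _)).
rewrite (eq_rint _ E) rint_sum => [|i]; last first.
  by apply: intgZ; exact: (intg_cos_gauss X_gauss).
apply: eq_bigr => i _; rewrite rintZ; last exact: (intg_cos_gauss X_gauss).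
by rewrite (gauss_cos X_gauss) dotZl dotZr; congr (_ * (_ * expR _)); ring.
Qed.

(* Gaussian integration by parts rewrites the sum, a Hessian of the smoothed
   polynomial, through its gradient; [de] is the parameter of AM-GM. *)
Lemma trig_hess_gauss (L : R) (B : 'M[R]_N) (s de : R) (x : 'rV[R]_N) : 0 < de -> 0 <= L ->
  (forall x v, trig_grad a xi th x v <= L * euclidean_norm v) ->
  `|s * \sum_i a i * (cos (dot (xi i) x + th i) * expR (- 4^-1 * s ^+ 2 * dot (xi i) (xi i)) *
     dot (xi i) (xi i *m B))| <= L * (de + frob2 B / (2 * de)).
Proof.
move=> de0 L0 gradL.
have gradN y v : `|trig_grad a xi th y v| <= L * euclidean_norm v.
  rewrite ler_norml gradL andbT lerNl -mulN1r -trig_gradZ.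
  by apply: le_trans (gradL _ _) _; rewrite enormZ normrN1 mul1r.
have adjoint v : dot v (v *m B) = dot (v *m B) v by apply: eq_bigr => i _; rewrite mulrC.
have transp v y : dot (v *m B) y = dot v (y *m B^T).
  rewrite /dot; under eq_bigr => j _ do rewrite mxE mulr_suml.
  rewrite exchange_big/=; apply: eq_bigr => i _; rewrite mxE mulr_sumr.
  by apply: eq_bigr => j _; rewrite mxE; ring.
have i1 i : intg P (fun w => dot (xi i *m B) (X w) * sin (dot (s *: xi i) (X w) + (dot (xi i) x + th i))).
  apply: (@intgMl _ _ _ _ _ _ 1); first exact: (intg_dot_gauss X_gauss).
    exact: (measurable_sin_gauss X_gauss).
  by move=> w; exact: sin_max.
(* Apply [gauss_sin] to the frequency s xi_i and the direction xi_i B: its factor s / 2 absorbs the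
   leading [s] and leaves -2. *)
have -> : s * \sum_i a i * (cos (dot (xi i) x + th i) * expR (- 4^-1 * s ^+ 2 * dot (xi i) (xi i)) *
     dot (xi i) (xi i *m B)) =
   - (2 * rint P (fun w => trig_grad a xi th (x + s *: X w) (X w *m B^T))).
  have E w : trig_grad a xi th (x + s *: X w) (X w *m B^T) =
      \sum_i - a i * (dot (xi i *m B) (X w) * sin (dot (s *: xi i) (X w) + (dot (xi i) x + th i))).
    apply: eq_bigr => i _; rewrite -transp dotDr dotZr dotZl -mulrA; congr (_ * _).
    by rewrite mulrC addrA (addrC (s * _)).
  rewrite (eq_rint _ E) rint_sum => [|i]; last exact: intgZ.
  rewrite !mulr_sumr -sumrN; apply: eq_bigr => i _; rewrite rintZ//.
  rewrite (gauss_sin X_gauss) !dotZl !dotZr -adjoint.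
  have -> : - 4^-1 * (s * (s * dot (xi i) (xi i))) = - 4^-1 * s ^+ 2 * dot (xi i) (xi i) by ring.
  by field.
rewrite normrN normrM ger0_norm//.
pose q w := \sum_j dot (row j B) (X w) ^+ 2.
have qE w : dot (X w *m B^T) (X w *m B^T) = q w.
  apply: eq_bigr => j _; rewrite -expr2 mxE; congr (_ ^+ 2).
  by apply: eq_bigr => i _; rewrite !mxE mulrC.
have iq : intg P q by apply: intg_sum => j; exact: (gauss_sqr X_gauss _).1.
(* Each row of B contributes the second moment of one scalar product with [X]. *)
have rq : rint P q <= 2^-1 * frob2 B.
  rewrite rint_sum => [|j]; last exact: (gauss_sqr X_gauss _).1.
  rewrite mulr_sumr; apply: ler_sum => j _; apply: le_trans (gauss_sqr X_gauss _).2 _.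
  by rewrite ler_wpM2l//; apply: ler_sum => i _; rewrite mxE expr2.
have ig : intg P (fun w => trig_grad a xi th (x + s *: X w) (X w *m B^T)).
  have -> : (fun w => trig_grad a xi th (x + s *: X w) (X w *m B^T)) = (fun w =>
      \sum_i - a i * (dot (xi i *m B) (X w) * sin (dot (s *: xi i) (X w) + (dot (xi i) x + th i)))).
    apply/funext => w; apply: eq_bigr => i _; rewrite -transp dotDr dotZr dotZl -mulrA; congr (_ * _).
    by rewrite mulrC addrA (addrC (s * _)).
  by apply: intg_sum => i; exact: intgZ.
have ib : intg P (fun w => L * (2^-1 * (de + de^-1 * q w))).
  by apply: intgZ; apply: intgZ; apply: intgD; [exact: intg_cst|exact: intgZ].
(* The norm e of the direction is at most (de + e^2 / de) / 2, which only involves the second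
   moment. *)
apply: le_trans (_ : 2 * rint P (fun w => L * (2^-1 * (de + de^-1 * q w))) <= _).
  rewrite ler_pM2l//; apply: rint_norm_le => // w; apply: le_trans (gradN _ _) _.
  rewrite ler_wpM2l// -qE -sqr_enorm; set e := euclidean_norm _.
  rewrite -(ler_pM2l de0) mulrCA mulrDr mulVKf ?gt_eqF//.
  by have := sqr_ge0 (de - e); lra.
rewrite rintZ; last by apply: intgZ; apply: intgD; [exact: intg_cst|exact: intgZ].
rewrite rintZ; last by apply: intgD; [exact: intg_cst|exact: intgZ].
rewrite rintD; [|exact: intg_cst|exact: intgZ].
rewrite rint_cst rintZ// mulrCA ler_wpM2l// mulVKf// lerD2l.
by rewrite invfM mulrA [leRHS]mulrC ler_pM2l ?invr_gt0// mulrC.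
Qed.

End gaussian_smoothing_bound.

Local Open Scope complex_scope.
Local Open Scope sesquilinear_scope.

HB.instance Definition _ (R : realType) := isPointed.Build R[i] 0.

(** * Real and imaginary parts *)

Section complex_parts.
Variable R : realType.
Implicit Types (z w : R[i]) (r : R).

Lemma cReD z w : complex.Re (z + w) = complex.Re z + complex.Re w.
Proof. by case: z; case: w. Qed.

Lemma cImD z w : complex.Im (z + w) = complex.Im z + complex.Im w.
Proof. by case: z; case: w. Qed.

Lemma cReM z w : complex.Re (z * w) =
  complex.Re z * complex.Re w - complex.Im z * complex.Im w.
Proof. by case: z; case: w. Qed.

Lemma cImM z w : complex.Im (z * w) =
  complex.Re z * complex.Im w + complex.Im z * complex.Re w.
Proof. by case: z => a b; case: w => c d /=; ring. Qed.

Lemma cRe_conj z : complex.Re (conjc z) = complex.Re z.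
Proof. by case: z. Qed.

Lemma cIm_conj z : complex.Im (conjc z) = - complex.Im z.
Proof. by case: z. Qed.

Lemma ler_norm_Re z w : `|z| <= w -> `|complex.Re z| <= complex.Re w.
Proof.
move=> zw; have := le_trans (normc_ge_Re z) zw.
by rewrite lecE/= => /andP[].
Qed.

Lemma ler_norm_Im z w : `|z| <= w -> `|complex.Im z| <= complex.Re w.
Proof.
move=> zw; rewrite -normrN -ReiNIm; apply: ler_norm_Re.
rewrite normrM [ `|'i%C| ]normc_def /= expr0n expr1n /= add0r sqrtr1 mulr1.
exact: zw.
Qed.

Lemma norm_real_complex r : `|r%:C| = `|r|%:C :> R[i].
Proof. by rewrite normc_def/= expr0n/= addr0 sqrtr_sqr. Qed.

End complex_parts.

(** * Differentiation along the unitary group and Haar integration by parts *)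

Section lie_derivative.
Variables (R : realType) (n : nat).
Local Notation C := R[i].
Local Notation Mat := 'M[C]_n.
Local Notation mT := (g_sigma_algebraType (@cmx_cylinder R n n)).
Implicit Types (F G : Mat -> C) (DF DG : Mat -> Mat -> C) (M X Y H : Mat).

Definition cmeasurable F :=
  measurable_fun setT (fun A : mT => complex.Re (F A)) /\
  measurable_fun setT (fun A : mT => complex.Im (F A)).

(** Polynomials in the entries are bounded on the unitary group but not on all matrices. *)
Definition ubounded F := exists K : C, forall M, M \is unitarymx -> `|F M| <= K.

(* These are the H for which [ucurve s H] is an explicit unitary matrix; the
   directions i H span all matrices over C. *)
Definition skew_elem H := H^t* = H /\ H *m H *m H = H.

(** This is exp (i t H) with s = sin t: as H^3 = H, the exponential series collapses to 1 + i sin t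
    H - (1 - cos t) H^2. *)
Definition ucurve (s : R) H : Mat :=
  1%:M + ('i%C * s%:C) *: H - (1 - Num.sqrt (1 - s ^+ 2))%:C *: (H *m H).

(* Only the differential at the identity of s |-> F (ucurve s H *m M) is recorded,
   as a second-order Taylor bound, and DF is required to be linear over C: an
   identity E DF(M)(iH) = 0 for the H above thus extends to all directions. *)
Definition lie_diff F DF := [/\ cmeasurable F, ubounded F,
  forall X, cmeasurable (DF ^~ X) /\ ubounded (DF ^~ X),
  forall M (a : C) X Y, DF M (a *: X + Y) = a * DF M X + DF M Y &
  forall H, skew_elem H -> exists K : C, forall M (s : R), M \is unitarymx -> 0 <= s <= 1 ->
   `|F (ucurve s H *m M) - F M - s%:C * DF M ('i%C *: H)| <= K * s%:C ^+ 2].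

Lemma cmeasurable_cst (c : C) : cmeasurable (fun=> c).
Proof. by split; exact: measurable_cst. Qed.

Lemma cmeasurableD F G : cmeasurable F -> cmeasurable G -> cmeasurable (fun M => F M + G M).
Proof.
move=> [F1 F2] [G1 G2]; split.
  under [X in measurable_fun _ X]funext do rewrite cReD.
  exact: measurable_funD.
under [X in measurable_fun _ X]funext do rewrite cImD.
exact: measurable_funD.
Qed.

Lemma cmeasurableM F G : cmeasurable F -> cmeasurable G -> cmeasurable (fun M => F M * G M).
Proof.
move=> [F1 F2] [G1 G2]; split.
  under [X in measurable_fun _ X]funext do rewrite cReM.
  by apply: measurable_funB; exact: measurable_funM.
under [X in measurable_fun _ X]funext do rewrite cImM.
by apply: measurable_funD; exact: measurable_funM.
Qed.

Lemma cmeasurable_sum (I : Type) (r : seq I) (F : I -> Mat -> C) :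
  (forall i, cmeasurable (F i)) -> cmeasurable (fun M => \sum_(i <- r) F i M).
Proof.
move=> mF; elim: r => [|i r ih].
  by under [X in cmeasurable X]funext do rewrite big_nil; exact: cmeasurable_cst.
by under [X in cmeasurable X]funext do rewrite big_cons; exact: cmeasurableD.
Qed.

Lemma cmeasurable_conj F : cmeasurable F -> cmeasurable (fun M => conjc (F M)).
Proof.
move=> [F1 F2]; split.
  by under [X in measurable_fun _ X]funext do rewrite cRe_conj.
under [X in measurable_fun _ X]funext do rewrite cIm_conj.
exact: measurable_funN.
Qed.

Lemma cmeasurable_real (g : Mat -> R) :
  measurable_fun setT (g : mT -> R) -> cmeasurable (fun M => (g M)%:C).
Proof. by move=> mg; split=> //=; exact: measurable_cst. Qed.

Lemma cmeasurable_entry i j : cmeasurable (fun M => M i j).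
Proof.
by split=> _ E mE; rewrite setTI; apply: sub_sigma_algebra; exists i, j, E;
  split=> //; [left|right].
Qed.

Lemma ubounded_ge0 F : ubounded F -> exists2 K : C, 0 <= K &
  forall M, M \is unitarymx -> `|F M| <= K.
Proof.
move=> [K FK]; exists `|K| => // M uM; apply: le_trans (FK M uM) _.
by rewrite ger0_norm// (le_trans _ (FK M uM)).
Qed.

Lemma ubounded_cst (c : C) : ubounded (fun=> c).
Proof. by exists `|c|. Qed.

Lemma uboundedD F G : ubounded F -> ubounded G -> ubounded (fun M => F M + G M).
Proof.
move=> [K FK] [L GL]; exists (K + L) => M uM.
by rewrite (le_trans (ler_normD _ _))// lerD ?FK ?GL.
Qed.

Lemma uboundedM F G : ubounded F -> ubounded G -> ubounded (fun M => F M * G M).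
Proof.
move=> [K FK] [L GL]; exists (K * L) => M uM.
by rewrite normrM ler_pM ?FK ?GL.
Qed.

Lemma ubounded_conj F : ubounded F -> ubounded (fun M => conjc (F M)).
Proof.
move=> [K FK]; exists K => M uM; apply: le_trans (FK M uM).
by rewrite !normc_def cRe_conj cIm_conj sqrrN.
Qed.

Lemma unitary_entry_le1 M i j : M \is unitarymx -> `|M i j| <= 1.
Proof.
move=> /unitarymxP/matrixP/(_ i i); rewrite !mxE eqxx => MM.
have : `|M i j| ^+ 2 <= 1.
  rewrite -[leRHS]/(1%:R) -MM (bigD1 j)//= !mxE -normCK lerDl.
  by apply: sumr_ge0 => k _; rewrite !mxE -normCK exprn_ge0.
by rewrite -[X in _ <= X](expr1n C 2) ler_pXn2r// nnegrE.
Qed.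

Lemma ubounded_entry i j : ubounded (fun M => M i j).
Proof. by exists 1 => M; exact: unitary_entry_le1. Qed.

Lemma adjD (A B : Mat) : (A + B)^t* = A^t* + B^t*.
Proof. by apply/matrixP => i j; rewrite !mxE rmorphD. Qed.

Lemma adjZ (c : C) (A : Mat) : (c *: A)^t* = conjc c *: A^t*.
Proof. by apply/matrixP => i j; rewrite !mxE rmorphM. Qed.

Lemma adjN (A : Mat) : (- A)^t* = - A^t*.
Proof. by apply/matrixP => i j; rewrite !mxE rmorphN. Qed.

Lemma adjM (m p q : nat) (A : 'M[C]_(m, p)) (B : 'M[C]_(p, q)) : (A *m B)^t* = B^t* *m A^t*.
Proof. by rewrite trmx_mul map_mxM. Qed.

Lemma adjK (A : Mat) : (A^t*)^t* = A.
Proof. by apply/matrixP => i j; rewrite !mxE conjCK. Qed.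

Lemma adj1 : (1%:M : Mat)^t* = 1%:M.
Proof. by rewrite trmx1 map_mx1. Qed.

(** Q = H^2 is idempotent with H Q = H, so the product with the adjoint is 1 + (k^2 - 2 k + s^2) Q,
    and k = 1 - sqrt (1 - s^2) is a root of this polynomial. *)
Lemma ucurve_unitary s H : skew_elem H -> 0 <= s <= 1 -> ucurve s H \is unitarymx.
Proof.
move=> [HH H3] /andP[s0 s1]; apply/unitarymxP.
rewrite /ucurve; set k : R := 1 - _; set b := 'i%C * _.
have kE : k ^+ 2 - 2 * k + s ^+ 2 = 0.
  have : Num.sqrt (1 - s ^+ 2) ^+ 2 = 1 - s ^+ 2.
    by rewrite sqr_sqrtr// subr_ge0 -[leRHS](expr1n R 2) lerXn2r ?nnegrE.
  by rewrite /k; set t := Num.sqrt _ => tE; nra.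
have bb : b * b = - (s ^+ 2)%:C.
  by apply/eqP; rewrite eq_complex /b /=; apply/andP; split; apply/eqP; ring.
have bJ : conjc b = - b by apply/eqP; rewrite eq_complex /b /=; apply/andP; split; apply/eqP; ring.
have kJ : conjc k%:C = k%:C by exact: conjc_real.
rewrite !adjD adjN !adjZ adj1 adjM HH bJ kJ.
set Q := H *m H.
have HQ : H *m Q = H by rewrite mulmxA.
have QQ : Q *m Q = Q by rewrite /Q mulmxA H3.
rewrite !(mulmxDl, mulmxDr, mulNmx, mulmxN, mul1mx, mulmx1).
rewrite -!(scalemxAl, scalemxAr) HQ H3 QQ -/Q.
have : (k%:C * k%:C - k%:C - k%:C - b * b) *: Q = 0.
  have -> : k%:C * k%:C - k%:C - k%:C - b * b = (k ^+ 2 - 2 * k + s ^+ 2)%:C.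
    rewrite bb; apply/eqP; rewrite eq_complex /=; apply/andP; split; apply/eqP; ring.
  by rewrite kE scale0r.
clearbody Q k b; move=> Q0; apply/matrixP => i j; move/matrixP/(_ i j): Q0; rewrite !mxE => Q0.
by apply/eqP; rewrite -subr_eq0; apply/eqP; rewrite -[RHS]Q0; ring.
Qed.

Lemma ucurve_coef s : 0 <= s <= 1 -> `|(1 - Num.sqrt (1 - s ^+ 2))%:C| <= s%:C ^+ 2 :> C.
Proof.
move=> /andP[s0 s1]; rewrite norm_real_complex -rmorphXn lecR.
have s2 : 0 <= 1 - s ^+ 2 by rewrite subr_ge0 -[leRHS](expr1n R 2) lerXn2r ?nnegrE.
have := sqr_sqrtr s2; have := sqrtr_ge0 (1 - s ^+ 2); set t := Num.sqrt _ => t0 tE.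
rewrite ger0_norm; nra.
Qed.

Lemma ubounded_sum (I : Type) (r : seq I) (F : I -> Mat -> C) :
  (forall i, ubounded (F i)) -> ubounded (fun M => \sum_(i <- r) F i M).
Proof.
move=> mF; elim: r => [|i r ih].
  by under [X in ubounded X]funext do rewrite big_nil; exact: ubounded_cst.
by under [X in ubounded X]funext do rewrite big_cons; exact: uboundedD.
Qed.

Lemma lie_cst (c : C) : lie_diff (fun=> c) (fun _ _ => 0).
Proof.
split.
- exact: cmeasurable_cst.
- exact: ubounded_cst.
- by move=> X; split; [exact: cmeasurable_cst|exact: ubounded_cst].
- by move=> *; rewrite mulr0 addr0.
- by move=> H _; exists 0 => M s _ _; rewrite subrr mulr0 subr0 normr0 mul0r.
Qed.

Lemma lie_entry i j : lie_diff (fun M => M i j) (fun M X => (X *m M) i j).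
Proof.
have mb X : cmeasurable (fun M => (X *m M) i j) /\ ubounded (fun M => (X *m M) i j).
  split.
    under [X in cmeasurable X]funext do rewrite mxE.
    apply: cmeasurable_sum => k; apply: cmeasurableM; [exact: cmeasurable_cst|exact: cmeasurable_entry].
  under [X in ubounded X]funext do rewrite mxE.
  by apply: ubounded_sum => k; apply: uboundedM; [exact: ubounded_cst|exact: ubounded_entry].
split=> //.
- exact: cmeasurable_entry.
- exact: ubounded_entry.
- by move=> M a X Y; rewrite mulmxDl mxE -scalemxAl mxE.
- move=> H eH; have [_ [K HK]] := mb (H *m H).
  exists K => M s uM s01.
  have -> : (ucurve s H *m M) i j - M i j - s%:C * ('i%C *: H *m M) i j =
      - ((1 - Num.sqrt (1 - s ^+ 2))%:C * (H *m H *m M) i j).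
    rewrite /ucurve !mulmxDl mulNmx mul1mx -!scalemxAl !mxE; ring.
  rewrite normrN normrM mulrC ler_pM//; first exact: HK.
  exact: ucurve_coef.
Qed.

Lemma lieD F G DF DG : lie_diff F DF -> lie_diff G DG ->
  lie_diff (fun M => F M + G M) (fun M X => DF M X + DG M X).
Proof.
move=> [F1 F2 F3 F4 F5] [G1 G2 G3 G4 G5]; split.
- exact: cmeasurableD.
- exact: uboundedD.
- by move=> X; have [? ?] := F3 X; have [? ?] := G3 X; split;
    [exact: cmeasurableD|exact: uboundedD].
- by move=> M a X Y; rewrite F4 G4; ring.
- move=> H eH; have [K FK] := F5 H eH; have [L GL] := G5 H eH.
  exists (K + L) => M s uM s01; rewrite mulrDl.
  apply: le_trans (lerD (FK M s uM s01) (GL M s uM s01)).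
  by apply: le_trans (ler_normD _ _); rewrite le_eqVlt; apply/orP; left; apply/eqP; congr `|_|; ring.
Qed.

Lemma lieM F G DF DG : lie_diff F DF -> lie_diff G DG ->
  lie_diff (fun M => F M * G M) (fun M X => DF M X * G M + F M * DG M X).
Proof.
move=> [F1 F2 F3 F4 F5] [G1 G2 G3 G4 G5]; split.
- exact: cmeasurableM.
- exact: uboundedM.
- move=> X; have [? ?] := F3 X; have [? ?] := G3 X; split.
    by apply: cmeasurableD; exact: cmeasurableM.
  by apply: uboundedD; exact: uboundedM.
- by move=> M a X Y; rewrite F4 G4; ring.
- move=> H eH; have [K FK] := F5 H eH; have [L GL] := G5 H eH.
  have [bF bF0 Fb] := ubounded_ge0 F2; have [bG bG0 Gb] := ubounded_ge0 G2.
  have [bDF bDF0 DFb] := ubounded_ge0 (F3 ('i%C *: H)).2.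
  have [bDG bDG0 DGb] := ubounded_ge0 (G3 ('i%C *: H)).2.
  exists (K * bG + (bF + bDF) * L + bDF * bDG) => M s uM s01.
  have uM' := mul_unitarymx (ucurve_unitary eH s01) uM.
  have /andP[s0 s1] := s01.
  have s0' : 0 <= s%:C :> C by rewrite ler0c.
  have s1' : s%:C <= 1 :> C by rewrite -[1]/(1%:C) lecR.
  set DX := DF M _; set DY := DG M _.
  set rF := F (ucurve s H *m M) - F M - s%:C * DX.
  set rG := G (ucurve s H *m M) - G M - s%:C * DY.
  (* An exact expansion of the remainder of the product; its three terms are bounded by the three
     summands of the constant above. *)
  have -> : F (ucurve s H *m M) * G (ucurve s H *m M) - F M * G M -
      s%:C * (DX * G M + F M * DY) =
    rF * G (ucurve s H *m M) + (F M + s%:C * DX) * rG + DX * DY * s%:C ^+ 2.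
    by rewrite /rF /rG; ring.
  have -> : (K * bG + (bF + bDF) * L + bDF * bDG) * s%:C ^+ 2 =
    K * bG * s%:C ^+ 2 + (bF + bDF) * L * s%:C ^+ 2 + bDF * bDG * s%:C ^+ 2 by ring.
  apply: le_trans (ler_normD _ _) _; rewrite lerD//.
    apply: le_trans (ler_normD _ _) _; rewrite lerD//.
      by rewrite normrM mulrAC ler_pM// ?Gb// FK.
    rewrite normrM -mulrA ler_pM// ?GL//.
    apply: le_trans (ler_normD _ _) _; rewrite lerD ?Fb// normrM (ger0_norm s0').
    by rewrite -[leRHS]mul1r ler_pM// DFb.
  by rewrite normrM normrX (ger0_norm s0') normrM ler_wpM2r ?exprn_ge0// ler_pM ?DFb ?DGb.
Qed.

Lemma lie_sum (I : Type) (r : seq I) (F : I -> Mat -> C) (DF : I -> Mat -> Mat -> C) :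
  (forall i, lie_diff (F i) (DF i)) ->
  lie_diff (fun M => \sum_(i <- r) F i M) (fun M X => \sum_(i <- r) DF i M X).
Proof.
move=> dF; elim: r => [|i r ih].
  have -> : (fun M => \sum_(i <- [::]) F i M) = (fun=> 0) by apply/funext => M; rewrite big_nil.
  have -> : (fun M X => \sum_(i <- [::]) DF i M X) = (fun _ _ => 0).
    by apply/funext => M; apply/funext => X; rewrite big_nil.
  exact: lie_cst.
have -> : (fun M => \sum_(i <- i :: r) F i M) = (fun M => F i M + \sum_(i <- r) F i M).
  by apply/funext => M; rewrite big_cons.
have -> : (fun M X => \sum_(i <- i :: r) DF i M X) =
    (fun M X => DF i M X + \sum_(i <- r) DF i M X).
  by apply/funext => M; apply/funext => X; rewrite big_cons.
exact: lieD.
Qed.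

(** Conjugating a linear differential makes it antilinear; precomposing with minus the adjoint
    restores linearity over C, and this map fixes i H for Hermitian H. *)
Lemma lie_conj F DF : lie_diff F DF ->
  lie_diff (fun M => conjc (F M)) (fun M X => conjc (DF M (- X^t*))).
Proof.
move=> [F1 F2 F3 F4 F5]; split.
- exact: cmeasurable_conj.
- exact: ubounded_conj.
- by move=> X; have [? ?] := F3 (- X^t*); split; [exact: cmeasurable_conj|exact: ubounded_conj].
- move=> M a X Y; rewrite adjD adjZ opprD -scalerN F4 rmorphD rmorphM.
  by rewrite /= conjcK.
- move=> H eH; have [K FK] := F5 H eH; exists K => M s uM s01.
  have [HH _] := eH; have -> : - ('i%C *: H)^t* = 'i%C *: H.
    rewrite adjZ HH -scaleNr; congr (_ *: _).
    by apply/eqP; rewrite eq_complex/= oppr0 opprK !eqxx.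
  apply: le_trans (FK M s uM s01); rewrite -[leRHS]norm_conjC.
  rewrite le_eqVlt; apply/orP; left; apply/eqP; congr `|_|.
  rewrite !rmorphB rmorphM; congr (_ - _ * _).
  exact/esym/conjc_real.
Qed.

Lemma lie_ext F G DF DG : (forall M, F M = G M) -> (forall M X, DF M X = DG M X) ->
  lie_diff F DF -> lie_diff G DG.
Proof.
move=> FG DFG; have -> : F = G by exact/funext.
by have -> : DF = DG by apply/funext => M; apply/funext => X.
Qed.

Lemma lie_comp (f df : R -> R) (g : Mat -> R) Dg :
  measurable_fun setT f -> measurable_fun setT df ->
  (forall x, `|f x| <= 1) -> (forall x, `|df x| <= 1) ->
  (forall x y, `|f (x + y) - f x - y * df x| <= y ^+ 2) ->
  lie_diff (fun M => (g M)%:C) Dg ->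
  lie_diff (fun M => (f (g M))%:C) (fun M X => (df (g M))%:C * Dg M X).
Proof.
move=> mf mdf f1 df1 fdf [[G1 _] G2 G3 G4 G5].
have mdg : cmeasurable (fun M => (df (g M))%:C).
  by apply: cmeasurable_real; exact: measurableT_comp mdf G1.
have bdg : ubounded (fun M => (df (g M))%:C).
  by exists 1 => M _; rewrite norm_real_complex -[1]/(1%:C) lecR df1.
split.
- by apply: cmeasurable_real; exact: measurableT_comp mf G1.
- by exists 1 => M _; rewrite norm_real_complex -[1]/(1%:C) lecR f1.
- by move=> X; have [? ?] := G3 X; split; [exact: cmeasurableM|exact: uboundedM].
- by move=> M a X Y; rewrite G4; ring.
- move=> H eH; have [K GK] := G5 H eH.
  have [bD bD0 Db] := ubounded_ge0 (G3 ('i%C *: H)).2.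
  pose K' := `|K|; exists ((K' + bD) ^+ 2 + K') => M s uM s01.
  have /andP[s0 s1] := s01.
  have s0' : 0 <= s%:C :> C by rewrite ler0c.
  have s1' : s%:C <= 1 :> C by rewrite -[1]/(1%:C) lecR.
  (* This increment is at most (K' + bD) s. Its square bounds the remainder of f, while K' accounts
     for the first-order remainder of g multiplied by df. *)
  set y := g (ucurve s H *m M) - g M.
  have r1 : `|y%:C - s%:C * Dg M ('i%C *: H)| <= K' * s%:C ^+ 2.
    rewrite /y rmorphB; apply: le_trans (GK M s uM s01) _.
    have K0 : 0 <= K * s%:C ^+ 2 by apply: le_trans (GK M s uM s01).
    by rewrite -[leLHS]ger0_norm// normrM (ger0_norm (exprn_ge0 2 s0')).
  have K'0 : 0 <= K' by exact: normr_ge0.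
  have yle : `|y%:C| <= (K' + bD) * s%:C.
    rewrite -[y%:C](subrK (s%:C * Dg M ('i%C *: H))) mulrDl.
    apply: le_trans (ler_normD _ _) _; rewrite lerD//.
      apply: le_trans r1 _; rewrite ler_wpM2l// expr2 -[leRHS]mul1r ler_wpM2r//.
    by rewrite normrM (ger0_norm s0') mulrC ler_wpM2r// Db.
  have -> : (f (g (ucurve s H *m M)))%:C - (f (g M))%:C -
      s%:C * ((df (g M))%:C * Dg M ('i%C *: H)) =
    (f (g M + y) - f (g M) - y * df (g M))%:C + (df (g M))%:C * (y%:C - s%:C * Dg M ('i%C *: H)).
    have -> : g M + y = g (ucurve s H *m M) by rewrite /y addrC subrK.
    have yC : (g (ucurve s H *m M))%:C - (g M)%:C = y%:C by rewrite -rmorphB.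
    by rewrite !rmorphB rmorphM /= yC; ring.
  rewrite [leRHS]mulrDl; apply: le_trans (ler_normD _ _) _; rewrite lerD//.
    rewrite -exprMn; apply: le_trans (_ : `|y%:C| ^+ 2 <= _); last by rewrite lerXn2r ?nnegrE ?mulr_ge0 ?addr_ge0.
    by rewrite !norm_real_complex -rmorphXn lecR real_normK ?num_real.
  rewrite normrM -[leRHS]mul1r ler_pM// norm_real_complex -[1]/(1%:C) lecR//.
Qed.

End lie_derivative.

(** * Differentiation of matrix-valued maps *)

Section lie_matrix.
Variables (R : realType) (n : nat).
Local Notation C := R[i].
Local Notation Mat := 'M[C]_n.

Definition lie_mx (p q : nat) (F : Mat -> 'M[C]_(p, q)) (DF : Mat -> Mat -> 'M[C]_(p, q)) :=
  forall i j, lie_diff (fun M => F M i j) (fun M X => DF M X i j).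

Lemma lie_mx_id : lie_mx id (fun M X => X *m M).
Proof. by move=> i j; exact: lie_entry. Qed.

Lemma lie_mx_cst (p q : nat) (A : 'M[C]_(p, q)) : lie_mx (fun=> A) (fun _ _ => 0).
Proof. by move=> i j; apply: lie_ext (lie_cst n (A i j)) => // M X; rewrite mxE. Qed.

(** For skew-Hermitian X the adjoint of X M is - M^* X, and this expression is linear over C in
    X. *)
Lemma lie_mx_adj : lie_mx (fun M => M^t*) (fun M X => - (M^t* *m X)).
Proof.
move=> i j; apply: lie_ext (lie_conj (lie_entry R j i)) => [M|M X].
  by rewrite !mxE.
rewrite mulNmx !mxE rmorphN rmorph_sum; congr (- _); apply: eq_bigr => k _.
by rewrite !mxE rmorphM /= mulrC conjcK.
Qed.

Lemma lie_mxM (p q r : nat) (F : Mat -> 'M[C]_(p, q)) (G : Mat -> 'M[C]_(q, r)) DF DG :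
  lie_mx F DF -> lie_mx G DG ->
  lie_mx (fun M => F M *m G M) (fun M X => DF M X *m G M + F M *m DG M X).
Proof.
move=> dF dG i j.
apply: lie_ext (lie_sum (index_enum 'I_q) (fun k => lieM (dF i k) (dG k j))) => [M|M X].
  by rewrite mxE.
by rewrite !mxE big_split.
Qed.

Lemma lie_mxZ (p q : nat) (f : Mat -> C) Df (F : Mat -> 'M[C]_(p, q)) DF :
  lie_diff f Df -> lie_mx F DF ->
  lie_mx (fun M => f M *: F M) (fun M X => Df M X *: F M + f M *: DF M X).
Proof.
by move=> df dF i j; apply: lie_ext (lieM df (dF i j)) => [M|M X]; rewrite !mxE.
Qed.

Lemma lie_tr (p : nat) (F : Mat -> 'M[C]_p) DF : lie_mx F DF ->
  lie_diff (fun M => \tr (F M)) (fun M X => \tr (DF M X)).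
Proof. by move=> dF; exact: lie_sum (fun i => dF i i). Qed.

Lemma lie_mx_ext (p q : nat) (F G : Mat -> 'M[C]_(p, q)) DF DG :
  (forall M, F M = G M) -> (forall M X, DF M X = DG M X) -> lie_mx F DF -> lie_mx G DG.
Proof.
move=> FG DFG dF i j; apply: lie_ext (dF i j) => [M|M X]; first by rewrite FG.
by rewrite DFG.
Qed.

End lie_matrix.

(** * Expectation of complex random variables *)

Section complex_expectation.
Context (R : realType) d (T : measurableType d) (P : probability T R).
Local Notation C := R[i].
Implicit Types (f g : T -> C) (c : C).

Definition cintg f := intg P (fun w => complex.Re (f w)) /\ intg P (fun w => complex.Im (f w)).

Definition cE f : C := Complex (rint P (fun w => complex.Re (f w))) (rint P (fun w => complex.Im (f w))).

Lemma eq_cE f g : f =1 g -> cE f = cE g.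
Proof. by move=> fg; congr Complex; apply: eq_rint => w; rewrite fg. Qed.

Lemma cintg_ext f g : f =1 g -> cintg f -> cintg g.
Proof. by move=> /funext ->. Qed.

Lemma cintgD f g : cintg f -> cintg g -> cintg (fun w => f w + g w).
Proof.
move=> [f1 f2] [g1 g2]; split.
  under [X in intg _ X]funext do rewrite cReD.
  exact: intgD.
under [X in intg _ X]funext do rewrite cImD.
exact: intgD.
Qed.

Lemma cintgZ c f : cintg f -> cintg (fun w => c * f w).
Proof.
move=> [f1 f2]; split.
  under [X in intg _ X]funext do rewrite cReM.
  by apply: intgB; exact: intgZ.
under [X in intg _ X]funext do rewrite cImM.
by apply: intgD; exact: intgZ.
Qed.

Lemma cintg_sum (I : Type) (r : seq I) (f : I -> T -> C) : (forall i, cintg (f i)) ->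
  cintg (fun w => \sum_(i <- r) f i w).
Proof.
move=> fi; elim: r => [|i r ih].
  by under [X in cintg X]funext do rewrite big_nil; split; exact: intg_cst.
by under [X in cintg X]funext do rewrite big_cons; exact: cintgD.
Qed.

Lemma cED f g : cintg f -> cintg g -> cE (fun w => f w + g w) = cE f + cE g.
Proof.
move=> [f1 f2] [g1 g2]; congr Complex.
  by rewrite -rintD//; apply: eq_rint => w; rewrite cReD.
by rewrite -rintD//; apply: eq_rint => w; rewrite cImD.
Qed.

Lemma cEZ c f : cintg f -> cE (fun w => c * f w) = c * cE f.
Proof.
move=> [f1 f2]; apply/eqP; rewrite eq_complex; apply/andP; split; apply/eqP.
  rewrite cReM /= -!rintZ// -rintB; [|exact: intgZ|exact: intgZ].
  by apply: eq_rint => w; rewrite cReM.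
rewrite cImM /= -!rintZ// -rintD; [|exact: intgZ|exact: intgZ].
by apply: eq_rint => w; rewrite cImM.
Qed.

Lemma cE_cst c : cE (fun=> c) = c.
Proof. by case: c => a b; rewrite /cE !rint_cst. Qed.

Lemma cE_sum (I : Type) (r : seq I) (f : I -> T -> C) : (forall i, cintg (f i)) ->
  cE (fun w => \sum_(i <- r) f i w) = \sum_(i <- r) cE (f i).
Proof.
move=> fi; elim: r => [|i r ih].
  by under eq_cE do rewrite big_nil; rewrite big_nil cE_cst.
under eq_cE do rewrite big_cons.
by rewrite cED ?ih ?big_cons//; exact: cintg_sum.
Qed.

End complex_expectation.

(** * Invariance and integration by parts for Haar measure *)

Section haar_ibp.
Context (R : realType) d (T : measurableType d) (P : probability T R) (n : nat).
Local Notation C := R[i].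
Local Notation Mat := 'M[C]_n.
Local Notation mT := (g_sigma_algebraType (@cmx_cylinder R n n)).
Variable M : T -> Mat.
Hypothesis M_haar : haar_random_unitary P M.

Lemma measurable_haar : measurable_fun setT (M : T -> mT).
Proof. by case: M_haar => rM _ _ _ E mE; rewrite setTI; apply: rM. Qed.

Lemma haar_unitary w : M w \is unitarymx.
Proof. by case: M_haar => _ uM _; exact: uM. Qed.

Lemma cintg_haar (F : Mat -> C) : cmeasurable F -> ubounded F -> cintg P (fun w => F (M w)).
Proof.
move=> [F1 F2] [K FK]; split.
  apply: (@intg_bounded _ _ _ _ _ (complex.Re K)) => [|w].
    exact: measurableT_comp F1 measurable_haar.
  by apply: ler_norm_Re; apply: FK; exact: haar_unitary.
apply: (@intg_bounded _ _ _ _ _ (complex.Re K)) => [|w].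
  exact: measurableT_comp F2 measurable_haar.
by apply: ler_norm_Im; apply: FK; exact: haar_unitary.
Qed.

Lemma measurable_haar_mul (V : Mat) : measurable_fun setT ((fun w => V *m M w) : T -> mT).
Proof.
have mV i j : cmeasurable (fun A : Mat => (V *m A) i j).
  under [X in cmeasurable X]funext do rewrite mxE.
  apply: cmeasurable_sum => k.
  by apply: cmeasurableM; [exact: cmeasurable_cst|exact: cmeasurable_entry].
apply: (@measurability _ _ _ mT setT _ (@cmx_cylinder R n n) erefl) => _ [_ [i [j [E [mE [->|->]]]]] <-].
  have := measurableT_comp (mV i j).1 measurable_haar.
  by move=> /(_ measurableT _ mE).
have := measurableT_comp (mV i j).2 measurable_haar.
by move=> /(_ measurableT _ mE).
Qed.

(** Invariance is assumed for images of sets; the preimage of B under V is its image under the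
    adjoint of V. *)
Lemma haar_law (V : Mat) (B : set Mat) : V \is unitarymx -> borel_cmx B ->
  P [set w | B (V *m M w)] = P [set w | B (M w)].
Proof.
move=> uV mB; case: M_haar => _ _ [_ inv].
have uV' : V^t* \is unitarymx by rewrite trmxC_unitary.
rewrite -[RHS](inv (V^t*) B)//; congr (P _); apply/seteqP; split => w /=.
  move=> BV; exists (V *m M w) => //.
  by rewrite mulmxA (mulmx1C (unitarymxP uV)) mul1mx.
move=> [A BA <-]; rewrite mulmxA; have /unitarymxP -> := uV.
by rewrite mul1mx.
Qed.

Lemma haar_rint (V : Mat) (f : Mat -> R) (K : R) : V \is unitarymx ->
  measurable_fun setT (f : mT -> R) -> (forall A, A \is unitarymx -> `|f A| <= K) ->
  rint P (fun w => f (V *m M w)) = rint P (fun w => f (M w)).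
Proof.
move=> uV mf fK.
(* Equality of the laws transfers to bounded functions on R. Clipping provides one that is the
   identity on the values taken by f on unitary matrices. *)
pose clip (x : R) : R := Num.max (- K) (Num.min K x).
have K0 : 0 <= K by apply: le_trans (fK _ uV).
have clipE x : `|x| <= K -> clip x = x.
  by rewrite ler_norml => /andP[x1 x2]; rewrite /clip min_r// max_r.
have clipK x : `|clip x| <= K.
  rewrite /clip ler_norml le_max lexx /= ge_max ge_min lexx /= andbT.
  by rewrite -subr_ge0 opprK addr_ge0.
have mclip : measurable_fun setT clip.
  by apply: measurable_maxr => //; apply: measurable_minr.
have m1 : measurable_fun setT (fun w => f (V *m M w)).
  exact: measurableT_comp mf (measurable_haar_mul V).
have m2 : measurable_fun setT (fun w => f (M w)).
  exact: measurableT_comp mf measurable_haar.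
have ind (X : T -> R) (E : set R) : measurable_fun setT X -> measurable E ->
    rint P (fun w => 1 * \1_E (X w)) = fine (P [set w | E (X w)]).
  move=> mX mE; rewrite -rint_indic; last by rewrite -[X in measurable X]setTI; exact: mX.
  by apply: eq_rint => w; rewrite mul1r !indicE; congr (nat_of_bool _)%:R; apply/idP/idP; rewrite !inE.
have := weighted_extension (intg_cst P 1) (intg_cst P 1) m1 m2 _ mclip clipK.
have agree (E : set R) : measurable E ->
    rint P (fun w => 1 * \1_E (f (V *m M w))) = rint P (fun w => 1 * \1_E (f (M w))).
  move=> mE; rewrite (ind (fun w => f (V *m M w)))// (ind (fun w => f (M w)))//.
  congr fine; apply: (haar_law (B := f @^-1` E)) => //.
  by have := mf measurableT _ mE; rewrite setTI.
move=> /(_ agree) h.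
transitivity (rint P (fun w => 1 * clip (f (V *m M w)))).
  by apply: eq_rint => w; rewrite mul1r (clipE _ (fK _ (mul_unitarymx uV (haar_unitary w)))).
by rewrite h; apply: eq_rint => w; rewrite mul1r (clipE _ (fK _ (haar_unitary w))).
Qed.

Lemma haar_cE (V : Mat) (F : Mat -> C) : V \is unitarymx -> cmeasurable F -> ubounded F ->
  cE P (fun w => F (V *m M w)) = cE P (fun w => F (M w)).
Proof.
move=> uV [F1 F2] [K FK]; congr Complex.
  apply: (@haar_rint V (fun A => complex.Re (F A)) (complex.Re K)) => // A uA.
  by apply: ler_norm_Re; exact: FK.
apply: (@haar_rint V (fun A => complex.Im (F A)) (complex.Re K)) => // A uA.
by apply: ler_norm_Im; exact: FK.
Qed.

(** By invariance the increment of F along the curve has mean 0, so s E DF (i H) is minus the mean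
    of a remainder of size K s^2; divide by s and let s tend to 0. *)
Lemma haar_ibp_skew F DF (H : Mat) : lie_diff F DF -> skew_elem H ->
  cE P (fun w => DF (M w) ('i%C *: H)) = 0.
Proof.
move=> [F1 F2 F3 F4 F5] eH; have [K FK] := F5 H eH.
have [mD bD] := F3 ('i%C *: H).
have cD : cintg P (fun w => DF (M w) ('i%C *: H)) by exact: (cintg_haar mD bD).
have cF : cintg P (fun w => F (M w)) by exact: (cintg_haar F1 F2).
pose z := cE P (fun w => DF (M w) ('i%C *: H)).
have bound (s : R) : 0 <= s <= 1 -> `|complex.Re (s%:C * z)| <= complex.Re K * s ^+ 2 /\
   `|complex.Im (s%:C * z)| <= complex.Re K * s ^+ 2.
  move=> s01; have uV := ucurve_unitary eH s01.
  pose f w := F (ucurve s H *m M w) + ((-1) * F (M w) + (- s%:C) * DF (M w) ('i%C *: H)).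
  have cFV : cintg P (fun w => F (ucurve s H *m M w)).
    case: F1 => F11 F12; case: F2 => L FL; split.
      apply: (@intg_bounded _ _ _ _ _ (complex.Re L)) => [|w].
        exact: measurableT_comp F11 (measurable_haar_mul _).
      by apply: ler_norm_Re; exact: FL (mul_unitarymx uV (haar_unitary w)).
    apply: (@intg_bounded _ _ _ _ _ (complex.Re L)) => [|w].
      exact: measurableT_comp F12 (measurable_haar_mul _).
    by apply: ler_norm_Im; exact: FL (mul_unitarymx uV (haar_unitary w)).
  have cFD := cintgD (cintgZ (-1) cF) (cintgZ (- s%:C) cD).
  have cf : cintg P f by exact: (cintgD cFV cFD).
  have zE : s%:C * z = - cE P f.
    rewrite /f (cED cFV cFD) (cED (cintgZ (-1) cF) (cintgZ (- s%:C) cD)).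
    by rewrite (cEZ _ cF) (cEZ _ cD) (haar_cE uV F1 F2) -/z; ring.
  have fK w : `|f w| <= K * s%:C ^+ 2.
    have -> : f w = F (ucurve s H *m M w) - F (M w) - s%:C * DF (M w) ('i%C *: H).
      by rewrite /f; ring.
    exact: FK (haar_unitary w) s01.
  have ReK : complex.Re (K * s%:C ^+ 2) = complex.Re K * s ^+ 2.
    by rewrite -rmorphXn cReM /= mulr0 subr0.
  rewrite zE -ReK; case: cf => cf1 cf2; split.
    have -> : complex.Re (- cE P f) = - rint P (fun w => complex.Re (f w)) by [].
    rewrite normrN -[leRHS](rint_cst P); apply: rint_norm_le => // [|w]; first exact: intg_cst.
    by apply: ler_norm_Re.
  have -> : complex.Im (- cE P f) = - rint P (fun w => complex.Im (f w)) by [].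
  rewrite normrN -[leRHS](rint_cst P); apply: rint_norm_le => // [|w]; first exact: intg_cst.
  by apply: ler_norm_Im.
have zero (x k : R) : (forall s, 0 <= s <= 1 -> `|s * x| <= k * s ^+ 2) -> x = 0.
  move=> xk; have k0 : 0 <= k.
    have := xk 1; rewrite ler01 lexx mul1r expr1n mulr1 => /(_ isT); exact: le_trans.
  apply/eqP; rewrite -normr_le0; apply/ler_addgt0Pr => e e0; rewrite add0r.
  pose s := Num.min 1 (e / (k + 1)).
  have k1 : 0 < k + 1 by rewrite ltr_wpDl.
  have s0 : 0 < s by rewrite lt_min ltr01 divr_gt0.
  have s1 : s <= 1 by rewrite ge_min lexx.
  have se : s * (k + 1) <= e by rewrite -ler_pdivlMr// ge_min lexx orbT.
  have := xk s; rewrite (ltW s0) s1 normrM (gtr0_norm s0) expr2 mulrA => /(_ isT).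
  rewrite mulrAC -(mulrC s) ler_pM2l// => h; apply: le_trans h _; nra.
apply/eqP; rewrite eq_complex /=; apply/andP; split; apply/eqP.
  apply: (zero _ (complex.Re K)) => s s01; have [+ _] := bound s s01.
  by rewrite cReM /= mul0r subr0.
apply: (zero _ (complex.Re K)) => s s01; have [_ +] := bound s s01.
by rewrite cImM /= mul0r addr0.
Qed.

End haar_ibp.

(** * Contractions over matrix units *)

Section matrix_units.
Variables (R : realType) (n : nat).
Local Notation C := R[i].
Local Notation Mat := 'M[C]_n.
Local Notation E := (fun a b => delta_mx a b : Mat).
Implicit Types (A B : Mat).

Lemma adj_delta a b : (E a b)^t* = E b a.
Proof. by rewrite trmx_delta; apply/matrixP => i j; rewrite !mxE rmorph_nat. Qed.

Lemma tr_delta_mul a b A : \tr (E a b *m A) = A b a.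
Proof.
rewrite /mxtrace (bigD1 a)//= big1 => [|i ia].
  rewrite addr0 mxE (bigD1 b)//= big1 => [|k kb]; first by rewrite !mxE !eqxx mul1r addr0.
  by rewrite mxE eqxx (negbTE kb) mul0r.
by rewrite mxE big1// => k _; rewrite mxE (negbTE ia) mul0r.
Qed.

Lemma delta_mul_delta a c A : E a c *m A *m E c a = A c c *: E a a.
Proof.
apply/matrixP => i j; rewrite !mxE (bigD1 c)//= big1 => [|k kc]; last first.
  by rewrite !mxE (negbTE kc) mulr0.
rewrite addr0 mxE (bigD1 c)//= big1 => [|k kc]; last first.
  by rewrite mxE (negbTE kc) andbF mul0r.
rewrite !mxE !eqxx addr0 andbT; case: (i == a); case: (j == a) => /=; ring.
Qed.

(** Summation over the dual pairs E_ac, E_ca splits one trace into two here and merges two into one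
    in [sum_tr_delta]. Every integration by parts below ends with one of these contractions. *)
Lemma sum_tr_delta2 A B : \sum_a \sum_c \tr (E a c *m A *m E c a *m B) = \tr A * \tr B.
Proof.
rewrite mulrC mulr_suml; apply: eq_bigr => a _; rewrite mulr_sumr; apply: eq_bigr => c _.
by rewrite delta_mul_delta -scalemxAl mxtraceZ tr_delta_mul mulrC.
Qed.

Lemma sum_tr_delta A B : \sum_a \sum_c \tr (E a c *m A) * \tr (E c a *m B) = \tr (A *m B).
Proof.
rewrite exchange_big; apply: eq_bigr => c _; rewrite mxE; apply: eq_bigr => a _.
by rewrite !tr_delta_mul.
Qed.

Lemma skew_elem_diag a : skew_elem (E a a).
Proof. by split; [exact: adj_delta|rewrite !mul_delta_mx]. Qed.

Lemma skew_elem_sym a b : a != b -> skew_elem (E a b + E b a).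
Proof.
move=> ab; split; first by rewrite adjD !adj_delta addrC.
rewrite !(mulmxDl, mulmxDr) !mul_delta_mx_cond.
by rewrite !(eq_sym b a) (negbTE ab) !eqxx !(mulmxDl, mul0mx, mulr0n, mulr1n, addr0, add0r)
  !mul_delta_mx_cond !(eq_sym b a) (negbTE ab) !eqxx !(mulr0n, mulr1n, addr0, add0r) addrC.
Qed.

Lemma skew_elem_antisym a b : a != b -> skew_elem ('i%C *: (E a b - E b a)).
Proof.
move=> ab; split.
  rewrite adjZ adjD adjN !adj_delta -opprB scalerN -scaleNr; congr (_ *: _).
  by apply/eqP; rewrite eq_complex/= oppr0 opprK !eqxx.
set D := E a b - E b a.
have DD : D *m D = - (E a a + E b b).
  rewrite !(mulmxBl, mulmxBr) !mul_delta_mx_cond !(eq_sym b a) (negbTE ab) !eqxx.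
  by rewrite !mulr0n !mulr1n sub0r subr0 opprD addrC.
have D3 : D *m D *m D = - D.
  rewrite DD mulNmx mulmxDl !mulmxBr !mul_delta_mx_cond !(eq_sym b a) (negbTE ab) !eqxx.
  by rewrite !mulr0n !mulr1n subr0 sub0r.
rewrite -!(scalemxAl, scalemxAr) D3 !scalerA scalerN -scaleNr; congr (_ *: _).
by apply/eqP; rewrite eq_complex/=; apply/andP; split; apply/eqP; ring.
Qed.

End matrix_units.

(** * Integration by parts in trace form *)

Section haar_moments.
Context (R : realType) d (T : measurableType d) (P : probability T R) (n : nat).
Local Notation C := R[i].
Local Notation Mat := 'M[C]_n.
Local Notation E := (fun a b => delta_mx a b : Mat).
Variable M : T -> Mat.
Hypothesis M_haar : haar_random_unitary P M.

Lemma cintg_lie F DF : @lie_diff R n F DF -> cintg P (fun w => F (M w)).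
Proof. by case=> F1 F2 _ _ _; exact: cintg_haar. Qed.

Lemma cintg_lieD F DF X : @lie_diff R n F DF -> cintg P (fun w => DF (M w) X).
Proof. by case=> _ _ /(_ X)[D1 D2] _ _; exact: (cintg_haar M_haar D1 D2). Qed.

Lemma haar_ibp F DF X : @lie_diff R n F DF -> cE P (fun w => DF (M w) X) = 0.
Proof.
move=> dF; pose L Y := cE P (fun w => DF (M w) Y).
have [_ _ _ lin _] := dF.
have LD (a : C) Y Z : L (a *: Y + Z) = a * L Y + L Z.
  rewrite /L -cEZ; last exact: cintg_lieD dF.
  rewrite -cED; [|apply: cintgZ|]; [|exact: cintg_lieD dF|exact: cintg_lieD dF].
  by apply: eq_cE => w; rewrite lin.
have L0 : L 0 = 0.
  by have /eqP := LD (-1) 0 0; rewrite scaler0 addr0 mulN1r addNr => /eqP.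
have LZ (a : C) Y : L (a *: Y) = a * L Y by rewrite -[_ *: _]addr0 LD L0 addr0.
have LA Y Z : L (Y + Z) = L Y + L Z by rewrite -{1}[Y]scale1r LD mul1r.
have Lel H : skew_elem H -> L H = 0.
  move=> eH; have : L ('i%C *: H) = 0 by exact: haar_ibp_skew dF eH.
  rewrite LZ => /eqP; rewrite mulf_eq0 => /orP[|/eqP//].
  by rewrite eq_complex/= oner_eq0 andbF.
have LE a b : L (E a b) = 0.
  have [->|ab] := eqVneq a b; first exact/Lel/skew_elem_diag.
  have : L (E a b + E b a) = 0 by exact/Lel/skew_elem_sym.
  have : L ('i%C *: (E a b - E b a)) = 0 by exact/Lel/skew_elem_antisym.
  rewrite LZ => /eqP; rewrite mulf_eq0 => /orP[|].
    by rewrite eq_complex/= oner_eq0 andbF.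
  rewrite -scaleN1r !LA LZ mulN1r subr_eq0 => /eqP <- /eqP.
  by rewrite -mulr2n mulrn_eq0/= => /eqP.
rewrite -/(L X) (matrix_sum_delta X).
elim/big_ind : _ => [|Y Z HY HZ|a _]; [exact: L0|by rewrite LA HY HZ addr0|].
elim/big_ind : _ => [|Y Z HY HZ|b _]; [exact: L0|by rewrite LA HY HZ addr0|].
by rewrite LZ LE mulr0.
Qed.

(** Sum the integrations by parts of tr (E_ac M Psi(M)) in the directions E_ca. The products E_ac
    E_ca add up to n times the identity, so differentiating the factor M yields n tr (M Psi(M)). *)
Lemma haar_trace_ibp (Psi : Mat -> Mat) DPsi : lie_mx Psi DPsi ->
  n%:R * cE P (fun w => \tr (M w *m Psi (M w))) +
  cE P (fun w => \sum_a \sum_c \tr (E a c *m M w *m DPsi (M w) (E c a))) = 0.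
Proof.
move=> dPsi.
have dF a c := lie_tr (lie_mxM (lie_mxM (lie_mx_cst n (E a c)) (@lie_mx_id R n)) dPsi).
have I1 : lie_diff (fun A => \tr (A *m Psi A)) (fun A X => \tr (X *m A *m Psi A + A *m DPsi A X)).
  exact: lie_tr (lie_mxM (@lie_mx_id R n) dPsi).
rewrite -cEZ; last exact: cintg_lie I1.
have I2 a c : cintg P (fun w => \tr (E a c *m M w *m DPsi (M w) (E c a))).
  have := cintg_lieD (E c a) (dF a c).
  have := cintg_lie (lie_tr (lie_mxM (lie_mxM (lie_mx_cst n (E a a)) (@lie_mx_id R n)) dPsi)).
  move=> h1 h2; apply: cintg_ext (cintgD h2 (cintgZ (-1) h1)) => w /=.
  by rewrite mul0mx add0r mulmxA mul_delta_mx raddfD /= mulN1r; ring.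
rewrite -cED; last 2 first.
- by apply: cintgZ; exact: cintg_lie I1.
- by apply: cintg_sum => a; apply: cintg_sum => c; exact: I2.
transitivity (cE P (fun w => \sum_a \sum_c \tr ((0 *m M w + E a c *m (E c a *m M w)) *m Psi (M w) +
    E a c *m M w *m DPsi (M w) (E c a)))).
  apply: eq_cE => w.
  under [in RHS]eq_bigr => a _.
    under eq_bigr => c _ do rewrite mul0mx add0r mulmxA mul_delta_mx raddfD/= -mulmxA tr_delta_mul.
    rewrite big_split/= sumr_const card_ord; over.
  by rewrite big_split/=; congr (_ + _); rewrite mulr_natl -sumrMnl.
rewrite cE_sum => [|a]; last by apply: cintg_sum => c; exact: cintg_lieD (dF a c).
rewrite big1// => a _; rewrite cE_sum => [|c]; last exact: cintg_lieD (dF a c).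
by rewrite big1// => c _; exact: haar_ibp (dF a c).
Qed.

End haar_moments.

(** * Second and fourth moments of traces *)

Section haar_trace_moments.
Context (R : realType) d (T : measurableType d) (P : probability T R) (n : nat).
Local Notation C := R[i].
Local Notation Mat := 'M[C]_n.
Local Notation E := (fun a b => delta_mx a b : Mat).
Variable M : T -> Mat.
Hypothesis M_haar : haar_random_unitary P M.
Implicit Types A B K : Mat.

Let MMJ w : M w *m (M w)^t* = 1%:M.
Proof. exact/unitarymxP/(haar_unitary M_haar). Qed.

Let MJM w : (M w)^t* *m M w = 1%:M.
Proof. exact: mulmx1C (MMJ w). Qed.

Lemma sum_tr_delta_comm A K : \sum_a \sum_c \tr (E a c *m A) * \tr (K *m E c a) = \tr (A *m K).
Proof.
rewrite -sum_tr_delta; apply: eq_bigr => a _; apply: eq_bigr => c _.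
by rewrite [\tr (K *m _)]mxtrace_mulC.
Qed.

Lemma lie_tr_mul A : lie_diff (fun X : Mat => \tr (X *m A)) (fun X Y => \tr (Y *m X *m A)).
Proof.
apply: lie_ext (lie_tr (lie_mxM (@lie_mx_id R n) (lie_mx_cst n A))) => // X Y.
by rewrite mulmx0 addr0.
Qed.

Lemma lie_tr_adj A : lie_diff (fun X : Mat => \tr (X^t* *m A)) (fun X Y => - \tr (X^t* *m Y *m A)).
Proof.
apply: lie_ext (lie_tr (lie_mxM (@lie_mx_adj R n) (lie_mx_cst n A))) => // X Y.
by rewrite mulmx0 addr0 mulNmx raddfN.
Qed.

(** Take Psi(M) = A M^* B in [haar_trace_ibp]: the contraction splits the trace, and M^* M = 1 frees
    both factors from M. *)
Lemma haar_conj_tr A B :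
  n%:R * cE P (fun w => \tr (M w *m A *m (M w)^t* *m B)) = \tr A * \tr B.
Proof.
have dPsi : lie_mx (fun X : Mat => A *m X^t* *m B) (fun X Y => - (A *m X^t* *m Y *m B)).
  apply: lie_mx_ext (lie_mxM (lie_mxM (lie_mx_cst n A) (@lie_mx_adj R n)) (lie_mx_cst n B)) => // X Y.
  by rewrite mul0mx add0r mulmx0 addr0 mulmxN mulNmx !mulmxA.
have /eqP := haar_trace_ibp M_haar dPsi; rewrite addr_eq0 => /eqP.
rewrite (eq_cE _ (_ : _ =1 (fun w => \tr (M w *m A *m (M w)^t* *m B)))) => [->|w]; last first.
  by rewrite !mulmxA.
rewrite (eq_cE _ (_ : _ =1 (fun=> - (\tr A * \tr B)))); first by rewrite cE_cst opprK.
move=> w; transitivity (- (\tr (M w *m A *m (M w)^t*) * \tr B)).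
  rewrite -sum_tr_delta2 -sumrN; apply: eq_bigr => a _; rewrite -sumrN; apply: eq_bigr => c _.
  by rewrite mulmxN raddfN /= !mulmxA.
by rewrite mxtrace_mulC mulmxA MJM mul1mx.
Qed.

Lemma haar_cov A B :
  n%:R * cE P (fun w => \tr (M w *m A) * \tr ((M w)^t* *m B)) = \tr (A *m B).
Proof.
have dPsi : lie_mx (fun X : Mat => \tr (X^t* *m B) *: A)
    (fun X Y => - \tr (X^t* *m Y *m B) *: A).
  by apply: lie_mx_ext (lie_mxZ (lie_tr_adj B) (lie_mx_cst n A)) => // X Y; rewrite scaler0 addr0.
have /eqP := haar_trace_ibp M_haar dPsi; rewrite addr_eq0 => /eqP.
rewrite (eq_cE _ (_ : _ =1 (fun w => \tr (M w *m A) * \tr ((M w)^t* *m B)))) => [->|w]; last first.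
  by rewrite -scalemxAr mxtraceZ mulrC.
rewrite (eq_cE _ (_ : _ =1 (fun=> - \tr (A *m B)))); first by rewrite cE_cst opprK.
move=> w; transitivity (- \tr (M w *m A *m (B *m (M w)^t*))).
  rewrite -sum_tr_delta_comm -sumrN; apply: eq_bigr => a _; rewrite -sumrN; apply: eq_bigr => c _.
  rewrite -scalemxAr mxtraceZ mulNr mulrC !mulmxA; congr (- (_ * _)).
  by rewrite mxtrace_mulC !mulmxA.
by rewrite mulmxA mxtrace_mulC !mulmxA MJM mul1mx.
Qed.

(** Integration by parts exchanges the single trace [h] and the product of traces [p]. When A and B
    are replaced by their adjoints, [hJ] and [pJ] become the complex conjugates of [h] and [p]. *)
Let h A B w := \tr (M w *m B *m M w *m A).
Let hJ A B w := \tr ((M w)^t* *m B *m (M w)^t* *m A).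
Let p A B w := \tr (M w *m A) * \tr (M w *m B).
Let pJ A B w := \tr ((M w)^t* *m A) * \tr ((M w)^t* *m B).

(* [haar_fourth1] and [haar_fourth2] form a linear system for E hJ h and E hJ p. *)
Lemma haar_fourth1 A B A' B' :
  n%:R * cE P (fun w => hJ A' B' w * h A B w) + cE P (fun w => hJ A' B' w * p A B w) =
  cE P (fun w => \tr (B *m M w *m A *m B' *m (M w)^t* *m A') +
    \tr (M w *m (A *m A') *m (M w)^t* *m (B' *m B))).
Proof.
have dhJ : lie_diff (fun X : Mat => \tr (X^t* *m B' *m X^t* *m A'))
   (fun X Y => - (\tr (X^t* *m Y *m B' *m X^t* *m A') + \tr (X^t* *m B' *m X^t* *m Y *m A'))).
  apply: lie_ext (lie_tr (lie_mxM (lie_mxM (lie_mxM (@lie_mx_adj R n) (lie_mx_cst n B'))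
     (@lie_mx_adj R n)) (lie_mx_cst n A'))) => // X Y.
  by move: (X^t*) => Z; rewrite !mulmx0 !addr0 !mulmxDl mxtraceD opprD mulmxN !mulNmx !(raddfN (@mxtrace _ _)) !mulmxA.
have dBMA : lie_mx (fun X : Mat => B *m X *m A) (fun X Y => B *m Y *m X *m A).
  apply: lie_mx_ext (lie_mxM (lie_mxM (lie_mx_cst n B) (@lie_mx_id R n)) (lie_mx_cst n A)) => // X Y.
  by rewrite mulmx0 addr0 mul0mx add0r mulmxA.
(* Here Psi(M) = hJ(M) B M A. Differentiating B M A splits [h] into [p]; differentiating [hJ]
   cancels an M against an M^* and leaves traces with one of each. *)
have /eqP := haar_trace_ibp M_haar (lie_mxZ dhJ dBMA); rewrite addr_eq0 => /eqP.
rewrite (eq_cE _ (_ : _ =1 (fun w => hJ A' B' w * h A B w))) => [->|w]; last first.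
  by rewrite -scalemxAr mxtraceZ /h !mulmxA.
set u := fun w => \tr (B *m M w *m A *m B' *m (M w)^t* *m A') +
    \tr (M w *m (A *m A') *m (M w)^t* *m (B' *m B)).
have iph : cintg P (fun w => hJ A' B' w * p A B w).
  by apply: cintg_ext (cintg_lie M_haar (lieM dhJ (lieM (lie_tr_mul A) (lie_tr_mul B)))) => w.
have iu : cintg P u.
  have d1 := lie_tr (lie_mxM (lie_mxM dBMA (lie_mx_cst n B')) (lie_mxM (@lie_mx_adj R n) (lie_mx_cst n A'))).
  have d2 := lie_tr (lie_mxM (lie_mxM (lie_mxM (@lie_mx_id R n) (lie_mx_cst n (A *m A')))
    (@lie_mx_adj R n)) (lie_mx_cst n (B' *m B))).
  apply: cintg_ext (cintg_lie M_haar (lieD d1 d2)) => w.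
  by rewrite /u !mulmxA.
rewrite (eq_cE _ (_ : _ =1 (fun w => hJ A' B' w * p A B w + (-1) * u w))); last first.
  move=> w.
  transitivity (hJ A' B' w * (\tr (M w *m B) * \tr (M w *m A)) -
    (\tr (M w *m B *m M w *m A *m (B' *m (M w)^t* *m A' *m (M w)^t*)) +
     \tr (M w *m B *m M w *m A *m (A' *m (M w)^t* *m B' *m (M w)^t*)))).
    rewrite /hJ; move: ((M w)^t*) => V; move: (M w) => U.
    rewrite -sum_tr_delta2 -(sum_tr_delta_comm _ (B' *m _ *m _ *m _)).
    rewrite -(sum_tr_delta_comm _ (A' *m _ *m _ *m _)) -big_split/= mulr_sumr -sumrB.
    apply: eq_bigr => a _; rewrite -big_split/= mulr_sumr -sumrB; apply: eq_bigr => c _.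
    rewrite mulmxDr raddfD/= -!scalemxAr !mxtraceZ !mulmxA.
    have -> : \tr (V *m E c a *m B' *m V *m A') =
        \tr (B' *m V *m A' *m V *m E c a).
      by rewrite -!mulmxA mulmxA mxtrace_mulC !mulmxA.
    have -> : \tr (V *m B' *m V *m E c a *m A') =
        \tr (A' *m V *m B' *m V *m E c a).
      by rewrite mxtrace_mulC !mulmxA.
    by ring.
  rewrite mulN1r; congr (_ - _); first by rewrite /p [\tr (M w *m B) * _]mulrC.
  rewrite /u; congr (_ + _).
    by rewrite mulmxA mxtrace_mulC !mulmxA MJM mul1mx.
  rewrite mulmxA mxtrace_mulC !mulmxA MJM mul1mx.
  by rewrite -!mulmxA mxtrace_mulC !mulmxA.
rewrite cED//; last exact: cintgZ.
by rewrite cEZ// opprD addrAC addNr add0r mulN1r opprK.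
Qed.

Lemma haar_fourth2 A B A' B' :
  n%:R * cE P (fun w => pJ A' B' w * p A B w) + cE P (fun w => pJ A' B' w * h A B w) =
  \tr (A *m A') * cE P (fun w => \tr (M w *m B) * \tr ((M w)^t* *m B')) +
  \tr (A *m B') * cE P (fun w => \tr (M w *m B) * \tr ((M w)^t* *m A')).
Proof.
have dpJ := lieM (lie_tr_adj A') (lie_tr_adj B').
have d1 := lieM (lie_tr_mul B) dpJ.
(* Here Psi(M) = tr (M B) pJ(M) A. Differentiating tr (M B) merges [p] into [h]; differentiating
   [pJ] leaves the covariances given by [haar_cov]. *)
have dPsi := lie_mxZ d1 (lie_mx_cst n A).
have /eqP := haar_trace_ibp M_haar dPsi; rewrite addr_eq0 => /eqP.
rewrite (eq_cE _ (_ : _ =1 (fun w => pJ A' B' w * p A B w))) => [->|w]; last first.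
  by rewrite -scalemxAr mxtraceZ /p /pJ /=; ring.
have iph : cintg P (fun w => pJ A' B' w * h A B w).
  have dh := lie_tr (lie_mxM (lie_mxM (lie_mxM (@lie_mx_id R n) (lie_mx_cst n B))
    (@lie_mx_id R n)) (lie_mx_cst n A)).
  by apply: cintg_ext (cintg_lie M_haar (lieM dpJ dh)) => w.
have iB : cintg P (fun w => \tr (M w *m B) * \tr ((M w)^t* *m B')).
  by apply: cintg_ext (cintg_lie M_haar (lieM (lie_tr_mul B) (lie_tr_adj B'))) => w.
have iA : cintg P (fun w => \tr (M w *m B) * \tr ((M w)^t* *m A')).
  by apply: cintg_ext (cintg_lie M_haar (lieM (lie_tr_mul B) (lie_tr_adj A'))) => w.
rewrite (eq_cE _ (_ : _ =1 (fun w => pJ A' B' w * h A B w +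
   ((- \tr (A *m A')) * (\tr (M w *m B) * \tr ((M w)^t* *m B')) +
    (- \tr (A *m B')) * (\tr (M w *m B) * \tr ((M w)^t* *m A')))))); last first.
  move=> w.
  transitivity (pJ A' B' w * \tr (M w *m A *m (M w *m B)) +
    (- \tr (M w *m A *m (A' *m (M w)^t*)) * (\tr (M w *m B) * \tr ((M w)^t* *m B')) +
    - \tr (M w *m A *m (B' *m (M w)^t*)) * (\tr (M w *m B) * \tr ((M w)^t* *m A')))).
    rewrite /pJ; set tB := \tr (M w *m B); set tA' := \tr ((M w)^t* *m A').
    set tB' := \tr ((M w)^t* *m B'); move: tB tA' tB' => tB tA' tB'.
    rewrite -(sum_tr_delta (M w *m A) (M w *m B)).
    rewrite -(sum_tr_delta_comm (M w *m A) (A' *m _)) -(sum_tr_delta_comm (M w *m A) (B' *m _)).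
    rewrite !mulNr !mulr_suml mulr_sumr -!sumrN -!big_split/=; apply: eq_bigr => a _.
    rewrite !mulr_suml mulr_sumr -!sumrN -!big_split/=; apply: eq_bigr => c _.
    rewrite scaler0 addr0 -scalemxAr mxtraceZ !mulmxA.
    have trA K : \tr (K *m (M w)^t* *m E c a) = \tr ((M w)^t* *m E c a *m K).
      by rewrite -mulmxA mxtrace_mulC.
    by rewrite !trA; ring.
  have trM K : \tr (M w *m A *m (K *m (M w)^t*)) = \tr (A *m K).
    by rewrite mulmxA mxtrace_mulC !mulmxA MJM mul1mx.
  rewrite !trM; congr (_ * _ + _).
  by rewrite /h mxtrace_mulC !mulmxA.
rewrite cED//; last by apply: cintgD; exact: cintgZ.
rewrite cED; [|exact: cintgZ|exact: cintgZ].
by rewrite !cEZ//; ring.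
Qed.

End haar_trace_moments.

(** * Squared modulus and the trace inner product *)

Section squared_modulus.
Variable R : realType.
Implicit Types z w : R[i].

Lemma cReN z : complex.Re (- z) = - complex.Re z.
Proof. by case: z. Qed.

Definition sqmod z : R := complex.Re z ^+ 2 + complex.Im z ^+ 2.

Lemma sqmod_ge0 z : 0 <= sqmod z.
Proof. by rewrite addr_ge0 ?sqr_ge0. Qed.

Lemma sqmodE z : conjc z * z = (sqmod z)%:C.
Proof. by case: z => a b; apply/eqP; rewrite eq_complex /sqmod /=; apply/andP; split; apply/eqP; ring. Qed.

Lemma Re_sqmod z : complex.Re (conjc z * z) = sqmod z.
Proof. by rewrite sqmodE. Qed.

Lemma sqmodM z w : sqmod (z * w) = sqmod z * sqmod w.
Proof. by case: z => a b; case: w => c d; rewrite /sqmod /=; ring. Qed.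

Lemma Re_conjM z w : complex.Re (conjc z * w) = complex.Re (conjc w * z).
Proof. by case: z => a b; case: w => c d /=; ring. Qed.

Lemma Re_conjM_le z w : `|2 * complex.Re (conjc z * w)| <= sqmod z + sqmod w.
Proof.
case: z => a b; case: w => c d; rewrite /sqmod /= ler_norml.
have := sqr_ge0 (a - c); have := sqr_ge0 (b - d); have := sqr_ge0 (a + c); have := sqr_ge0 (b + d).
by move=> *; apply/andP; split; nra.
Qed.

Variable n : nat.
Implicit Types A B : 'M[R[i]]_n.

Lemma tr_adj A : \tr (A^t*) = conjc (\tr A).
Proof. by rewrite [RHS]rmorph_sum; apply: eq_bigr => i _; rewrite !mxE. Qed.

Lemma tr_mul_adj A : \tr (A *m A^t*) = (\sum_i \sum_j sqmod (A i j))%:C.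
Proof.
rewrite rmorph_sum; apply: eq_bigr => i _; rewrite mxE rmorph_sum; apply: eq_bigr => j _.
by rewrite !mxE mulrC /= -sqmodE.
Qed.

Lemma Re_tr_mul_adj_le A B : complex.Re (\tr (A *m B^t*)) <=
  2^-1 * (complex.Re (\tr (A *m A^t*)) + complex.Re (\tr (B *m B^t*))).
Proof.
have : 0 <= complex.Re (\tr ((A - B) *m (A - B)^t*)).
  by rewrite tr_mul_adj /=; apply: sumr_ge0 => i _; apply: sumr_ge0 => j _; exact: sqmod_ge0.
rewrite adjD adjN mulmxBl !mulmxDr !mulmxN !raddfD /= !raddfN /=.
have -> : \tr (B *m A^t*) = conjc (\tr (A *m B^t*)) by rewrite -tr_adj adjM adjK.
case: (\tr (A *m B^t*)) => x1 x2; case: (\tr (A *m A^t*)) => a1 a2.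
case: (\tr (B *m B^t*)) => b1 b2 /=; lra.
Qed.

End squared_modulus.

(** * Bound on the error terms and the Stein identity *)

Section haar_bounds.
Context (R : realType) d (T : measurableType d) (P : probability T R) (n : nat).
Local Notation C := R[i].
Local Notation Mat := 'M[C]_n.
Local Notation E := (fun a b => delta_mx a b : Mat).
Variable M : T -> Mat.
Hypothesis M_haar : haar_random_unitary P M.
Implicit Types A B K : Mat.

Lemma lie_tr_quad A B : lie_diff (fun X : Mat => \tr (X *m B *m X *m A))
  (fun X Y => \tr (((Y *m X *m B + X *m 0) *m X + X *m B *m (Y *m X)) *m A + X *m B *m X *m 0)).
Proof.
exact: lie_tr (lie_mxM (lie_mxM (lie_mxM (@lie_mx_id R n) (lie_mx_cst n B))
    (@lie_mx_id R n)) (lie_mx_cst n A)).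
Qed.

Lemma rint_Re (f : T -> C) : rint P (fun w => complex.Re (f w)) = complex.Re (cE P f).
Proof. by []. Qed.

Lemma intg_sqmod (F : Mat -> C) DF : lie_diff F DF -> intg P (fun w => sqmod (F (M w))).
Proof.
move=> dF; have [+ _] := cintg_lie M_haar (lieM (lie_conj dF) dF).
by under [X in intg _ X]funext do rewrite Re_sqmod.
Qed.

(** Let a = E |h|^2, c = E |p|^2 and x the mean of the real part of conj(h) p. The moment identities
    give n a + x <= 2 n and n c + x <= 2 n, while |2 x| <= a + c. Adding, (n - 1) (a + c) <= 4 n, so
    a <= 4 n / (n - 1) <= 8 when n >= 2. The boolean covers at once the cases of equal and of
    distinct indices. *)
Lemma haar_quad_bound A B (b : bool) : (0 < n)%N ->
  \tr (A *m A^t*) = n%:R -> \tr (B *m B^t*) = n%:R ->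
  \tr (A *m B^t*) = n%:R * b%:R -> \tr (B *m A^t*) = n%:R * b%:R ->
  rint P (fun w => sqmod (\tr (M w *m B *m M w *m A))) <= 8.
Proof.
move=> n0 AA BB AB BA.
have AA' : \tr (A^t* *m A) = n%:R by rewrite mxtrace_mulC.
have BB' : \tr (B^t* *m B) = n%:R by rewrite mxtrace_mulC.
have nC : n%:R != 0 :> C by rewrite pnatr_eq0 -lt0n.
have nR : 0 < n%:R :> R by rewrite ltr0n.
pose h w := \tr (M w *m B *m M w *m A).
pose p w := \tr (M w *m A) * \tr (M w *m B).
have hJE w : \tr ((M w)^t* *m B^t* *m (M w)^t* *m A^t*) = conjc (h w).
  by rewrite /h [in RHS]mxtrace_mulC -tr_adj !adjM !mulmxA.
have pJE w : \tr ((M w)^t* *m A^t*) * \tr ((M w)^t* *m B^t*) = conjc (p w).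
  by rewrite /p rmorphM /= -!tr_adj !adjM; congr (_ * _); rewrite mxtrace_mulC.
have dh := lie_tr_quad A B.
have dp := lieM (lie_tr_mul A) (lie_tr_mul B).
have f1 := haar_fourth1 M_haar A B (A^t*) (B^t*).
have f2 := haar_fourth2 M_haar A B (A^t*) (B^t*).
pose a := rint P (fun w => sqmod (h w)); pose c := rint P (fun w => sqmod (p w)).
pose x := rint P (fun w => complex.Re (conjc (h w) * p w)).
have ia : intg P (fun w => sqmod (h w)) by exact: intg_sqmod dh.
have ic : intg P (fun w => sqmod (p w)) by exact: intg_sqmod dp.
have ix : intg P (fun w => complex.Re (conjc (h w) * p w)).
  by have [+ _] := cintg_lie M_haar (lieM (lie_conj dh) dp).
have ReM_nat (z : C) : complex.Re (n%:R * z) = n%:R * complex.Re z.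
  have -> : n%:R = (n%:R : R)%:C :> C by rewrite rmorph_nat.
  by rewrite cReM /= mul0r subr0.
pose r K L w := complex.Re (\tr (M w *m K *m (M w)^t* *m L)).
have Er K L : \tr K = n%:R -> \tr L = n%:R -> rint P (r K L) = n%:R.
  move=> trK trL; apply: (mulfI (lt0r_neq0 nR)).
  rewrite /r rint_Re -ReM_nat haar_conj_tr// trK trL.
  have -> : n%:R * n%:R = (n%:R * n%:R : R)%:C :> C by rewrite rmorphM !rmorph_nat.
  by [].
have ir K L : intg P (r K L).
  have [+ _] := cintg_lie M_haar (lie_tr (lie_mxM (lie_mxM (lie_mxM (@lie_mx_id R n) (lie_mx_cst n K))
    (@lie_mx_adj R n)) (lie_mx_cst n L))).
  by [].
have ha : n%:R * a + x <= 2 * n%:R.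
  have -> : n%:R * a + x = complex.Re (n%:R * cE P (fun w => \tr ((M w)^t* *m B^t* *m (M w)^t* *m A^t*) * h w) +
     cE P (fun w => \tr ((M w)^t* *m B^t* *m (M w)^t* *m A^t*) * p w)).
    rewrite cReD ReM_nat; congr (_ * _ + _).
      by apply: eq_rint => w; rewrite hJE Re_sqmod.
    by apply: eq_rint => w; rewrite hJE.
  rewrite f1 -rint_Re.
  set u := fun w => _.
  have iu : intg P u.
    have d1 := lie_tr (lie_mxM (lie_mxM (lie_mxM (lie_mxM (lie_mx_cst n B) (@lie_mx_id R n)) (lie_mx_cst n A)) (lie_mx_cst n (B^t*)))
      (lie_mxM (@lie_mx_adj R n) (lie_mx_cst n (A^t*)))).
    have d2 := lie_tr (lie_mxM (lie_mxM (lie_mxM (@lie_mx_id R n) (lie_mx_cst n (A *m A^t*)))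
      (@lie_mx_adj R n)) (lie_mx_cst n (B^t* *m B))).
    have [+ _] := cintg_lie M_haar (lieD d1 d2).
    by under [X in intg _ X]funext do rewrite !mulmxA; rewrite /u;
      under [X in _ -> intg _ X]funext do rewrite !mulmxA.
  (* The first trace of [u] is an inner product of two matrices, bounded by half the sum of their
     squared norms, which are [r1] and [r2]; the second trace is [r1]. Both have mean n by
     [haar_conj_tr]. *)
  pose r1 := r (A *m A^t*) (B^t* *m B); pose r2 := r (B *m B^t*) (A^t* *m A).
  have i1 : intg P r1 by exact: ir.
  have i2 : intg P r2 by exact: ir.
  apply: le_trans (_ : rint P (fun w => 2^-1 * (r1 w + r2 w) + r1 w) <= _).
    apply: rint_le => // [|w].
      exact: intgD (intgZ 2^-1 (intgD i1 i2)) i1.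
    rewrite /u cReD lerD//.
    have -> : \tr (B *m M w *m A *m B^t* *m (M w)^t* *m A^t*) =
        \tr ((B *m M w *m A) *m (A *m M w *m B)^t*).
      by rewrite !adjM !mulmxA.
    apply: le_trans (Re_tr_mul_adj_le _ _) _.
    have rE K L : \tr ((L *m M w *m K) *m (L *m M w *m K)^t*) =
        \tr (M w *m (K *m K^t*) *m (M w)^t* *m (L^t* *m L)).
      rewrite !adjM !mulmxA [RHS]mxtrace_mulC !mulmxA; congr (\tr _).
    by rewrite !rE /r1 /r2 /r.
  rewrite (rintD (intgZ 2^-1 (intgD i1 i2)) i1) (rintZ _ (intgD i1 i2)) (rintD i1 i2).
  by rewrite /r1 /r2 !Er//; lra.
have hc : n%:R * c + x <= 2 * n%:R.
  have -> : n%:R * c + x = complex.Re (n%:R * cE P (fun w => \tr ((M w)^t* *m A^t*) * \tr ((M w)^t* *m B^t*) * p w) +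
     cE P (fun w => \tr ((M w)^t* *m A^t*) * \tr ((M w)^t* *m B^t*) * h w)).
    rewrite cReD ReM_nat; congr (_ * _ + _).
      by apply: eq_rint => w; rewrite pJE Re_sqmod.
    by apply: eq_rint => w; rewrite pJE Re_conjM.
  rewrite f2.
  have c1 : cE P (fun w => \tr (M w *m B) * \tr ((M w)^t* *m B^t*)) = 1.
    by apply: (mulfI nC); rewrite haar_cov// BB mulr1.
  have c2 : cE P (fun w => \tr (M w *m B) * \tr ((M w)^t* *m A^t*)) = b%:R.
    by apply: (mulfI nC); rewrite haar_cov// BA.
  rewrite c1 c2 AA AB mulr1 -mulrA -natrM mulnb andbb.
  rewrite cReD ReM_nat.
  have -> : complex.Re (n%:R : C) = n%:R by rewrite -[n%:R]mulr1 ReM_nat mulr1.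
  by case: b {AB BA c2} => /=; rewrite ?mulr1 ?mulr0; lra.
have hx : `|2 * x| <= a + c.
  rewrite -rintZ// -rintD//; apply: rint_norm_le.
  - exact: intgZ.
  - exact: intgD.
  - by move=> w; exact: Re_conjM_le.
have a0 : 0 <= a by apply: rint_ge0 => w; exact: sqmod_ge0.
have c0 : 0 <= c by apply: rint_ge0 => w; exact: sqmod_ge0.
move: hx; rewrite ler_norml => /andP[hx _].
have [n2|n1] := leqP 2 n.
  rewrite -/(rint P _) -/a.
  have : 2 <= n%:R :> R by rewrite ler_nat.
  nra.
(* For n = 1 the factor n - 1 vanishes and the inequalities say nothing, but all matrices are then
   scalars of modulus 1. *)
pose o := Ordinal n0.
have all_o (i : 'I_n) : i = o.
  by apply/val_inj => /=; case: i => [[|i]] //= hi; have := leq_ltn_trans hi n1.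
have sum1 (F : 'I_n -> C) : \sum_i F i = F o.
  by rewrite (bigD1 o)//= big1 ?addr0// => i; rewrite (all_o i) eqxx.
have tr1 K : \tr K = K o o by exact: sum1.
have mul1 K L : (K *m L) o o = K o o * L o o by rewrite mxE sum1.
have nE : n%:R = 1 :> C.
  by rewrite (_ : n = 1%N)//; apply/eqP; rewrite eqn_leq -ltnS n1.
have sq1 K : \tr (K *m K^t*) = n%:R -> sqmod (K o o) = 1.
  rewrite tr1 mul1 !mxE nE mulrC => /(congr1 (@complex.Re R)) /=.
  by rewrite -/(conjc _) Re_sqmod.
have sqM w : sqmod (M w o o) = 1.
  by apply: sq1; have /unitarymxP -> := haar_unitary M_haar w; rewrite mxtrace1.
rewrite (eq_rint _ (_ : _ =1 fun=> 1)) ?rint_cst; first by rewrite ler1n.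
by move=> w; rewrite tr1 !mul1 !sqmodM !sqM (sq1 A)// (sq1 B)// !mulr1.
Qed.

Lemma haar_stein K (th : R) :
  n%:R * rint P (fun w => sin (complex.Re (\tr (M w *m K)) + th) * complex.Re (\tr (M w *m K))) =
  2^-1 * rint P (fun w => cos (complex.Re (\tr (M w *m K)) + th) *
    (complex.Re (\tr (K *m K^t*)) - complex.Re (\tr (M w *m K *m M w *m K)))).
Proof.
pose g (X : Mat) : R := complex.Re (\tr (X *m K)).
(* The real part is half the sum of tr (X K) and its conjugate; differentiating the conjugate
   produces the minus sign. *)
pose Dg (X Y : Mat) : C := 2^-1 * (\tr (Y *m X *m K) - \tr (X^t* *m Y *m K^t*)).
have half2 (z : C) : (complex.Re z)%:C = 2^-1 * (z + conjc z).
  by rewrite ReJ_add mulrC.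
have dg : lie_diff (fun X => (g X)%:C) Dg.
  apply: lie_ext (lieM (lie_cst n 2^-1) (lieD (lie_tr_mul K) (lie_tr_adj (K^t*)))) => [X|X Y].
    by rewrite /g half2 -tr_adj adjM [\tr (K^t* *m _)]mxtrace_mulC.
  by rewrite mul0r add0r.
have maff : measurable_fun setT (fun x : R => x + th) by exact: measurable_funD.
have msin : measurable_fun setT (fun x : R => sin (x + th)).
  exact: measurableT_comp (@measurable_sin R) maff.
have mcos : measurable_fun setT (fun x : R => cos (x + th)).
  exact: measurableT_comp (@measurable_cos R) maff.
have dsin : lie_diff (fun X => (sin (g X + th))%:C) (fun X Y => (cos (g X + th))%:C * Dg X Y).
  apply: (@lie_comp R n (fun x => sin (x + th)) (fun x => cos (x + th))) => // [x|x|x y].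
  - exact: sin_max.
  - exact: cos_max.
  - by rewrite (addrAC x); exact: sin_remainder.
have dcos : lie_diff (fun X => (cos (g X + th))%:C) (fun X Y => (- sin (g X + th))%:C * Dg X Y).
  apply: (@lie_comp R n (fun x => cos (x + th)) (fun x => - sin (x + th))) => // [|x|x|x y].
  - exact: measurable_funN.
  - exact: cos_max.
  - by rewrite normrN sin_max.
  - by rewrite (addrAC x) mulrN opprK; exact: cos_remainder.
(* With this Psi both contractions merge traces: one gives tr (M K M K), the other tr (K K^* ),
   since M is unitary. *)
have dPsi : lie_mx (fun X => (sin (g X + th))%:C *: K)
    (fun X Y => ((cos (g X + th))%:C * Dg X Y) *: K).
  by apply: lie_mx_ext (lie_mxZ dsin (lie_mx_cst n K)) => // X Y; rewrite scaler0 addr0.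
have /eqP := haar_trace_ibp M_haar dPsi; rewrite addr_eq0 => /eqP/(congr1 (@complex.Re R)).
have nC (z : C) : complex.Re (n%:R * z) = n%:R * complex.Re z.
  have -> : n%:R = (n%:R : R)%:C :> C by rewrite rmorph_nat.
  by rewrite cReM /= mul0r subr0.
have ReZ (r : R) (z : C) : complex.Re (r%:C * z) = r * complex.Re z.
  by rewrite cReM /= mul0r subr0.
rewrite nC => E1.
have -> : rint P (fun w => sin (complex.Re (\tr (M w *m K)) + th) * complex.Re (\tr (M w *m K))) =
    complex.Re (cE P (fun w => \tr (M w *m ((sin (g (M w) + th))%:C *: K)))).
  by apply: eq_rint => w; rewrite -scalemxAr mxtraceZ ReZ.
rewrite E1 -[complex.Re _]/(- rint P _).
have MJM w : (M w)^t* *m M w = 1%:M.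
  by apply: mulmx1C; exact/unitarymxP/(haar_unitary M_haar).
have sumE w : \sum_a \sum_c \tr (E a c *m M w *m (((cos (g (M w) + th))%:C * Dg (M w) (E c a)) *: K)) =
    (cos (g (M w) + th))%:C * (2^-1 * (\tr (M w *m K *m M w *m K) - \tr (K *m K^t*))).
  have -> : \tr (K *m K^t*) = \tr (M w *m K *m (K^t* *m (M w)^t*)).
    by rewrite !mulmxA [RHS]mxtrace_mulC !mulmxA MJM mul1mx.
  rewrite -[_ *m M w *m K]mulmxA -(sum_tr_delta (M w *m K)) -(sum_tr_delta_comm (M w *m K) (K^t* *m _)).
  rewrite -sumrB !mulr_sumr; apply: eq_bigr => a _.
  rewrite -sumrB !mulr_sumr; apply: eq_bigr => c _.
  rewrite -scalemxAr mxtraceZ /Dg !mulmxA.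
  have -> : \tr ((M w)^t* *m E c a *m K^t*) = \tr (K^t* *m (M w)^t* *m E c a).
    by rewrite mxtrace_mulC !mulmxA.
  by ring.
have dq := lie_tr_quad K K.
have icos : intg P (fun w => cos (complex.Re (\tr (M w *m K)) + th) *
    (complex.Re (\tr (K *m K^t*)) - complex.Re (\tr (M w *m K *m M w *m K)))).
  have [+ _] := cintg_lie M_haar (lieM dcos (lieD (lie_cst n (\tr (K *m K^t*))) (lieM (lie_cst n (-1)) dq))).
  by under [X in intg _ X]funext do rewrite ReZ mulN1r cReD cReN.
rewrite -(rintZ _ icos) -rintN; last first.
  have := intgZ (- 2^-1) icos; congr (intg P _); apply/funext => w.
  rewrite sumE ReZ; have -> : 2^-1 = (2^-1 : R)%:C :> C by rewrite fmorphV rmorph_nat.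
  by rewrite ReZ cReD cReN; ring.
apply: eq_rint => w.
rewrite sumE ReZ; have -> : 2^-1 = (2^-1 : R)%:C :> C by rewrite fmorphV rmorph_nat.
by rewrite ReZ cReD cReN /g; ring.
Qed.

End haar_bounds.

Lemma is_derive_bigsum (R : realType) (I : Type) (r : seq I) (f : I -> R -> R) (df : I -> R) (x : R) :
  (forall i, is_derive x (1 : R) (f i) (df i)) ->
  is_derive x (1 : R) (fun y => \sum_(i <- r) f i y) (\sum_(i <- r) df i).
Proof.
move=> fdf; elim: r => [|i r ih].
  rewrite big_nil; have -> : (fun y => \sum_(i <- [::]) f i y) = cst 0.
    by apply/funext => y; rewrite big_nil.
  exact: is_derive_cst.
rewrite big_cons; have -> : (fun y => \sum_(j <- i :: r) f j y) =
    f i + (fun y => \sum_(j <- r) f j y).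
  by apply/funext => y; rewrite big_cons.
exact: is_deriveD.
Qed.

Lemma cRe_sum (R : realType) (I : Type) (r : seq I) (F : I -> R[i]) :
  complex.Re (\sum_(j <- r) F j) = \sum_(j <- r) complex.Re (F j).
Proof. by elim/big_rec2 : _ => // j x y _ <-; rewrite cReD. Qed.

Lemma cIm_sum (R : realType) (I : Type) (r : seq I) (F : I -> R[i]) :
  complex.Im (\sum_(j <- r) F j) = \sum_(j <- r) complex.Im (F j).
Proof. by elim/big_rec2 : _ => // j x y _ <-; rewrite cImD. Qed.

(** * Comparison of the traces with the Gaussian vector *)

Section trace_vector.
Context (R : realType) d (T : measurableType d) (P : probability T R) (n k : nat).
Local Notation C := R[i].
Variable M : T -> 'M[C]_n.
Hypothesis M_haar : haar_random_unitary P M.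
Variable A : 'I_k -> 'M[C]_n.
Hypothesis A_orth : forall i j : 'I_k, \tr (A i *m (A j)^t*) = n%:R * (i == j)%:R.
Hypothesis n_gt0 : (0 < n)%N.
Implicit Types v : 'rV[R]_(k + k).

Definition trace_vec w : 'rV[C]_k := \row_(j < k) \tr (A j *m M w).

(** The minus sign comes from Re ((x - i y) z) = x Re z + y Im z. *)
Definition lin_comb v : 'M[C]_n :=
  \sum_j Complex (v ord0 (lshift k j)) (- v ord0 (rshift k j)) *: A j.

Lemma dot_trace_vec v w : dot v (realify (trace_vec w)) = complex.Re (\tr (M w *m lin_comb v)).
Proof.
rewrite /lin_comb mulmx_sumr (raddf_sum (@mxtrace _ _)) cRe_sum /dot big_split_ord/= -big_split/=.
apply: eq_bigr => j _.
rewrite /realify row_mxEl row_mxEr !mxE -scalemxAr mxtraceZ cReM /= [\tr (M w *m _)]mxtrace_mulC.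
ring.
Qed.

Lemma tr_lin_comb v : complex.Re (\tr (lin_comb v *m (lin_comb v)^t*)) = n%:R * dot v v.
Proof.
have adj_sum (F : 'I_k -> 'M[C]_n) : (\sum_j F j)^t* = \sum_j (F j)^t*.
  elim/big_rec2 : _ => [|j x y _ <-]; last by rewrite adjD.
  by apply/matrixP => i j; rewrite !mxE conjC0.
rewrite /lin_comb adj_sum mulmx_suml (raddf_sum (@mxtrace _ _)) /=.
rewrite (eq_bigr (fun j => (n%:R * (v ord0 (lshift k j) ^+ 2 + v ord0 (rshift k j) ^+ 2))%:C)).
  rewrite -rmorph_sum /= -mulr_sumr /dot big_split_ord/= -big_split/=.
  by congr (_ * _); apply: eq_bigr => j _; rewrite !expr2.
move=> j _; rewrite mulmx_sumr (raddf_sum (@mxtrace _ _)) (bigD1 j)//= big1 => [|l lj]; last first.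
  by rewrite adjZ -scalemxAl -scalemxAr !mxtraceZ A_orth eq_sym (negbTE lj) !mulr0.
rewrite addr0 adjZ -scalemxAl -scalemxAr !mxtraceZ A_orth eqxx mulr1.
have -> : n%:R = (n%:R : R)%:C :> C by rewrite rmorph_nat.
by apply/eqP; rewrite eq_complex /=; apply/andP; split; apply/eqP; ring.
Qed.

Definition quad_tr w (j l : 'I_k) : C := \tr (M w *m A l *m M w *m A j).

(** The matrix of the quadratic form v -> Re tr (M K M K), with K = [lin_comb A v]: the real part of
    (x - i y) (x' - i y') z is (x x' - y y') Re z + (x y' + y x') Im z. *)
Definition err_mx w : 'M[R]_(k + k) :=
  block_mx (\matrix_(j, l) complex.Re (quad_tr w j l)) (\matrix_(j, l) complex.Im (quad_tr w j l))
    (\matrix_(j, l) complex.Im (quad_tr w j l)) (- \matrix_(j, l) complex.Re (quad_tr w j l)).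

Lemma quad_lin_comb v w : complex.Re (\tr (M w *m lin_comb v *m M w *m lin_comb v)) =
  dot v (v *m err_mx w).
Proof.
rewrite {2}/lin_comb mulmx_sumr (raddf_sum (@mxtrace _ _)) cRe_sum.
rewrite /dot big_split_ord/= -big_split/=.
apply: eq_bigr => j _; rewrite -scalemxAr mxtraceZ cReM /=.
rewrite /lin_comb mulmx_sumr !mulmx_suml (raddf_sum (@mxtrace _ _)) cRe_sum cIm_sum.
rewrite ![(_ *m err_mx w) _ _]mxE !big_split_ord/= -!big_split/= !mulr_sumr -sumrB -big_split/=.
apply: eq_bigr => l _.
rewrite /err_mx block_mxEul block_mxEur block_mxEdl block_mxEdr.
rewrite -scalemxAr -!scalemxAl mxtraceZ -/(quad_tr w j l) !mxE.
have -> : quad_tr w l j = quad_tr w j l.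
  by rewrite /quad_tr -mulmxA mxtrace_mulC !mulmxA.
case: (quad_tr w j l) => x y /=; ring.
Qed.

Lemma frob2_err_mx w : frob2 (err_mx w) = 2 * \sum_j \sum_l sqmod (quad_tr w j l).
Proof.
rewrite /frob2 big_split_ord/= -big_split mulr_sumr /=; apply: eq_bigr => j _.
rewrite !big_split_ord/= -!big_split mulr_sumr /=; apply: eq_bigr => l _.
by rewrite /err_mx block_mxEul block_mxEur block_mxEdl block_mxEdr !mxE /sqmod; ring.
Qed.

Lemma intg_frob2_err_mx : intg P (fun w => frob2 (err_mx w)).
Proof.
under [X in intg _ X]funext do rewrite frob2_err_mx.
apply: intgZ; apply: intg_sum => j; apply: intg_sum => l.
exact: (intg_sqmod M_haar (lie_tr_quad (A j) (A l))).
Qed.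

Lemma rint_frob2_err_mx : rint P (fun w => frob2 (err_mx w)) <= 16 * k%:R ^+ 2.
Proof.
have i0 j l : intg P (fun w => sqmod (quad_tr w j l)).
  exact: (intg_sqmod M_haar (lie_tr_quad (A j) (A l))).
rewrite (eq_rint _ frob2_err_mx) rintZ; last first.
  by apply: intg_sum => j; exact: intg_sum.
rewrite rint_sum => [|j]; last exact: intg_sum.
(* The 2 is there because each real and each imaginary part occurs in two blocks; 8 is the bound of
   [haar_quad_bound]. *)
rewrite (_ : 16 = 2 * 8 :> R); last by ring.
rewrite -mulrA ler_pM2l//; apply: le_trans (_ : \sum_(j < k) \sum_(l < k) 8 <= _).
  apply: ler_sum => j _; rewrite rint_sum//; apply: ler_sum => l _.
  apply: (@haar_quad_bound _ _ _ _ _ _ M_haar (A j) (A l) (j == l)) => //.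
  - by rewrite A_orth eqxx mulr1.
  - by rewrite A_orth eqxx mulr1.
  - by rewrite A_orth eq_sym.
by rewrite !sumr_const !card_ord -[leLHS]mulr_natr -[X in X * _]mulr_natr expr2 mulrA.
Qed.

Lemma lie_trace_dot v : lie_diff (fun X => \tr (X *m lin_comb v)) (fun X Y => \tr (Y *m X *m lin_comb v)).
Proof. exact: lie_tr_mul. Qed.

Lemma measurable_trace_vec i : measurable_fun setT (fun w => realify (trace_vec w) ord0 i).
Proof.
have -> : (fun w => realify (trace_vec w) ord0 i) =
    (fun w => complex.Re (\tr (M w *m lin_comb (delta_mx ord0 i)))).
  by apply/funext => w; rewrite -dot_trace_vec dot_delta.
have [+ _] := cintg_lie M_haar (lie_trace_dot (delta_mx ord0 i)).
exact: intg_measurable.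
Qed.

Lemma dot_trace_vec_bounded v : exists c : R, forall w, `|dot v (realify (trace_vec w))| <= c.
Proof.
have [_ [K HK] _ _ _] := lie_trace_dot v.
exists (complex.Re K) => w; rewrite dot_trace_vec; apply: ler_norm_Re; apply: HK.
exact: (haar_unitary M_haar).
Qed.

Lemma trace_vec_stein v (th : R) :
  n%:R * rint P (fun w => sin (dot v (realify (trace_vec w)) + th) * dot v (realify (trace_vec w))) =
  2^-1 * rint P (fun w => cos (dot v (realify (trace_vec w)) + th) *
    (n%:R * dot v v - dot v (v *m err_mx w))).
Proof.
have := haar_stein M_haar (lin_comb v) th.
rewrite (eq_rint _ (_ : _ =1 (fun w => sin (dot v (realify (trace_vec w)) + th) *
   dot v (realify (trace_vec w))))) => [->|w]; last by rewrite dot_trace_vec.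
congr (_ * _); apply: eq_rint => w.
by rewrite dot_trace_vec tr_lin_comb quad_lin_comb.
Qed.

End trace_vector.

(** * Derivative of a characteristic function *)

Section characteristic_derivative.
Context (R : realType) d (T : measurableType d) (P : probability T R).
Variables (l : T -> R) (K b : R).
Hypothesis ml : measurable_fun setT l.
Hypothesis lK : forall w, `|l w| <= K.

Lemma measurable_scaled_shift s : measurable_fun setT (fun w => s * l w + b).
Proof. by apply: measurable_funD => //; apply: measurable_funM. Qed.

Lemma intg_cos_scaled s : intg P (fun w => cos (s * l w + b)).
Proof.
apply: (@intg_bounded _ _ _ _ _ 1) => [|w]; last exact: cos_max.
by apply: measurableT_comp; [exact: measurable_cos|exact: measurable_scaled_shift].
Qed.

Lemma intg_sin_scaled s : intg P (fun w => sin (s * l w + b) * l w).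
Proof.
apply: (@intg_bounded _ _ _ _ _ K) => [|w].
  apply: measurable_funM => //.
  by apply: measurableT_comp; [exact: measurable_sin|exact: measurable_scaled_shift].
by rewrite normrM -[leRHS]mul1r ler_pM// sin_max.
Qed.

Lemma is_derive_rint_cos s : is_derive s (1 : R) (fun t => rint P (fun w => cos (t * l w + b)))
  (- rint P (fun w => sin (s * l w + b) * l w)).
Proof.
apply: (@is_derive_quadratic _ _ _ _ (K ^+ 2)) => y _.
have iB : intg P (fun w => cos ((s + y) * l w + b) - cos (s * l w + b)).
  by apply: intgB; exact: intg_cos_scaled.
have iS : intg P (fun w => y * (sin (s * l w + b) * l w)).
  by apply: intgZ; exact: intg_sin_scaled.
have -> : rint P (fun w => cos ((s + y) * l w + b)) - rint P (fun w => cos (s * l w + b)) -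
    y * - rint P (fun w => sin (s * l w + b) * l w) =
    rint P (fun w => cos ((s + y) * l w + b) - cos (s * l w + b) + y * (sin (s * l w + b) * l w)).
  rewrite (rintD iB iS) rintB; [|exact: intg_cos_scaled..].
  by rewrite mulrN opprK (rintZ y (intg_sin_scaled s)).
rewrite -[leRHS](rint_cst P); apply: rint_norm_le.
- exact: intgD.
- exact: intg_cst.
- move=> w.
  have -> : cos ((s + y) * l w + b) - cos (s * l w + b) + y * (sin (s * l w + b) * l w) =
      cos ((s * l w + b) + y * l w) - cos (s * l w + b) + (y * l w) * sin (s * l w + b).
    by rewrite (_ : (s + y) * l w + b = s * l w + b + y * l w); ring.
  apply: le_trans (cos_remainder _ _) _.
  rewrite exprMn mulrC ler_wpM2r ?sqr_ge0//.
  by rewrite -real_normK ?num_real// lerXn2r ?nnegrE// (le_trans _ (lK w)).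
Qed.

End characteristic_derivative.

(** * Interpolation between the trace vector and the Gaussian vector *)

Section comparison.
Context (R : realType) d (T : measurableType d) (P : probability T R) (n k : nat).
Local Notation C := R[i].
Variable M : T -> 'M[C]_n.
Hypothesis M_haar : haar_random_unitary P M.
Variable A : 'I_k -> 'M[C]_n.
Hypothesis A_orth : forall i j : 'I_k, \tr (A i *m (A j)^t*) = n%:R * (i == j)%:R.
Hypothesis n_gt0 : (0 < n)%N.
Hypothesis k_gt0 : (0 < k)%N.
Context d' (T' : measurableType d') (P' : probability T' R).
Variable X : T' -> 'rV[R]_(k + k).
Hypothesis X_gauss : gaussian_vector P' X 0 (2^-1)%:M.
Variables (I : finType) (a : I -> R) (xi : I -> 'rV[R]_(k + k)) (th : I -> R).
Variable L : R.
Hypothesis L_ge0 : 0 <= L.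
Hypothesis grad_le : forall x v, trig_grad a xi th x v <= L * euclidean_norm v.

Local Notation W w := (realify (trace_vec M A w)).

Lemma measurable_dot_trace_vec v : measurable_fun setT (fun w => dot v (W w)).
Proof. by apply: measurable_dot => i; exact: measurable_trace_vec M_haar _ _. Qed.

(** The factor by which averaging over cos al [X] multiplies the i-th cosine, as in
    [trig_poly_gauss]. In [phi] this averaging is already carried out, so only expectations over [W]
    remain. *)
Let E al i : R := expR (- 4^-1 * cos al ^+ 2 * dot (xi i) (xi i)).
Let Cf i s : R := rint P (fun w => cos (s * dot (xi i) (W w) + th i)).
Let Sf i s : R := rint P (fun w => sin (s * dot (xi i) (W w) + th i) * dot (xi i) (W w)).
Let Q i s : R := rint P (fun w => cos (s * dot (xi i) (W w) + th i) *
  dot (xi i) (xi i *m err_mx M A w)).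
Let phi al : R := \sum_i a i * (E al i * Cf i (sin al)).
Let dphi al : R := \sum_i a i * (E al i * (- Sf i (sin al) * cos al) +
  Cf i (sin al) * (E al i * (2^-1 * dot (xi i) (xi i) * cos al * sin al))).

Let is_derive_phi al : is_derive al (1 : R) phi (dphi al).
Proof.
apply: is_derive_bigsum => i.
have [K lK] := dot_trace_vec_bounded M_haar A (xi i).
have dC := is_derive_compE (is_derive_rint_cos P (th i) (measurable_dot_trace_vec (xi i)) lK (sin al)) (is_derive_sin al).
have dE : is_derive al (1 : R) (fun y => E y i) (E al i * (2^-1 * dot (xi i) (xi i) * cos al * sin al)).
  have := is_derive_compE (is_derive_expR_sqr (- 4^-1 * dot (xi i) (xi i)) (cos al)) (is_derive_cos al).
  rewrite (_ : (fun y => _) = (fun y => E y i)); last first.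
    by apply/funext => y; congr expR; ring.
  move=> /is_derive_eqE; apply; rewrite /E.
  rewrite [X in expR X](_ : _ = - 4^-1 * cos al ^+ 2 * dot (xi i) (xi i)); last ring.
  by field.
apply: is_derive_eqE (is_derive_mulE (is_derive_cst _ _ _) (is_derive_mulE dE dC)) _.
by rewrite /= mulr0 addr0.
Qed.

Let intg_quad i s : intg P (fun w => cos (s * dot (xi i) (W w) + th i) *
  dot (xi i) (xi i *m err_mx M A w)).
Proof.
have [K lK] := dot_trace_vec_bounded M_haar A (xi i).
rewrite (_ : (fun w => _) = (fun w => dot (xi i) (xi i *m err_mx M A w) *
  cos (s * dot (xi i) (W w) + th i))); last by apply/funext => w; rewrite mulrC.
apply: (@intgMl _ _ _ _ _ _ 1) => [||w]; last exact: cos_max.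
  rewrite (_ : (fun w => _) = (fun w => complex.Re (\tr (M w *m lin_comb A (xi i) *m M w *m lin_comb A (xi i))))).
    by have [] := cintg_lie M_haar (lie_tr_quad (lin_comb A (xi i)) (lin_comb A (xi i))).
  by apply/funext => w; rewrite quad_lin_comb.
apply: measurableT_comp; first exact: measurable_cos.
by apply: measurable_scaled_shift; exact: measurable_dot_trace_vec.
Qed.

(* The Stein identity for the direction s xi, divided by s. *)
Let stein i s : s != 0 ->
  2^-1 * dot (xi i) (xi i) * s * Cf i s - Sf i s = 2^-1 * s * Q i s / n%:R.
Proof.
move=> s0; have n0 : n%:R != 0 :> R by rewrite pnatr_eq0 -lt0n.
have [K lK] := dot_trace_vec_bounded M_haar A (xi i).
have ml := measurable_dot_trace_vec (xi i).
have H := trace_vec_stein M_haar A_orth (s *: xi i) (th i).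
rewrite (eq_rint _ (_ : _ =1 (fun w => s * (sin (s * dot (xi i) (W w) + th i) * dot (xi i) (W w))))) in H; last first.
  by move=> w; rewrite dotZl; ring.
rewrite rintZ in H; last exact: intg_sin_scaled lK _.
rewrite -/(Sf i s) in H.
rewrite (eq_rint _ (_ : _ =1 (fun w => n%:R * s ^+ 2 * dot (xi i) (xi i) *
   cos (s * dot (xi i) (W w) + th i) - s ^+ 2 * (cos (s * dot (xi i) (W w) + th i) *
  dot (xi i) (xi i *m err_mx M A w))))) in H; last first.
  by move=> w; rewrite -scalemxAl !dotZl !dotZr; ring.
rewrite (rintB (intgZ _ (intg_cos_scaled P (th i) ml s)) (intgZ _ (intg_quad i s))) in H.
rewrite (rintZ _ (intg_cos_scaled P (th i) ml s)) (rintZ _ (intg_quad i s)) in H.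
rewrite -/(Cf i s) -/(Q i s) mulrA in H.
apply: (mulfI (mulf_neq0 n0 s0)); rewrite mulrBr H; field.
exact: n0.
Qed.

(** By [stein] the terms in [Cf] and [Sf] combine into the error term [Q], with a factor sin al / (2
    n). The factor cos al from the chain rule is the parameter [s] that [trig_hess_gauss] requires
    in front of the Hessian. *)
Let dphi_le al : 0 < sin al -> `|dphi al| <= 3 * L * k%:R / n%:R.
Proof.
move=> s0; set s := sin al; set c := cos al.
have n0 : 0 < n%:R :> R by rewrite ltr0n.
have k0 : 0 < k%:R :> R by rewrite ltr0n.
pose q w := c * \sum_i a i * (cos (dot (xi i) (s *: W w) + th i) *
  expR (- 4^-1 * c ^+ 2 * dot (xi i) (xi i)) * dot (xi i) (xi i *m err_mx M A w)).
pose q' w := c * \sum_i a i * (E al i * (cos (s * dot (xi i) (W w) + th i) *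
   dot (xi i) (xi i *m err_mx M A w))).
have qq' : q =1 q'.
  by move=> w; congr (_ * _); apply: eq_bigr => i _; rewrite dotZr /E -/c; ring.
have iq' : intg P q'.
  by apply: intgZ; apply: intg_sum => i; apply: intgZ; apply: intgZ.
have -> : dphi al = s / (2 * n%:R) * rint P q.
  rewrite (eq_rint _ qq') rintZ; last by apply: intg_sum => i; apply: intgZ; apply: intgZ.
  rewrite rint_sum => [|i]; last by apply: intgZ; apply: intgZ.
  rewrite mulrA mulr_sumr; apply: eq_bigr => i _.
  rewrite rintZ ?rintZ//; last by apply: intgZ.
  rewrite -/(Q i s) -/s -/c.
  have s0' : s != 0 by rewrite gt_eqF.
  transitivity (a i * (E al i * (c * (2^-1 * dot (xi i) (xi i) * s * Cf i s - Sf i s)))); first ring.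
  by rewrite stein//; field; rewrite gt_eqF.
have sn0 : 0 <= s / (2 * n%:R) by rewrite divr_ge0 ?ltW// mulr_gt0.
rewrite normrM ger0_norm//.
(* The parameter de = 3 k is close to sqrt 8 k, which minimizes de + 16 k^2 / (2 de); it gives 17 k
   / 3, hence at most 6 k. *)
have qle : `|rint P q| <= L * (3 * k%:R + (6 * k%:R)^-1 * (16 * k%:R ^+ 2)).
  have if2 := intg_frob2_err_mx M_haar A.
  apply: (@le_trans _ _ (rint P (fun w => L * (3 * k%:R + (6 * k%:R)^-1 * frob2 (err_mx M A w))))).
    apply: rint_norm_le.
    - by rewrite (_ : q = q') //; apply/funext.
    - by apply: intgZ; apply: intgD; [exact: intg_cst|exact: intgZ].
    - move=> w; have de0 : 0 < 3 * k%:R :> R by rewrite mulr_gt0.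
      have := trig_hess_gauss X_gauss (err_mx M A w) c (s *: W w) de0 L_ge0 grad_le.
      rewrite -/(q w) => /le_trans; apply.
      by rewrite ler_wpM2l// lerD2l mulrC mulrA -natrM.
  rewrite rintZ; last by apply: intgD; [exact: intg_cst|exact: intgZ].
  rewrite rintD; [|exact: intg_cst|exact: intgZ].
  rewrite rint_cst rintZ// ler_wpM2l// lerD2l ler_wpM2l ?invr_ge0 ?mulr_ge0//.
  exact: rint_frob2_err_mx.
apply: (@le_trans _ _ ((2 * n%:R)^-1 * (L * (6 * k%:R)))); last first.
  rewrite le_eqVlt; apply/orP; left; apply/eqP; field; by rewrite gt_eqF.
apply: ler_pM => //.
  rewrite -[leRHS]mul1r ler_wpM2r ?invr_ge0 ?mulr_ge0//; exact: sin_le1.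
apply: le_trans qle _; rewrite ler_wpM2l//.
have -> : (6 * k%:R)^-1 * (16 * k%:R ^+ 2) = 8 / 3 * k%:R :> R by field; rewrite gt_eqF.
lra.
Qed.

Lemma trig_poly_comparison :
  `|rint P (fun w => trig_poly a xi th (W w)) - rint P' (fun w => trig_poly a xi th (X w))|
  <= 6 * L * k%:R / n%:R.
Proof.
have -> : rint P (fun w => trig_poly a xi th (W w)) = phi (pi / 2).
  rewrite /phi sin_pihalf rint_sum => [|i].
    apply: eq_bigr => i _; rewrite /E cos_pihalf.
    rewrite (_ : - 4^-1 * 0 ^+ 2 * _ = 0); last by rewrite expr0n/= mulr0 mul0r.
    rewrite expR0 mul1r rintZ.
      by congr (_ * _); apply: eq_rint => w; rewrite mul1r.
    under [X in intg _ X]funext do rewrite -[dot _ _]mul1r.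
    by apply: intg_cos_scaled; exact: measurable_dot_trace_vec.
  apply: intgZ.
  under [X in intg _ X]funext do rewrite -[dot _ _]mul1r.
  by apply: intg_cos_scaled; exact: measurable_dot_trace_vec.
have -> : rint P' (fun w => trig_poly a xi th (X w)) = phi 0.
  rewrite (eq_rint _ (_ : _ =1 (fun w => trig_poly a xi th (0 + 1 *: X w)))); last first.
    by move=> w; rewrite add0r scale1r.
  rewrite (trig_poly_gauss X_gauss) /phi sin0; apply: eq_bigr => i _.
  rewrite /E cos0 /Cf (eq_rint _ (_ : _ =1 (fun=> cos (th i)))); last first.
    by move=> w; rewrite mul0r add0r.
  have -> : dot (xi i) 0 = 0 by rewrite -(scale0r 0) dotZr mul0r.
  by rewrite rint_cst add0r; ring.
have pi0 : 0 < pi / 2 :> R by rewrite divr_gt0// pi_gt0.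
(* The mean value point is interior, so sin c > 0 as the bound on [dphi] demands; pi / 2 <= 2 turns
   3 L into 6 L. *)
have [c /itvP cin ->] := MVT pi0 (fun x _ => is_derive_phi x)
  (continuous_subspaceT (is_derive_continuous is_derive_phi)).
rewrite subr0 normrM (ger0_norm (ltW pi0)).
have -> : 6 * L * k%:R / n%:R = 3 * L * k%:R / n%:R * 2 :> R by ring.
apply: ler_pM; [exact: normr_ge0|exact: ltW| |exact/ltW/pihalf_lt2].
by apply: dphi_le; apply: sin_gt0_pihalf; rewrite !cin.
Qed.

End comparison.

Lemma expectation_rint (R : realType) d (T : measurableType d) (P : probability T R) (f : T -> R) :
  intg P f -> 'E_P[f]%E = (rint P f)%:E.
Proof.
by move=> fi; rewrite unlock /rint /Rintegral fineK//; exact: integrable_fin_num.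
Qed.

Definition unrealify (R : realType) (k : nat) (x : 'rV[R]_(k + k)) : 'rV[R[i]]_k :=
  \row_j Complex (x ord0 (lshift k j)) (x ord0 (rshift k j)).

Lemma realifyK (R : realType) (k : nat) : cancel (@realify R k) (@unrealify R k).
Proof.
move=> z; apply/rowP => j; rewrite mxE row_mxEl row_mxEr !mxE.
by case: (z ord0 j).
Qed.

Lemma unrealifyK (R : realType) (k : nat) : cancel (@unrealify R k) (@realify R k).
Proof.
move=> x; apply/rowP => j; rewrite /realify -[RHS](congr1 (fun y : 'rV_(k + k) => y ord0 j) (hsubmxK x)).
by congr (row_mx _ _ _ _); apply/rowP => i; rewrite !mxE.
Qed.

(** * From trigonometric polynomials to Lipschitz functions *)

Section lipschitz_comparison.
Context (R : realType) d (T : measurableType d) (P : probability T R) (n k : nat).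
Local Notation C := R[i].
Variable M : T -> 'M[C]_n.
Hypothesis M_haar : haar_random_unitary P M.
Variable A : 'I_k -> 'M[C]_n.
Hypothesis A_orth : forall i j : 'I_k, \tr (A i *m (A j)^t*) = n%:R * (i == j)%:R.
Hypothesis n_gt0 : (0 < n)%N.
Hypothesis k_gt0 : (0 < k)%N.
Context d' (T' : measurableType d') (P' : probability T' R).
Variable X : T' -> 'rV[R]_(k + k).
Hypothesis X_gauss : gaussian_vector P' X 0 (2^-1)%:M.

Local Notation W w := (realify (trace_vec M A w)).

Lemma intg_dot_trace_vec_self : intg P (fun w => dot (W w) (W w)).
Proof.
have -> : (fun w => dot (W w) (W w)) = (fun w => \sum_i dot (delta_mx ord0 i) (W w) * dot (delta_mx ord0 i) (W w)).
  by apply/funext => w; apply: eq_bigr => i _; rewrite dot_delta.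
apply: intg_sum => i; have [K lK] := dot_trace_vec_bounded M_haar A (delta_mx ord0 i).
have ml := measurable_dot_trace_vec M_haar A (delta_mx ord0 i).
by apply: (@intgMl _ _ _ _ _ _ K) => //; exact: (intg_bounded P ml lK).
Qed.

Variable g : 'rV[R]_(k + k) -> R.
Hypothesis g_lip : forall x y, `|g x - g y| <= euclidean_norm (x - y).

Lemma intg_lipschitz_trace_vec : intg P (fun w => g (W w)).
Proof.
apply: intg_lipschitz => // [i|]; first exact: (measurable_trace_vec M_haar).
exact: intg_dot_trace_vec_self.
Qed.

Lemma intg_lipschitz_gauss : intg P' (fun w => g (X w)).
Proof.
apply: intg_lipschitz => //; first exact: X_gauss.1.
exact: (intg_dot_gauss_self X_gauss).
Qed.

Lemma lipschitz_comparison :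
  `|rint P (fun w => g (W w)) - rint P' (fun w => g (X w))| <= 12 * k%:R / n%:R.
Proof.
set m1 := rint P (fun w => dot (W w) (W w)); set m2 := rint P' (fun w => dot (X w) (X w)).
have approx_rint e (S : measurableType e) (Q : probability S R) (Y : S -> 'rV[R]_(k + k)) (p : 'rV[R]_(k + k) -> R) eta :
    intg Q (fun w => dot (Y w) (Y w)) -> intg Q (fun w => g (Y w)) ->
    measurable_fun setT (fun w => p (Y w)) ->
    (forall x, `|p x - g x| <= eta * (1 + dot x x)) ->
    `|rint Q (fun w => p (Y w)) - rint Q (fun w => g (Y w))| <= eta * (1 + rint Q (fun w => dot (Y w) (Y w))).
  move=> iY ig mp pg.
  have ir : intg Q (fun w => eta * (1 + dot (Y w) (Y w))).
    by apply: intgZ; apply: intgD => //; exact: intg_cst.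
  have ipg : intg Q (fun w => p (Y w) - g (Y w)).
    apply: (intg_le _ _ ir) => //; apply: measurable_funB => //; exact: intg_measurable ig.
  have ip : intg Q (fun w => p (Y w)).
    rewrite (_ : (fun w => _) = (fun w => p (Y w) - g (Y w) + g (Y w))); first exact: intgD.
    by apply/funext => w; rewrite subrK.
  rewrite -rintB// -[X in _ * (X + _)](rint_cst Q) -rintD ?intg_cst//.
  rewrite -rintZ; last by apply: intgD => //; exact: intg_cst.
  exact: rint_norm_le.
(* The two approximation errors are eta (1 + m1) and eta (1 + m2), which add up to [e]. *)
apply/ler_addgt0Pr => e e0; pose eta := e / (2 + m1 + m2).
have m10 : 0 <= m1 by apply: rint_ge0 => w; exact: dot_ge0.
have m20 : 0 <= m2 by apply: rint_ge0 => w; exact: dot_ge0.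
have m0 : 0 < 2 + m1 + m2 by lra.
have eta0 : 0 < eta by rewrite divr_gt0.
have [I [a [xi [th [pg grad_le]]]]] := trig_approx g_lip eta0.
have mW i : measurable_fun setT (fun w => W w ord0 i) by exact: (measurable_trace_vec M_haar).
have H1 := approx_rint _ _ P _ _ _ intg_dot_trace_vec_self intg_lipschitz_trace_vec
  (measurable_trig_poly mW a xi th) pg.
have H2 := approx_rint _ _ P' _ _ _ (intg_dot_gauss_self X_gauss) intg_lipschitz_gauss
  (measurable_trig_poly X_gauss.1 a xi th) pg.
(* The gradient bound L = 2 of [trig_approx] gives the final constant 6 * 2 = 12. *)
have H3 := trig_poly_comparison M_haar A_orth n_gt0 k_gt0 X_gauss (ler0n R 2) grad_le.
rewrite -/m1 in H1; rewrite -/m2 in H2.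
have -> : e = eta * (1 + m1) + eta * (1 + m2) by rewrite /eta; field; rewrite gt_eqF.
rewrite (_ : 6 * 2 * k%:R / n%:R = 12 * k%:R / n%:R) in H3; last by ring.
move: H1 H2 H3; set p1 := rint P _; set p2 := rint P' _; set q1 := rint P _; set q2 := rint P' _.
rewrite !ler_norml => /andP[? ?] /andP[? ?] /andP[? ?]; apply/andP; split; lra.
Qed.
End lipschitz_comparison.

Theorem theorem13 (R : realType) :
  exists c : R, forall (n k : nat), (0 < n)%N -> (0 < k)%N ->
  forall (d : measure_display) (T : measurableType d) (P : probability T R)
    (M : T -> 'M[R[i]]_n) (A : 'I_k -> 'M[R[i]]_n)
    (d' : measure_display) (T' : measurableType d') (P' : probability T' R)
    (Z : T' -> 'rV[R[i]]_k),
  haar_random_unitary P M ->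
  (forall i j : 'I_k, \tr (A i *m (A j)^t*) = n%:R * (i == j)%:R) ->
  standard_complex_gaussian P' Z ->
  (dW P (fun w => \row_(j < k) \tr (A j *m M w)) P' Z
     <= (c * k%:R / n%:R)%:E)%E.
Proof.
exists 12 => n k n0 k0 d T P M A d' T' P' Z M_haar A_orth Z_gauss.
rewrite -[fun w => _]/(trace_vec M A).
apply: ge_ereal_sup => _ [g g_lip <-].
pose h x := g (unrealify x).
have h_lip x y : `|h x - h y| <= euclidean_norm (x - y).
  by have := g_lip (unrealify x) (unrealify y); rewrite !unrealifyK.
have gW : g \o trace_vec M A = (fun w => h (realify (trace_vec M A w))).
  by apply/funext => w; rewrite /h realifyK.
have gZ : g \o Z = (fun w => h (realify (Z w))).
  by apply/funext => w; rewrite /h realifyK.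
(* Expectations take extended real values; integrability makes both finite, so that their difference
   is one of real numbers. *)
rewrite gW gZ expectation_rint; last exact: (intg_lipschitz_trace_vec M_haar).
rewrite expectation_rint; last exact: (intg_lipschitz_gauss Z_gauss).
by rewrite -EFinB abse_EFin lee_fin; exact: (lipschitz_comparison M_haar A_orth n0 k0 Z_gauss h_lip).
Qed.
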